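(* Consider the full discretization $\{u^M_n\}_{M,n\in\mathbb N}$ with temporal stepsize $\tau$ of the stochastic linear Schr\''odinger equation, determined by functions $A:(0,\infty)\to\mathbb R^{2\times2}$ and $B:(0,\infty)\to\mathbb R^2$ as described in the context, and put $B^M_N=\frac{u^M_N}{N\tau}$. Assume: (i) there is $h_1>0$ such that $4\det(A(h))-(\mathrm{tr}(A(h)))^2>0$ for all $0<h<h_1$; (ii) there is $h_2>0$ such that $\det(A(h))=1$ for all $0<h<h_2$; (iii) as $h\to0$, $|a_{11}(h)-1|+|a_{22}(h)-1|+|a_{12}(h)-h|+|a_{21}(h)+h|=\mathcal O(h^2)$ and $|b_1(h)|+|b_2(h)-1|=\mathcal O(h)$. Then: (1) For each fixed $M\in\mathbb N$ with $\eta_M>0$ and for all sufficiently small stepsizes $\tau$, $\{B^M_N\}_{N\in\mathbb N}$ satisfies an LDP (as $N\to\infty$, with speed $N$) on $H^0=L^2(0,\pi;\mathbb C)$ with the good rate function given, for $x\in H_M$, by $$I^{M,\tau}(x)=\sum_{k=1}^M\frac{\tau\left(4-(\mathrm{tr}(A(k^2\tau)))^2\right)}{4\left[a(k^2\tau)b(k^2\tau)-c^2(k^2\tau)\right]\alpha_k^2}\Big[b(k^2\tau)(\Re\langle x,e_k\rangle_{\mathbb C})^2+a(k^2\tau)(\Im\langle x,e_k\rangle_{\mathbb C})^2+2c(k^2\tau)\Re\langle x,e_k\rangle_{\mathbb C}\,\Im\langle x,e_k\rangle_{\mathbb C}\Big],$$ and $I^{M,\tau}(x)=+\infty$ for $x\notin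 H_M$. (2) For each fixed $M\in\mathbb N$ with $\eta_M>0$, $\{u^M_N\}_{N\in\mathbb N}$ asymptotically preserves the LDP of $\{B^M_T\}_{T>0}$, i.e. the modified rate function $I^{M,\tau}_{mod}:=I^{M,\tau}/\tau$ satisfies $\lim_{\tau\to0}I^{M,\tau}_{mod}(x)=I^M(x)$ for every $x\in H^0$. (3) $\{u^M_n\}_{M,n\in\mathbb N}$ weakly asymptotically preserves the LDP of $\{B_T\}_{T>0}$, i.e. for each $x\in Q^{\frac12}(H^0)$ and $\varepsilon>0$ there exist $x_0\in H^0$, $M\in\mathbb N$ and $\tau>0$ (within the range of sufficiently small stepsizes for which $\{B^M_N\}_{N\in\mathbb N}$ satisfies an LDP on $H^0$, with rate function denoted $I^{M,\tau}$) such that $$\|x-x_0\|_{H^0}<\varepsilon,\qquad|I(x)-I^{M,\tau}_{mod}(x_0)|<\varepsilon.$$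
   Context: Notation: $\bm{i}$ is the imaginary unit; $H^0=L^2(0,\pi;\mathbb C)$, $U^0=L^2(0,\pi;\mathbb R)$, $U^1=H^1(0,\pi;\mathbb R)$, $H^1_0(0,\pi)=\{f\in H^1(0,\pi;\mathbb C): f(0)=f(\pi)=0\}$; $\langle f,g\rangle_{\mathbb C}=\int_0^\pi f\bar g\,dx$. Continuous equation: $\alpha>0$; $\Delta$ is the Dirichlet Laplacian on $(0,\pi)$; $e_k(x)=\sqrt{2/\pi}\,\sin(kx)$. $Q$ is a nonnegative symmetric operator on $U^0$ with $Qe_k=\eta_ke_k$ for a non-increasing sequence $\{\eta_k\}$ of nonnegative reals, and $Q^{1/2}$ is Hilbert--Schmidt from $U^0$ to $U^1$; $Q$ is extended to $H^0$ by $Qf=Q(\Re f)+\bm{i}Q(\Im f)$. $W(t)=\sum_{k\ge1}\sqrt{\eta_k}\,\beta_k(t)e_k$ with independent standard real Brownian motions $\beta_k$. The equation is $du=\bm{i}\Delta u\,dt+\bm{i}\alpha\,dW(t)$, $u(0)=u_0\in H^1_0(0,\pi)$ deterministic, understood in the mild sense; $B_T=u(T)/T$. Spatial Galerkin approximation: $H_M=\mathrm{span}_{\mathbb C}\{e_1,\dots,e_M\}$, $P_Mx=\sum_{k=1}^M\langle x,e_k\rangle_{\mathbb C}e_k$, $du^M=\bm{i}\Delta P_Mu^M\,dt+\bm{i}\alpha P_M\,dW$, $u^M(0)=P_Mu_0$; $B^M_T=u^M(T)/T$. Rate functions: $\{B_T\}_{T>0}$ and $\{B^M_T\}_{T>0}$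 satisfy LDPs on $H^0$ (as $T\to\infty$, speed $T$) with rate functions $I(x)=\frac1{\alpha^2}\|Q^{-1/2}x\|_{H^0}^2$ if $x\in Q^{1/2}(H^0)$, $+\infty$ otherwise, and $I^M(x)=\frac1{\alpha^2}\|Q_M^{-1/2}x\|_{H^0}^2$ if $x\in Q_M^{1/2}(H^0)$, $+\infty$ otherwise, where $Q_M=QP_M$ and $Q^{-1/2}x$ (resp. $Q_M^{-1/2}x$) is the minimal-norm $z$ in $H^0$ (resp. $H_M$) with $Q^{1/2}z=x$ (resp. $Q_M^{1/2}z=x$). Full discretization: let $A(h)=\begin{pmatrix} a_{11}(h) & a_{12}(h) \\ a_{21}(h) & a_{22}(h) \end{pmatrix}$, $B(h)=\begin{pmatrix} b_1(h) \\ b_2(h) \end{pmatrix}$ be real-valued functions of $h>0$ with $b_1^2(h)+b_2^2(h)\ne0$ for all sufficiently small $h$. Let $\tau>0$, $t_n=n\tau$, $\alpha_k=\alpha\sqrt{\eta_k}$, $\delta\beta_{k,n}=\beta_k(t_{n+1})-\beta_k(t_n)$. For $k=1,\dots,M$ define real sequences by $p^{M,k}_0+\bm{i}q^{M,k}_0=\langle u^M(0),e_k\rangle_{\mathbb C}$ and $$\begin{pmatrix} p^{M,k}_{n+1} \\ q^{M,k}_{n+1} \end{pmatrix}=A(k^2\tau)\begin{pmatrix} p^{M,k}_n \\ q^{M,k}_n \end{pmatrix}+\alpha_kB(k^2\tau)\,\delta\beta_{k,n},\qquad n=0,1,2,\dots,$$ and set $u^M_n=\sum_{k=1}^M(p^{M,k}_n+\bm{i}q^{M,k}_n)e_k$.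 The functions $a,b,c:(0,\infty)\to\mathbb R$ are (all evaluated at the same $h$) $$a=(a_{11}b_1+a_{12}b_2-b_1)^2+b_1(a_{11}b_1+a_{12}b_2)(2-\mathrm{tr}(A)),$$ $$b=(a_{21}b_1-a_{11}b_2+b_2)^2-b_2(a_{21}b_1-a_{11}b_2)(2-\mathrm{tr}(A)),$$ $$c=\tfrac12(a_{21}b_1-a_{11}b_2)b_1\mathrm{tr}(A)+b_1b_2\left(\tfrac12(\mathrm{tr}(A))^2-1\right)-(a_{11}b_1+a_{12}b_2)(a_{21}b_1-a_{11}b_2)-\tfrac12\mathrm{tr}(A)(a_{11}b_1+a_{12}b_2)b_2.$$ LDP: a rate function is a lower semicontinuous function into $[0,\infty]$; it is good if its level sets $\{I\le r\}$, $r\in[0,\infty)$, are compact. $\{Z_N\}_{N\in\mathbb N}$ satisfies an LDP on $H^0$ with rate function $I$ if $\liminf_{N\to\infty}\frac1N\ln\mathbf P(Z_N\in G)\ge-\inf_GI$ for all open $G$ and $\limsup_{N\to\infty}\frac1N\ln\mathbf P(Z_N\in C)\le-\inf_CI$ for all closed $C$ (and analogously with $T\to\infty$ in place of $N\to\infty$). *)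

(* Defs.v *)
From HB Require Import structures.
From mathcomp Require Import all_boot all_order all_algebra.
From mathcomp Require Import complex.
From mathcomp Require Import all_classical all_reals all_analysis.
From mathcomp Require Import measurable_realfun.
From mathcomp Require Import ring lra.

Set Implicit Arguments.
Unset Strict Implicit.
Unset Printing Implicit Defensive.
Import Order.TTheory GRing.Theory Num.Theory.
Import numFieldNormedType.Exports.
Local Open Scope classical_set_scope.
Local Open Scope ring_scope.

(* The library's [LspaceType] carries no algebraic structure, so L^2(mu) is built
   here as the quotient of [LfunType mu _] by almost everywhere equality, with
   its normed module structure. *)
Section RealL2.
Context d (T : measurableType d) (R : realType).
Variable mu : {measure set T -> \bar R}.

Definition L2fun := LfunType mu (lee1n 2 : (1%E <= 2%:E :> \bar R)%E).
HB.instance Definition _ := GRing.Lmodule.on L2fun.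

Definition L2eq (f g : L2fun) : bool :=
  `[< (f : T -> R) = (g : T -> R) %[ae mu] >].

Let L2eq_refl : reflexive L2eq.
Proof. by move=> f; apply/asboolP; exact: ae_eq_refl. Qed.

Let L2eq_sym : symmetric L2eq.
Proof. by move=> f g; apply/idP/idP => /asboolP h; apply/asboolP/ae_eq_sym. Qed.

Let L2eq_trans : transitive L2eq.
Proof.
by move=> f g h /asboolP gf /asboolP fh; apply/asboolP; exact: ae_eq_trans gf fh.
Qed.

Canonical L2eq_equiv := EquivRel L2eq L2eq_refl L2eq_sym L2eq_trans.

Definition L2 : Type := {eq_quot L2eq}%qT.
HB.instance Definition _ := Choice.on L2.
HB.instance Definition _ := EqQuotient.on L2.

Definition L2_of (f : L2fun) : L2 := \pi_L2%qT f.
Definition fun_of (x : L2) : L2fun := repr x.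

Lemma L2_ofP (f g : L2fun) :
  L2_of f = L2_of g <-> (f : T -> R) = (g : T -> R) %[ae mu].
Proof.
split=> [h|h].
  by have /eqP := h; rewrite eqmodE => /asboolP.
by apply/eqP; rewrite eqmodE; apply/asboolP.
Qed.

Lemma fun_ofK (x : L2) : L2_of (fun_of x) = x.
Proof. exact: reprK. Qed.

Lemma L2_ofK (f : L2fun) : (fun_of (L2_of f) : T -> R) = (f : T -> R) %[ae mu].
Proof. by apply/L2_ofP; rewrite fun_ofK. Qed.

Definition L2_add (x y : L2) := L2_of (fun_of x + fun_of y).
Definition L2_opp (x : L2) := L2_of (- fun_of x).
Definition L2_scale (a : R) (x : L2) := L2_of (a *: fun_of x).

Lemma L2_addE f g : L2_add (L2_of f) (L2_of g) = L2_of (f + g).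
Proof.
apply/L2_ofP; move: (L2_ofK f) (L2_ofK g).
by apply: filterS2 => t /(_ I) hf /(_ I) hg _; exact: (congr2 +%R hf hg).
Qed.

Lemma L2_oppE f : L2_opp (L2_of f) = L2_of (- f).
Proof.
by apply/L2_ofP; move: (L2_ofK f); apply: filterS => t /(_ I) hf _; exact: (congr1 -%R hf).
Qed.

Lemma L2_scaleE a f : L2_scale a (L2_of f) = L2_of (a *: f).
Proof.
by apply/L2_ofP; move: (L2_ofK f); apply: filterS => t /(_ I) hf _; exact: (congr1 ( *%R a) hf).
Qed.

Let L2_ind (P : L2 -> Prop) : (forall f, P (L2_of f)) -> forall x, P x.
Proof. by move=> h x; rewrite -(fun_ofK x). Qed.

Let L2_addA : associative L2_add.
Proof.
elim/L2_ind=> f; elim/L2_ind=> g; elim/L2_ind=> h.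
by rewrite !L2_addE addrA.
Qed.

Let L2_addC : commutative L2_add.
Proof. by elim/L2_ind=> f; elim/L2_ind=> g; rewrite !L2_addE addrC. Qed.

Let L2_add0 : left_id (L2_of 0) L2_add.
Proof. by elim/L2_ind=> f; rewrite L2_addE add0r. Qed.

Let L2_addN : left_inverse (L2_of 0) L2_opp L2_add.
Proof. by elim/L2_ind=> f; rewrite L2_oppE L2_addE addNr. Qed.

HB.instance Definition _ :=
  GRing.isZmodule.Build L2 L2_addA L2_addC L2_add0 L2_addN.

Let L2_scaleA a b x : L2_scale a (L2_scale b x) = L2_scale (a * b) x.
Proof. by elim/L2_ind: x => f; rewrite !L2_scaleE scalerA. Qed.

Let L2_scale1 : left_id 1 L2_scale.
Proof. by elim/L2_ind=> f; rewrite L2_scaleE scale1r. Qed.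

Let L2_scaleDr : right_distributive L2_scale +%R.
Proof.
move=> a; elim/L2_ind=> f; elim/L2_ind=> g.
by rewrite -[L2_of f + _]/(L2_add _ _) L2_addE !L2_scaleE scalerDr -L2_addE.
Qed.

Let L2_scaleDl x : {morph L2_scale^~ x : a b / a + b}.
Proof.
move=> a b; elim/L2_ind: x => f.
by rewrite !L2_scaleE scalerDl -L2_addE.
Qed.

HB.instance Definition _ := GRing.Zmodule_isLmodule.Build R L2
  L2_scaleA L2_scale1 L2_scaleDr L2_scaleDl.

Lemma L2_ofD f g : L2_of (f + g) = L2_of f + L2_of g.
Proof. by rewrite -L2_addE. Qed.

Lemma L2_ofZ a f : L2_of (a *: f) = a *: L2_of f.
Proof. by rewrite -L2_scaleE. Qed.

Definition L2norm (f : L2fun) : R := fine ('N[mu]_2%:E[EFin \o f])%E.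

Definition L2_norm (x : L2) : R := L2norm (fun_of x).

Lemma L2_normE f : L2_norm (L2_of f) = L2norm f.
Proof.
rewrite /L2_norm /L2norm unlock; congr (fine (_ `^ _)%E).
apply: ae_eq_integral => //.
- apply/measurable_EFinP.
  apply: (@measurableT_comp _ _ _ _ _ _ (@powR R ^~ 2)) => //.
  by apply: measurableT_comp => //; exact: measurable_funP.
- apply/measurable_EFinP.
  apply: (@measurableT_comp _ _ _ _ _ _ (@powR R ^~ 2)) => //.
  by apply: measurableT_comp => //; exact: measurable_funP.
by move: (L2_ofK f); apply: filterS => t + _ /= => ->.
Qed.

Let L2_normD x y : L2_norm (x + y) <= L2_norm x + L2_norm y.
Proof.
elim/L2_ind: x => f; elim/L2_ind: y => g.
by rewrite -L2_ofD !L2_normE; exact: ler_LnormD.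
Qed.

Let L2_normZ (a : R) x : L2_norm (a *: x) = `|a| * L2_norm x.
Proof.
elim/L2_ind: x => f; rewrite -L2_ofZ !L2_normE /L2norm.
by rewrite LnormZ -finite_norm_fine -EFinM.
Qed.

Let L2_norm0_eq0 x : L2_norm x = 0 -> x = 0.
Proof.
elim/L2_ind: x => f; rewrite L2_normE => /fine_Lnormr_eq0 f0.
by apply/L2_ofP.
Qed.

HB.instance Definition _ :=
  Lmodule_isNormed.Build R L2 L2_normD L2_normZ L2_norm0_eq0.

Lemma L2_normrE (x : L2) : `|x| = L2norm (fun_of x).
Proof. by []. Qed.

End RealL2.

Section H0.
Variable R : realType.

(* Lebesgue measure restricted to the interval (0, pi): [L2 mu0pi] is the real
   space L^2(0, pi). *)
Definition mu0pi := mrestr (@lebesgue_measure R) (measurable_itv `]0%R, (pi : R)[)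
  : {measure set _ -> \bar R}.

Definition U0 : normedModType R := L2 mu0pi.

Definition dot (x y : U0) : R := \int[mu0pi]_t (fun_of x t * fun_of y t).

Definition sine (k : nat) (t : R) : R := Num.sqrt (2 / pi) * sin (k%:R * t).

Lemma sine_Lfun k : sine k \in Lfun mu0pi 2%:E.
Proof.
have ms : measurable_fun [set: R] (sine k).
  apply: measurable_funM => //; apply: measurableT_comp.
    exact: (continuous_measurable_fun (@continuous_sin R)).
  exact: measurable_funM.
rewrite inE/=; apply/andP; split; first by rewrite inE.
rewrite inE/= /finite_norm unlock; apply: poweR_lty.
apply: (@le_lt_trans _ _ (\int[mu0pi]_(x in setT) (cst (powR (Num.sqrt (2 / pi)) 2)%:E x))%E).
  apply: ge0_le_integral => //.
  - by move=> x _; rewrite poweR_ge0.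
  - apply/measurable_EFinP.
    apply: (@measurableT_comp _ _ _ _ _ _ (@powR R ^~ 2)) => //.
    exact: measurableT_comp.
  move=> x _; rewrite -[leLHS]/(powR `|sine k x| 2)%:E lee_fin; apply: ge0_ler_powR => //; rewrite ?nnegrE//.
  rewrite /sine normrM ger0_norm// ler_piMr//.
  by rewrite ler_norml sin_geN1 sin_le1.
rewrite integral_cst//= /mrestr setTI lebesgue_measure_itv/= lte_fin pi_gt0.
by rewrite -EFinD -EFinM ltry.
Qed.

Definition e_ (k : nat) : U0 := L2_of (Lfun_Sub (lee1n 2) (sine_Lfun k)).

(* L^2(0, pi; C) is U0 + i U0: the pair (f, g) stands for f + i g. It gets the
   Hilbert norm rather than the library's sup norm on products, and is a normed
   module over R; [cscale] and [cdot] are the complex scaling and the complex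
   inner product, the latter antilinear in its second argument. *)
Definition H0_pair : Type := (U0 * U0)%type.
HB.instance Definition _ := GRing.Lmodule.on H0_pair.

Definition H0_norm (z : H0_pair) : R := Num.sqrt (`|z.1| ^+ 2 + `|z.2| ^+ 2).

Let H0_normD (z w : H0_pair) : H0_norm (z + w) <= H0_norm z + H0_norm w.
Proof.
rewrite /H0_norm /=.
have : `|z.1 + w.1| <= `|z.1| + `|w.1| := ler_normD _ _.
have : `|z.2 + w.2| <= `|z.2| + `|w.2| := ler_normD _ _.
have := normr_ge0 (z.1 + w.1); have := normr_ge0 (z.2 + w.2).
have := normr_ge0 z.1; have := normr_ge0 z.2.
have := normr_ge0 w.1; have := normr_ge0 w.2.
move: `|z.1 + w.1| `|z.2 + w.2| `|z.1| `|z.2| `|w.1| `|w.2|.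
move=> s t a b c d d0 c0 b0 a0 t0 s0 ht hs.
have P0 : 0 <= a ^+ 2 + b ^+ 2 by rewrite addr_ge0 ?sqr_ge0.
have Q0 : 0 <= c ^+ 2 + d ^+ 2 by rewrite addr_ge0 ?sqr_ge0.
have [p p0 [pE ->]] : exists2 p : R, 0 <= p &
    p ^+ 2 = a ^+ 2 + b ^+ 2 /\ Num.sqrt (a ^+ 2 + b ^+ 2) = p.
  by exists (Num.sqrt (a ^+ 2 + b ^+ 2)); [exact: sqrtr_ge0|rewrite sqr_sqrtr].
have [q q0 [qE ->]] : exists2 q : R, 0 <= q &
    q ^+ 2 = c ^+ 2 + d ^+ 2 /\ Num.sqrt (c ^+ 2 + d ^+ 2) = q.
  by exists (Num.sqrt (c ^+ 2 + d ^+ 2)); [exact: sqrtr_ge0|rewrite sqr_sqrtr].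
have pqE : (p * q) ^+ 2 = (a ^+ 2 + b ^+ 2) * (c ^+ 2 + d ^+ 2).
  by rewrite -pE -qE; ring.
have pq2 : (p + q) ^+ 2 =
    (a ^+ 2 + b ^+ 2) + (c ^+ 2 + d ^+ 2) + 2 * (p * q).
  by rewrite -pE -qE; ring.
have pq : a * c + b * d <= p * q.
  rewrite -ler_sqr ?nnegrE ?addr_ge0 ?mulr_ge0//.
  rewrite pqE -subr_ge0.
  rewrite [X in 0 <= X](_ : _ = (a * d - b * c) ^+ 2) ?sqr_ge0//; ring.
have hs2 : s ^+ 2 <= (a + c) ^+ 2 by rewrite ler_sqr ?nnegrE ?addr_ge0.
have ht2 : t ^+ 2 <= (b + d) ^+ 2 by rewrite ler_sqr ?nnegrE ?addr_ge0.
have h : s ^+ 2 + t ^+ 2 <= (p + q) ^+ 2.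
  rewrite (le_trans (lerD hs2 ht2))// pq2 -subr_ge0.
  rewrite [X in 0 <= X](_ : _ = 2 * (p * q - (a * c + b * d))); last by ring.
  by rewrite mulr_ge0// subr_ge0.
by rewrite (le_trans (ler_wsqrtr h))// sqrtr_sqr ger0_norm ?addr_ge0.
Qed.

Let H0_normZ (a : R) (z : H0_pair) : H0_norm (a *: z) = `|a| * H0_norm z.
Proof.
rewrite /H0_norm /= !normrZ !exprMn -mulrDr sqrtrM ?sqr_ge0//.
by rewrite sqrtr_sqr normr_id.
Qed.

Let H0_norm0_eq0 (z : H0_pair) : H0_norm z = 0 -> z = 0.
Proof.
move=> /eqP; rewrite sqrtr_eq0 => z0.
have : `|z.1| ^+ 2 + `|z.2| ^+ 2 == 0.
  by rewrite eq_le z0 addr_ge0 ?sqr_ge0.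
rewrite paddr_eq0 ?sqr_ge0// !sqrf_eq0 !normr_eq0 => /andP[/eqP z1 /eqP z2].
by rewrite [z]surjective_pairing z1 z2.
Qed.

HB.instance Definition _ :=
  Lmodule_isNormed.Build R H0_pair H0_normD H0_normZ H0_norm0_eq0.

Definition H0 : normedModType R := H0_pair.

Lemma H0_normrE (x : H0) : `|x| = H0_norm x.
Proof. by []. Qed.

Definition RePart (z : H0) : U0 := (z : U0 * U0).1.
Definition ImPart (z : H0) : U0 := (z : U0 * U0).2.
Definition mkH0 (x y : U0) : H0 := (x, y) : H0_pair.

Definition cscale (c : R[i]) (z : H0) : H0 :=
  mkH0 (complex.Re c *: RePart z - complex.Im c *: ImPart z)
       (complex.Re c *: ImPart z + complex.Im c *: RePart z).

Definition cdot (z w : H0) : R[i] :=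
  ((dot (RePart z) (RePart w) + dot (ImPart z) (ImPart w)) +i*
   (dot (ImPart z) (RePart w) - dot (RePart z) (ImPart w)))%C.

Definition ec_ (k : nat) : H0 := mkH0 (e_ k) 0.

End H0.

Arguments e_ {R} k.
Arguments ec_ {R} k.

Section Operators.
Variable R : realType.

Definition HM (M : nat) : set (H0 R) :=
  [set x | exists c : nat -> R[i],
     x = \sum_(1 <= k < M.+1) cscale (c k) (ec_ k)].

Definition PM (M : nat) (x : H0 R) : H0 R :=
  \sum_(1 <= k < M.+1) cscale (cdot x (ec_ k)) (ec_ k).

Definition cext (L : U0 R -> U0 R) (z : H0 R) : H0 R :=
  mkH0 (L (RePart z)) (L (ImPart z)).

(* [ip] is the inner product: [dot] on [U0] or [cdot] on [H0]. Over [R[i]],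
   [0 <= c] means that [c] is real and nonnegative. *)
Definition nonneg_symmetric (K : numDomainType) (V : Type) (ip : V -> V -> K)
    (L : V -> V) : Prop :=
  (forall x y, ip (L x) y = ip x (L y)) /\ (forall x, 0 <= ip (L x) x).

Definition is_sqrt_op (K : numDomainType) (V : Type) (ip : V -> V -> K)
    (S L : V -> V) : Prop :=
  nonneg_symmetric ip S /\ (forall x, S (S x) = L x).

Definition QM (Q : U0 R -> U0 R) (M : nat) (x : H0 R) : H0 R :=
  cext Q (PM M x).

(* The nonnegative symmetric square root of Q P_M. It is unique, and it exists
   when the [e_ k], k <= M, are eigenvectors of [Q] with nonnegative
   eigenvalues. *)
Definition QM12 (Q : U0 R -> U0 R) (M : nat) : H0 R -> H0 R :=
  xget (fun=> 0) [set S | is_sqrt_op (@cdot R) S (QM Q M)].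

(* The element of minimal norm in [D] that [S] sends to [x]. *)
Definition min_norm_preimage (D : set (H0 R)) (S : H0 R -> H0 R) (x : H0 R) :
    H0 R :=
  xget 0 [set z | [/\ D z, S z = x &
                      forall w, D w -> S w = x -> `|z| <= `|w| ]].

Definition op_rate (alpha : R) (D : set (H0 R)) (S : H0 R -> H0 R) (x : H0 R) :
    \bar R :=
  if `[< range S x >]
  then ((alpha ^+ 2)^-1 * `|min_norm_preimage D S x| ^+ 2)%:E
  else +oo%E.

Definition rate_I (alpha : R) (Q12 : U0 R -> U0 R) : H0 R -> \bar R :=
  op_rate alpha setT (cext Q12).

Definition rate_IM (alpha : R) (Q : U0 R -> U0 R) (M : nat) : H0 R -> \bar R :=
  op_rate alpha (HM M) (QM12 Q M).

End Operators.

Section Sobolev.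
Variable R : realType.

(* Smooth with compact support in (0, pi). *)
Definition test_function (phi : R -> R) : Prop :=
  (forall n x, derivable (derive1n n phi) x 1) /\
  (exists a b : R, [/\ 0 < a, b < pi &
     forall x, ~~ (a <= x <= b) -> phi x = 0]).

Definition weak_derivative (f g : U0 R) : Prop :=
  forall phi : R -> R, test_function phi ->
    \int[mu0pi R]_t (fun_of f t * derive1 phi t) =
    - \int[mu0pi R]_t (fun_of g t * phi t).

Definition in_U1 (f : U0 R) : Prop := exists g, weak_derivative f g.

Definition weak_deriv (f : U0 R) : U0 R := xget 0 [set g | weak_derivative f g].

Definition U1_norm (f : U0 R) : R :=
  Num.sqrt (`|f| ^+ 2 + `|weak_deriv f| ^+ 2).

(* Bounded from [U0] to [U1], with square-summable [U1]-norms along the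
   orthonormal basis [e_] of [U0]. *)
Definition hilbert_schmidt_U0_U1 (L : U0 R -> U0 R) : Prop :=
  [/\ forall f, in_U1 (L f),
      exists C : R, forall f, U1_norm (L f) <= C * `|f| &
      (\sum_(1 <= k <oo) (U1_norm (L (e_ k)) ^+ 2)%:E < +oo)%E].

(* The boundary values are those of the continuous representative. *)
Definition in_U1_0 (f : U0 R) : Prop :=
  in_U1 f /\
  exists v : R -> R, [/\ {within `[0, pi], continuous v},
    (\forall t \ae mu0pi R, v t = fun_of f t), v 0 = 0 & v pi = 0].

Definition in_H1_0 (u : H0 R) : Prop :=
  in_U1_0 (RePart u) /\ in_U1_0 (ImPart u).

End Sobolev.

Section Probability.
Context d (Omega : measurableType d) (R : realType) (P : probability Omega R).

Definition mutually_independent (I : choiceType) (F : I -> set (set Omega)) :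
    Prop :=
  forall (J : seq I) (E : I -> set Omega), uniq J ->
    (forall i, i \in J -> F i (E i)) ->
    P (\bigcap_(i in [set` J]) E i) = (\prod_(i <- J) P (E i))%E.

Definition sigma_rv (X : Omega -> R) : set (set Omega) :=
  preimage_set_system setT X measurable.

Definition sigma_process (W : R -> Omega -> R) : set (set Omega) :=
  <<s \bigcup_(t in [set t | 0 <= t]) sigma_rv (W t) >>.

(* The second parameter of [normal_prob] is the standard deviation. *)
Definition brownian_motion (W : R -> {RV P >-> R}) : Prop :=
  [/\ (\forall w \ae P, W 0 w = 0),
      forall t : nat -> R, 0 <= t 0%N -> (forall i, t i <= t i.+1) ->
        mutually_independent
          (fun i : nat => sigma_rv (fun w => W (t i.+1) w - W (t i) w)),
      forall s t : R, 0 <= s -> s < t ->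
        forall B : set R, measurable B ->
        P [set w | B (W t w - W s w)] = normal_prob 0 (Num.sqrt (t - s)) B &
      (\forall w \ae P, {within `[0, +oo[, continuous (fun t : R => W t w)})].

Section LargeDeviations.
Variable X : topologicalType.

Definition rate_function (J : X -> \bar R) : Prop :=
  (forall x, (0 <= J x)%E) /\ lower_semicontinuous J.

Definition good_rate_function (J : X -> \bar R) : Prop :=
  rate_function J /\
  forall r : R, 0 <= r -> compact [set x | (J x <= r%:E)%E].

Definition ldp (Z : nat -> Omega -> X) (J : X -> \bar R) : Prop :=
  [/\ rate_function J,
      forall G : set X, open G ->
        (- ereal_inf (J @` G) <=
         limn_einf (fun N : nat =>
           (N%:R^-1)%:E * lne (P [set w | G (Z N w)])))%E &
      forall C : set X, closed C ->
        (limn_esup (fun N : nat =>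
           (N%:R^-1)%:E * lne (P [set w | C (Z N w)])) <=
         - ereal_inf (J @` C))%E].

End LargeDeviations.

Section FullDiscretization.
(* [A] and [B] are only used at positive arguments; [eta] and [beta] only at
   indices k >= 1. *)
Variables (A : R -> 'M[R]_2) (B : R -> 'cV[R]_2).
Variables (alpha : R) (eta : nat -> R).
Variables (beta : nat -> R -> {RV P >-> R}) (u0 : H0 R).

Definition alpha_ (k : nat) : R := alpha * Num.sqrt (eta k).

Definition dbeta (tau : R) (k n : nat) (w : Omega) : R :=
  beta k (n.+1%:R * tau) w - beta k (n%:R * tau) w.

(* The column vector (p_n, q_n) of mode k. *)
Fixpoint pq (M : nat) (tau : R) (k n : nat) (w : Omega) : 'cV[R]_2 :=
  if n is n'.+1 then
    A (k%:R ^+ 2 * tau) *m pq M tau k n' w +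
    (alpha_ k * dbeta tau k n' w) *: B (k%:R ^+ 2 * tau)
  else
    \col_(i < 2) (if i == 0 then complex.Re (cdot (PM M u0) (ec_ k))
                  else complex.Im (cdot (PM M u0) (ec_ k))).

Definition full_disc (M : nat) (tau : R) (n : nat) (w : Omega) : H0 R :=
  \sum_(1 <= k < M.+1)
    cscale (pq M tau k n w 0 0 +i* pq M tau k n w 1 0)%C (ec_ k).

Definition BMN (M : nat) (tau : R) (N : nat) (w : Omega) : H0 R :=
  (N%:R * tau)^-1 *: full_disc M tau N w.

End FullDiscretization.

End Probability.

Section DiscreteRate.
Variables (R : realType) (A : R -> 'M[R]_2) (B : R -> 'cV[R]_2).

Definition coef_a (h : R) : R :=
  let a11 := A h 0 0 in let a12 := A h 0 1 in
  let b1 := B h 0 0 in let b2 := B h 1 0 in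
  (a11 * b1 + a12 * b2 - b1) ^+ 2 +
  b1 * (a11 * b1 + a12 * b2) * (2 - \tr (A h)).

Definition coef_b (h : R) : R :=
  let a11 := A h 0 0 in let a21 := A h 1 0 in
  let b1 := B h 0 0 in let b2 := B h 1 0 in
  (a21 * b1 - a11 * b2 + b2) ^+ 2 -
  b2 * (a21 * b1 - a11 * b2) * (2 - \tr (A h)).

Definition coef_c (h : R) : R :=
  let a11 := A h 0 0 in let a12 := A h 0 1 in let a21 := A h 1 0 in
  let b1 := B h 0 0 in let b2 := B h 1 0 in
  2^-1 * (a21 * b1 - a11 * b2) * b1 * \tr (A h) +
  b1 * b2 * (2^-1 * (\tr (A h)) ^+ 2 - 1) -
  (a11 * b1 + a12 * b2) * (a21 * b1 - a11 * b2) -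
  2^-1 * \tr (A h) * (a11 * b1 + a12 * b2) * b2.

Definition rate_IMtau (alpha : R) (eta : nat -> R) (M : nat) (tau : R)
    (x : H0 R) : \bar R :=
  if `[< HM M x >] then
    (\sum_(1 <= k < M.+1)
      let h := k%:R ^+ 2 * tau in
      let a := coef_a h in let b := coef_b h in let c := coef_c h in
      let re := complex.Re (cdot x (ec_ k)) in
      let im := complex.Im (cdot x (ec_ k)) in
      tau * (4 - (\tr (A h)) ^+ 2) /
        (4 * (a * b - c ^+ 2) * alpha_ alpha eta k ^+ 2) *
      (b * re ^+ 2 + a * im ^+ 2 + 2 * c * re * im))%:E
  else +oo%E.

End DiscreteRate.

Definition modified_rate (R : realType) (X : Type) (tau : R) (J : X -> \bar R)
    (x : X) : \bar R := ((tau^-1)%:E * J x)%E.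

(* Main.v *)
(* When det A = 1 and (tr A)^2 < 4, the matrix A is a rotation of angle theta
   in suitable coordinates.  Undoing this rotation turns one Fourier mode of the
   scheme into a planar walk with independent Gaussian steps, whose covariance
   after N steps is N tau / 2 times the identity up to a bounded error; hence
   the rate of the mode is the A-invariant quadratic form v |-> det (v, A v),
   normalized by its value at B.  The upper bound is Markov's inequality for the
   exponential of the rate divided by rho > 1, linearized by a Gaussian average;
   the lower bound is an exponential tilt, with the concentration of the walk
   near 0.  The modes are independent, so exponential moments and the
   probabilities of boxes multiply.

   By (iii), det (v, A v) / det (B, A B) tends to |v|^2 as the step tends to 0,
   which identifies the limit of the modified rates.  Truncation to the first M
   modes gives the weak preservation when all eta k are positive; this uses that
   the sines are complete in L^2(0, pi).  If eta k = 0 for k > m >= 1, then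
   M = m is exact.  If all eta k vanish, the scheme is deterministic with
   bounded orbits, and its rate function is that of the point mass at 0. *)
Require Import Defs.
From HB Require Import structures.
From mathcomp Require Import all_boot all_order all_algebra.
From mathcomp Require Import complex.
From mathcomp Require Import all_classical all_reals all_analysis.
From mathcomp Require Import measurable_realfun.
From mathcomp Require Import ring lra.
Set Implicit Arguments.
Unset Strict Implicit.
Unset Printing Implicit Defensive.
Import Order.TTheory GRing.Theory Num.Theory.
Import numFieldNormedType.Exports.
Local Open Scope classical_set_scope.
Local Open Scope ring_scope.

(** * The sine basis of L^2(0, pi) *)

Section L2dot.
Context {R : realType}.
Notation mu := (mu0pi R).
Notation F2 := (L2fun mu).
Implicit Types (f g h : F2) (x y z : U0 R).

Lemma L2fun_mulr_integrable f g :
  mu.-integrable setT (fun t => (f t * g t)%:E).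
Proof.
have /Lfun1_integrable : (f \* g)%R \in Lfun mu 1%:E.
  apply: Lfun2_mul_Lfun1; exact: LfunP.
by [].
Qed.

Lemma dot_of f g : dot (L2_of f) (L2_of g) = \int[mu]_t (f t * g t).
Proof.
rewrite /dot /Rintegral; congr fine; apply: ae_eq_integral => //.
- exact: (measurable_int _ (L2fun_mulr_integrable _ _)).
- exact: (measurable_int _ (L2fun_mulr_integrable _ _)).
move: (L2_ofK f) (L2_ofK g).
by apply: filterS2 => t /(_ I) hf /(_ I) hg _; rewrite hf hg.
Qed.

Lemma dotC x y : dot x y = dot y x.
Proof. by rewrite /dot; apply: eq_Rintegral => t _; rewrite mulrC. Qed.

Lemma dotDl x y z : dot (x + y) z = dot x z + dot y z.
Proof.
rewrite -(fun_ofK x) -(fun_ofK y) -(fun_ofK z) -L2_ofD !dot_of.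
rewrite -RintegralD//; try exact: L2fun_mulr_integrable.
by apply: eq_Rintegral => t _; rewrite -mulrDl.
Qed.

Lemma dotZl a x y : dot (a *: x) y = a * dot x y.
Proof.
rewrite -(fun_ofK x) -(fun_ofK y) -L2_ofZ !dot_of.
rewrite -RintegralZl//; try exact: L2fun_mulr_integrable.
by apply: eq_Rintegral => t _; rewrite mulrA.
Qed.

Lemma dotxx x : dot x x = `|x| ^+ 2.
Proof.
rewrite -{1 2}(fun_ofK x) dot_of L2_normrE /L2norm.
set f := fun_of x.
have h : ((fine ('N[mu]_2%:E[EFin \o f]))%:E = 'N[mu]_2%:E[EFin \o f])%E.
  exact: (finite_norm_fine f).
have : (('N[mu]_2%:E[EFin \o f]) `^ 2 = \int[mu]_t (`|(f t)%:E| `^ 2))%E.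
  by apply: powR_Lnorm.
rewrite -h poweR_EFin powR_mulrn ?fine_ge0 ?Lnorm_ge0// => h2.
rewrite /Rintegral; have -> : (\int[mu]_t (f t * f t)%:E)%E =
   (\int[mu]_t (`|(f t)%:E| `^ 2))%E.
  apply: eq_integral => t _; rewrite abse_EFin poweR_EFin powR_mulrn//.
  by rewrite real_normK ?num_real// expr2.
by rewrite -h2.
Qed.

End L2dot.

Section Orthonormality.
Context {R : realType}.
Notation mu := (mu0pi R).
Notation leb := (@lebesgue_measure R).
Notation Ipi := (`]0, (pi : R)[%classic).

Lemma mu0piE A : mu A = leb (A `&` Ipi).
Proof. by []. Qed.

Lemma ae_mu0pi_itv : {ae mu, forall t, Ipi t}.
Proof.
exists (~` Ipi); split => //.
  by apply: measurableC; exact: measurable_itv.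
by rewrite mu0piE setICl measure0.
Qed.

Lemma integral_mu0pi (f : R -> \bar R) : measurable_fun setT f ->
  (\int[mu]_t f t = \int[leb]_(t in Ipi) f t)%E.
Proof.
move=> mf.
rewrite (@ae_eq_integral _ _ _ mu setT (f \_ Ipi))//.
- rewrite -integral_mkcond; apply: eq_measure_integral => A mA AI.
  by rewrite mu0piE setIidl.
- by apply/(measurable_restrictT f); [exact: measurable_itv|exact: measurable_funTS].
- apply: (@filterS _ _ (ae_filter_ringOfSetsType mu) _ _ _ ae_mu0pi_itv).
  by move=> t It _; rewrite patchE mem_set.
Qed.

Lemma sin_natpi k : sin (k%:R * pi : R) = 0.
Proof.
elim: k => [|k ih]; first by rewrite mul0r sin0.
by rewrite -natr1 mulrDl mul1r sinD ih sinpi mul0r mulr0 addr0.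
Qed.

Lemma integral_cos_itv0pi (a : R) : a != 0 -> sin (a * pi) = 0 ->
  \int[leb]_(t in `[0, pi]) cos (a * t) = 0.
Proof.
move=> a0 sa; rewrite /Rintegral.
have dF (x : R) : is_derive x 1 (fun t => a^-1 * sin (a * t)) (cos (a * x)).
  have dg : is_derive x 1 (cst a * id) a.
    by apply: is_derive_eq; rewrite /GRing.scale/= mulr1 mulr0 addr0.
  have ds := @is_derive1_comp _ (@sin R) _ _ _ _ (is_derive_sin ((cst a * id) x)) dg.
  have -> : (fun t => a^-1 * sin (a * t)) = cst a^-1 * (sin \o (cst a * id)) by [].
  apply: is_derive_eq; rewrite /GRing.scale/= mulr0 addr0 mulrCA mulVf ?mulr1//.
have cc : continuous (fun t : R => cos (a * t)).
  move=> x; apply: (@continuous_comp _ _ _ (fun t => a * t) (@cos R)).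
    by apply: mulrl_continuous.
  exact: continuous_cos.
have dF' (x : R) : derivable (fun t => a^-1 * sin (a * t)) x 1 by have [] := dF x.
have cF : continuous (fun t : R => a^-1 * sin (a * t)).
  by move=> x; apply: differentiable_continuous; apply/derivable1_diffP.
rewrite (@continuous_FTC2 _ _ (fun t => a^-1 * sin (a * t)))//.
- by rewrite sa !mulr0 sin0 mulr0 sube0.
- by rewrite pi_gt0.
- exact: continuous_subspaceT.
- split => //.
  + by apply: cvg_at_right_filter; exact: cF.
  + by apply: cvg_at_left_filter; exact: cF.
- by move=> x _; rewrite derive1E; have [] := dF x.
Qed.


Lemma continuous_cosM (a : R) : continuous (fun t : R => cos (a * t)).
Proof.
move=> x; apply: (@continuous_comp _ _ _ (fun t => a * t) (@cos R)).
  by apply: mulrl_continuous.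
exact: continuous_cos.
Qed.

Lemma integrable_cos_itv0pi (a : R) :
  leb.-integrable `[0, pi] (EFin \o (fun t : R => cos (a * t))).
Proof.
apply: continuous_compact_integrable; first exact: segment_compact.
apply: continuous_subspaceT; exact: continuous_cosM.
Qed.

Lemma dot_e_ k l : (0 < k)%N -> (0 < l)%N ->
  dot (e_ k : U0 R) (e_ l) = (k == l)%:R.
Proof.
move=> k0 l0; rewrite dot_of /=.
have ms n : measurable_fun setT (fun t : R => sin (n%:R * t)).
  apply: measurableT_comp; last exact: measurable_funM.
  exact: (continuous_measurable_fun (@continuous_sin R)).
have msk n : measurable_fun setT (@sine R n).
  by apply: measurable_funM => //; exact: ms.
rewrite /Rintegral integral_mu0pi; last first.
  by apply/measurable_EFinP; apply: measurable_funM; exact: msk.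
rewrite -(integral_itv_bndoo true false); last first.
  by apply: measurable_funTS; apply/measurable_EFinP; apply: measurable_funM; exact: msk.
pose C a := \int[leb]_(t in `[0, pi]) cos (a * t).
have C0 : C 0 = pi.
  rewrite /C -[RHS](_ : \int[leb]_(t in `[0, pi]) cst 1 t = pi).
    by apply: eq_Rintegral => t _; rewrite mul0r cos0.
  rewrite Rintegral_cst//= lebesgue_measure_itv/= lte_fin pi_gt0.
  by rewrite -EFinD/= mul1r subr0.
transitivity (pi^-1 * (C (k%:R - l%:R) - C (k%:R + l%:R))).
  rewrite /C -RintegralB//; [|exact: integrable_cos_itv0pi..].
  rewrite -RintegralZl//; last first.
    have := @integrableB _ _ _ leb _ _ _ _
      (integrable_cos_itv0pi (k%:R - l%:R)) (integrable_cos_itv0pi (k%:R + l%:R)).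
    by move=> /(_ (measurable_itv _)); apply: eq_integrable => // t _; rewrite /= EFinB.
  apply: eq_Rintegral => t _; rewrite /sine.
  rewrite mulrACA -expr2 sqr_sqrtr ?divr_ge0 ?pi_ge0//.
  rewrite (mulrBl t) (mulrDl k%:R) cosB cosD; ring.
have sz n : sin (n%:R * pi : R) = 0 by exact: sin_natpi.
have Cz a : a != 0 -> sin (a * pi) = 0 -> C a = 0 by exact: integral_cos_itv0pi.
have kl0 : C (k%:R + l%:R) = 0.
  by apply: Cz; rewrite -natrD ?sz// pnatr_eq0 addn_eq0 negb_and -lt0n k0.
rewrite kl0 subr0; have [->|kl] := eqVneq k l.
  by rewrite subrr C0 mulVf ?gt_eqF ?pi_gt0.
by rewrite Cz ?mulr0 ?mulrBl ?sinB ?sz ?mul0r ?mulr0 ?subrr// subr_eq0 eqr_nat.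
Qed.

End Orthonormality.

Import HBNNSimple.
Section SineClosure.
Context {R : realType}.
Notation mu := (mu0pi R).
Notation F2 := (L2fun mu).
Notation Ipi := (`]0, (pi : R)[%classic).

Inductive sine_span : U0 R -> Prop :=
| sine_span0 : sine_span 0
| sine_span_e k : (0 < k)%N -> sine_span (e_ k)
| sine_spanD x y : sine_span x -> sine_span y -> sine_span (x + y)
| sine_spanZ a x : sine_span x -> sine_span (a *: x).

Definition sine_closure (x : U0 R) : Prop :=
  forall eps : R, 0 < eps -> exists2 y, sine_span y & `|x - y| < eps.

Lemma sine_span_closure x : sine_span x -> sine_closure x.
Proof. by move=> sx eps eps0; exists x => //; rewrite subrr normr0. Qed.

Lemma sine_closureD x y : sine_closure x -> sine_closure y -> sine_closure (x + y).
Proof.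
move=> cx cy eps eps0.
have e2 : 0 < eps / 2 by rewrite divr_gt0.
have [x' sx xx] := cx _ e2; have [y' sy yy] := cy _ e2.
exists (x' + y'); first exact: sine_spanD.
rewrite opprD addrACA (le_lt_trans (ler_normD _ _))//.
by rewrite [eps]splitr ltrD.
Qed.

Lemma sine_closureZ a x : sine_closure x -> sine_closure (a *: x).
Proof.
move=> cx eps eps0.
have a0 : 0 < `|a| + 1 by rewrite ltr_wpDl.
have [y sy xy] := cx (eps / (`|a| + 1)) (divr_gt0 eps0 a0).
exists (a *: y); first exact: sine_spanZ.
rewrite -scalerBr normrZ (@le_lt_trans _ _ ((`|a| + 1) * `|x - y|))//.
  by rewrite ler_wpM2r// lerDl.
by rewrite mulrC -ltr_pdivlMr.
Qed.

Lemma sine_closure_limit x :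
  (forall eps : R, 0 < eps -> exists2 y, sine_closure y & `|x - y| < eps) ->
  sine_closure x.
Proof.
move=> h eps eps0.
have e2 : 0 < eps / 2 by rewrite divr_gt0.
have [y cy xy] := h _ e2; have [z sz yz] := cy _ e2.
exists z => //; rewrite -(subrK y x) -addrA (le_lt_trans (ler_normD _ _))//.
by rewrite [eps]splitr ltrD.
Qed.

Definition sine_approx (f : R -> R) : Prop :=
  exists2 F : F2, (F : R -> R) = f & sine_closure (L2_of F).

Lemma sine_approxD f g : sine_approx f -> sine_approx g -> sine_approx (f \+ g).
Proof.
move=> [F Ff cF] [G Gg cG]; exists (F + G); first by rewrite -Ff -Gg.
by rewrite L2_ofD; exact: sine_closureD.
Qed.

Lemma sine_approxZ a f : sine_approx f -> sine_approx (fun t => a * f t).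
Proof.
move=> [F Ff cF]; exists (a *: F); first by rewrite -Ff.
by rewrite L2_ofZ; exact: sine_closureZ.
Qed.

Lemma sine_approx0 : sine_approx (fun=> 0).
Proof.
exists 0 => //.
apply: sine_span_closure; rewrite -[L2_of _]/(0 : U0 R); exact: sine_span0.
Qed.

Lemma sine_approx_sin k : sine_approx (fun t => sin (k%:R * t)).
Proof.
case: k => [|k].
  by under eq_fun do rewrite mul0r sin0; exact: sine_approx0.
have -> : (fun t : R => sin (k.+1%:R * t)) =
    (fun t => (Num.sqrt (2 / pi))^-1 * sine k.+1 t).
  apply/funext => t; rewrite /sine mulKf// gt_eqF// sqrtr_gt0 divr_gt0//.
  exact: pi_gt0.
apply: sine_approxZ.
exists (Lfun_Sub (lee1n 2) (sine_Lfun R k.+1)) => //.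
by apply: sine_span_closure; exact: sine_span_e.
Qed.

Lemma sine_approx_sum (I : Type) (r : seq I) (f : I -> R -> R) :
  (forall i, sine_approx (f i)) -> sine_approx (fun t => \sum_(i <- r) f i t).
Proof.
move=> h; elim: r => [|i r ih].
  by under eq_fun do rewrite big_nil; exact: sine_approx0.
by under eq_fun do rewrite big_cons; exact: sine_approxD.
Qed.

Lemma sine_approx_sincos j k :
  sine_approx (fun t => sin (k%:R * t) * cos t ^+ j).
Proof.
elim: j k => [|j ih] k.
  by under eq_fun do rewrite mulr1; exact: sine_approx_sin.
case: k => [|k].
  by under eq_fun do rewrite mul0r sin0 mul0r; exact: sine_approx0.
have -> : (fun t : R => sin (k.+1%:R * t) * cos t ^+ j.+1) =
  (fun t => 2^-1 * ((fun t => sin (k.+2%:R * t) * cos t ^+ j) \+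
                    (fun t => sin (k%:R * t) * cos t ^+ j)) t).
  apply/funext => t /=.
  have -> : k.+2%:R * t = k.+1%:R * t + t by rewrite -(natr1 k.+1); ring.
  have -> : k%:R * t = k.+1%:R * t - t by rewrite -(natr1 k); ring.
  rewrite sinD sinB exprS; lra.
by apply: sine_approxZ; apply: sine_approxD; exact: ih.
Qed.

Lemma sine_approx_poly (p : {poly R}) : sine_approx (fun t => sin t * p.[cos t]).
Proof.
have -> : (fun t => sin t * p.[cos t]) =
   (fun t => \sum_(i < size p) p`_i * (sin (1%:R * t) * cos t ^+ i)).
  apply/funext => t; rewrite horner_coef mulr_sumr; apply: eq_bigr => i _.
  by rewrite mul1r; ring.
by apply: sine_approx_sum => i; apply: sine_approxZ; exact: sine_approx_sincos.
Qed.

Lemma L2_ae_eq (f g : F2) : (forall t, Ipi t -> f t = g t) -> L2_of f = L2_of g.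
Proof.
move=> fg; apply/L2_ofP.
apply: (@filterS _ _ (ae_filter_ringOfSetsType mu) _ _ _ (@ae_mu0pi_itv R)).
by move=> t It _; exact: fg.
Qed.

Lemma Lfun2_dominated (f : R -> R) (g : F2) : measurable_fun setT f ->
  (forall t, `|f t| <= `|g t|) -> f \in Lfun mu 2%:E.
Proof.
move=> mf fg; rewrite inE/=; apply/andP; split; first by rewrite inE.
have gfin : finite_norm mu 2%:E (g : R -> R).
  by have /andP[_] := LfunP g; rewrite inE.
rewrite inE/=; move: gfin; rewrite /finite_norm; apply: le_lt_trans.
rewrite unlock/=; apply: gt0_ler_poweR => //.
- by rewrite in_itv/= leey integral_ge0// => t _; exact: poweR_ge0.
- by rewrite in_itv/= leey integral_ge0// => t _; exact: poweR_ge0.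
apply: ge0_le_integral => //.
- apply/measurable_EFinP.
  apply: (@measurableT_comp _ _ _ _ _ _ (@powR R ^~ 2)) => //.
  exact: measurableT_comp.
- apply/measurable_EFinP.
  apply: (@measurableT_comp _ _ _ _ _ _ (@powR R ^~ 2)) => //.
  by apply: measurableT_comp => //; exact: measurable_funP.
move=> t _ /=.
by rewrite lee_fin; apply: ge0_ler_powR; rewrite ?nnegrE.
Qed.


Lemma sine_approx_ae f g : (forall t, Ipi t -> f t = g t) ->
  g \in Lfun mu 2%:E -> sine_approx f -> sine_approx g.
Proof.
move=> fg Lg [F Ff cF]; exists (Lfun_Sub (lee1n 2) Lg) => //.
rewrite -(@L2_ae_eq F)// => t It; rewrite Ff; exact: fg.
Qed.

Lemma L2_normB (F G : F2) :
  (`|L2_of F - L2_of G| ^+ 2)%:E = (\int[mu]_t ((F t - G t) ^+ 2)%:E)%E.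
Proof.
have -> : (L2_of F - L2_of G : U0 R) = L2_of (F - G).
  by rewrite L2_ofD; congr (_ + _); rewrite -scaleN1r -L2_ofZ scaleN1r.
rewrite -dotxx dot_of /Rintegral fineK; last first.
  exact: integrable_fin_num (L2fun_mulr_integrable _ _).
by apply: eq_integral => t _; rewrite expr2.
Qed.

Lemma sine_approx_dominated (f_ : nat -> R -> R) (f : R -> R) (g : F2) (a : R) :
  (forall n, sine_approx (f_ n)) -> measurable_fun setT f ->
  (forall n t, `|f_ n t| <= `|g t|) -> (forall t, `|f t| <= `|g t|) ->
  (forall t, Ipi t -> t != a -> f_ n t @[n --> \oo] --> f t) ->
  sine_approx f.
Proof.
move=> hf mf fg_ fg cf.
have Lf := Lfun2_dominated mf fg.
exists (Lfun_Sub (lee1n 2) Lf) => //.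
have /choice[F FP] : forall n, exists F : F2, (F : R -> R) = f_ n /\ sine_closure (L2_of F).
  by move=> n; have [F ? ?] := hf n; exists F.
apply: sine_closure_limit => eps eps0.
set G := Lfun_Sub _ Lf.
pose E n t := ((F n t - G t) ^+ 2)%:E.
have mE n : measurable_fun setT (E n).
  by apply/measurable_EFinP; apply: measurable_funX; apply: measurable_funB.
have cE : {ae mu, forall t, setT t -> E ^~ t @ \oo --> cst 0%E t}.
  exists (~` Ipi `|` [set a]); split.
  + apply: measurableU; last exact: measurable_set1.
    by apply: measurableC; exact: measurable_itv.
  + rewrite mu0piE setIUl setICl set0U.
    apply/eqP; rewrite -measure_le0 -(@lebesgue_measure_set1 _ a).
    apply: le_measure; rewrite ?inE; last exact: subIsetl.
      by apply: measurableI; [exact: measurable_set1|exact: measurable_itv].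
    exact: measurable_set1.
  + move=> t /= ht; rewrite -[_ \/ _]/((~` Ipi `|` [set a]) t).
    apply: contrapT => /not_orP[/contrapT It /eqP ta]; apply: ht => _.
    rewrite (_ : (fun n => _) = EFin \o (fun n => (f_ n t - f t) ^+ 2)); last first.
      by apply/funext => n; rewrite /E (FP n).1.
    apply: cvg_EFin; first by near=> n.
    rewrite (_ : 0 = (f t - f t) ^+ 2); last by rewrite subrr expr0n.
    rewrite /comp/=.
    have hB : (f_ n t - f t) @[n --> \oo] --> f t - f t.
      by apply: cvgB; [exact: cf|exact: cvg_cst].
    exact: (cvgM hB hB).
have iE : mu.-integrable setT (fun t => ((2 * `|g t|) ^+ 2)%:E).
  have := L2fun_mulr_integrable g g => /(integrableZl measurableT 4).
  apply: eq_integrable => // t _.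
  by rewrite -EFinM exprMn real_normK ?num_real// expr2; congr EFin; ring.
have dE : {ae mu, forall t n, setT t -> (`|E n t| <= ((2 * `|g t|) ^+ 2)%:E)%E}.
  apply: aeW => t n _; rewrite /E gee0_abs ?lee_fin ?sqr_ge0//.
  rewrite -(real_normK (num_real (F n t - G t))).
  rewrite ler_sqr ?nnegrE ?mulr_ge0// (le_trans (ler_normB _ _))//.
  rewrite (mulr_natl `|g t| 2) (mulr2n `|g t|) lerD//; first by rewrite (FP n).1; exact: fg_.
have h : (\int[mu]_t E n t)%E @[n --> \oo] --> 0%E.
  have [_ _] := dominated_convergence measurableT mE (@measurable_cst _ _ _ _ _ _) cE iE dE.
  by rewrite integral0.
have h0 : (`|L2_of (F n) - L2_of G| ^+ 2) @[n --> \oo] --> (0 : R).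
  apply: (@fine_cvg _ _ _ _ (fun n => (`|L2_of (F n) - L2_of G| ^+ 2)%:E)).
  by under eq_fun do rewrite L2_normB.
have /cvgrPdist_lt/(_ (eps ^+ 2) (exprn_gt0 _ eps0)) := h0.
move=> [n _ /(_ n (leqnn n))/=]; rewrite sub0r normrN normrX ger0_norm//.
rewrite ltr_sqr ?nnegrE ?(ltW eps0)// => hn.
by exists (L2_of (F n)); [exact: (FP n).2|rewrite distrC].
Unshelve. all: by end_near.
Qed.

Lemma bernoulli_ineq (x : R) m : -1 <= x -> 1 + m%:R * x <= (1 + x) ^+ m.
Proof.
move=> x1; elim: m => [|m ih]; first by rewrite mul0r addr0 expr0.
have x0 : 0 <= 1 + x by lra.
rewrite exprS (le_trans _ (ler_wpM2l x0 ih))// -natr1.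
have := mulr_ge0 (ler0n R m) (sqr_ge0 x).
lra.
Qed.

(* For y in [0, 1], (1 - y ^+ n) ^+ (2 ^ n) tends to 1 or to 0 according as
   y < 1/2 or y > 1/2; apply this to an affine function y of cos t. *)
Lemma sine_approx_ray (a : R) : Ipi a ->
  sine_approx (fun t => sin t * \1_(`]a, +oo[%classic) t).
Proof.
move=> Ia; have a0 : 0 <= a <= pi.
  by move: Ia; rewrite /= in_itv/= => /andP[/ltW -> /ltW ->].
pose q : {poly R} := 4^-1 *: ('X - (cos a)%:P) + (2^-1)%:P.
pose p n : {poly R} := (1 - q ^+ n) ^+ (2 ^ n)%N.
have qE y : q.[y] = (y - cos a) / 4 + 2^-1 by rewrite /q !hornerE; ring.
have pE n y : (p n).[y] = (1 - q.[y] ^+ n) ^+ (2 ^ n)%N.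
  by rewrite /p !hornerE.
have q01 t : 0 <= q.[cos t] <= 1.
  rewrite qE; have := cos_le1 t; have := cos_geN1 t.
  have := cos_le1 a; have := cos_geN1 a; lra.
have p01 n t : 0 <= (p n).[cos t] <= 1.
  have /andP[q0 q1] := q01 t.
  have x0 := exprn_ge0 n q0; have x1 : q.[cos t] ^+ n <= 1 by exact: exprn_ile1.
  by rewrite pE exprn_ge0 ?exprn_ile1 ?subr_ge0// gerBl.
pose S := Lfun_Sub (lee1n 2) (sine_Lfun R 1).
pose G : F2 := (Num.sqrt (2 / pi))^-1 *: S.
have GE t : G t = sin t.
  rewrite -[LHS]/(_ * sine 1 t) /sine mulKf ?mul1r// gt_eqF// sqrtr_gt0 divr_gt0//.
  exact: pi_gt0.
have ms : measurable_fun setT (@sin R) by exact: (continuous_measurable_fun (@continuous_sin R)).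
apply: (@sine_approx_dominated (fun n t => sin t * (p n).[cos t]) _ G a).
- by move=> n; exact: sine_approx_poly.
- by apply: measurable_funM => //; apply: measurable_indic; exact: measurable_itv.
- move=> n t; have /andP[? ?] := p01 n t.
  by rewrite GE normrM ler_piMr// ger0_norm.
- move=> t; rewrite GE normrM ler_piMr// indicE.
  by case: (_ \in _); rewrite ?normr1 ?normr0.
move=> t It ta.
have t0 : 0 <= t <= pi.
  by move: It; rewrite /= in_itv/= => /andP[/ltW -> /ltW ->].
apply: cvgM; first exact: cvg_cst.
have /andP[q0 q1] := q01 t.
set y := q.[cos t] in q0 q1.
have [at_|ta'] := ltP a t.
- have -> : \1_(`]a, +oo[%classic) t = 1 :> R.
    by rewrite indicE mem_set// /= in_itv/= at_.
  have y2 : y < 2^-1.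
    have : cos t < cos a by rewrite ltr_cos// in_itv/=.
    rewrite /y qE; lra.
  (* Bernoulli: 1 - (2 y) ^+ n <= (1 - y ^+ n) ^+ (2 ^ n) <= 1 *)
  have lb n : 1 - (2 * y) ^+ n <= (p n).[cos t].
    have y1 : -1 <= - y ^+ n by rewrite lerN2 exprn_ile1.
    rewrite pE (le_trans _ (bernoulli_ineq _ y1))//.
    by rewrite exprMn natrX mulrN.
  apply: (@squeeze_cvgr _ _ _ _ (fun n => 1 - (2 * y) ^+ n) (fun=> 1)).
  + by apply: nearW => n; rewrite lb; have /andP[] := p01 n t.
  + rewrite -[X in _ --> X]subr0; apply: cvgB; first exact: cvg_cst.
    apply: cvg_expr; rewrite ger0_norm; lra.
  + exact: cvg_cst.
- have {}ta' : t < a by rewrite lt_neqAle ta.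
  have -> : \1_(`]a, +oo[%classic) t = 0 :> R.
    by rewrite indicE memNset// /= in_itv/= andbT ltNge (ltW ta').
  have y2 : 2^-1 < y.
    have : cos a < cos t by rewrite ltr_cos// in_itv/=.
    rewrite /y qE; lra.
  have y0 : 0 < y by lra.
  (* (1 - x) ^+ m <= (1 + x)^-1 ^+ m <= (m x)^-1, with x = y ^+ n *)
  have ub n : (p n).[cos t] <= ((2 * y)^-1) ^+ n.
    rewrite pE -/y; set x := y ^+ n.
    have x0 : 0 < x by exact: exprn_gt0.
    have x1 : x <= 1 by exact: exprn_ile1.
    have -> : ((2 * y)^-1) ^+ n = ((2 ^ n)%N%:R * x)^-1.
      by rewrite exprVn exprMn natrX.
    set m := (2 ^ n)%N.
    have m0 : 0 < (m%:R : R) by rewrite ltr0n expn_gt0.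
    rewrite -[leRHS]mul1r ler_pdivlMr ?mulr_gt0//.
    have x1' : -1 <= x by lra.
    have h1 : 0 <= (1 - x) ^+ m by rewrite exprn_ge0 ?subr_ge0.
    have h2 : m%:R * x <= (1 + x) ^+ m.
      by rewrite (le_trans _ (bernoulli_ineq m x1'))// lerDr.
    rewrite (le_trans (ler_wpM2l h1 h2))// -exprMn exprn_ile1//; nra.
  apply: (@squeeze_cvgr _ _ _ _ (fun=> 0) (fun n => ((2 * y)^-1) ^+ n)).
  + by apply: nearW => n; rewrite ub andbT; have /andP[] := p01 n t.
  + exact: cvg_cst.
  + apply: cvg_expr; rewrite ger0_norm ?invr_ge0 ?invf_lt1; lra.
Qed.

Lemma sine_approx_indic (E : set R) : measurable E ->
  sine_approx (fun t => sin t * \1_E t).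
Proof.
pose S := Lfun_Sub (lee1n 2) (sine_Lfun R 1).
pose G : F2 := (Num.sqrt (2 / pi))^-1 *: S.
have GE t : G t = sin t.
  rewrite -[LHS]/(_ * sine 1 t) /sine mulKf ?mul1r// gt_eqF// sqrtr_gt0 divr_gt0//.
  exact: pi_gt0.
have ms : measurable_fun setT (@sin R) by exact: (continuous_measurable_fun (@continuous_sin R)).
have dom (F : set R) t : `|sin t * \1_F t| <= `|G t|.
  rewrite GE normrM ler_piMr// indicE.
  by case: (_ \in _); rewrite ?normr1 ?normr0.
have mE (F : set R) : measurable F -> measurable_fun setT (fun t => sin t * \1_F t).
  by move=> mF; apply: measurable_funM => //; exact: measurable_indic.
have LE (F : set R) : measurable F -> (fun t => sin t * \1_F t) \in Lfun mu 2%:E.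
  by move=> mF; apply: (Lfun2_dominated (mE _ mF) (dom F)).
have sT : sine_approx (fun t => sin t * \1_setT t).
  have := sine_approx_sin 1; congr sine_approx; apply/funext => t.
  by rewrite mul1r indicT mulr1.
have mG : @measurable _ R = <<s @RGenOInfty.G R >> by exact: RGenOInfty.measurableE.
rewrite mG; move: E.
apply: (@dynkin_induction _ _ (@RGenOInfty.G R) (fun F => sine_approx (fun t => sin t * \1_F t))).
- exact: mG.
- move=> _ _ [x ->] [y ->]; exists (Num.max x y).
  by apply/seteqP; split => z /=; rewrite !in_itv/= !andbT gt_max => /andP.
- exact: sT.
- move=> _ [a ->]; have [a0|a0] := leP a 0.
    apply: sine_approx_ae sT; last exact: LE.
    move=> t; rewrite /= in_itv/= => /andP[t0 _]; congr (_ * _).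
    by rewrite indicT indicE mem_set//= in_itv/= (le_lt_trans a0).
  have [api|pia] := ltP a pi.
    by apply: sine_approx_ray; rewrite /= in_itv/= a0.
  apply: sine_approx_ae sine_approx0; last exact: LE.
  move=> t; rewrite /= in_itv/= => /andP[_ tpi].
  rewrite indicE memNset ?mulr0//= in_itv/= andbT.
  by apply/negP; rewrite -leNgt (le_trans (ltW tpi)).
- move=> F mF sF; have := sine_approxD sT (sine_approxZ (-1) sF).
  congr sine_approx; apply/funext => t /=; rewrite indicC indicT indicE.
  by case: (t \in F) => /=; ring.
- move=> F mF tF sF.
  have sumE n t : \sum_(i < n) (sin t * \1_(F i) t) =
      if pselect (exists i, F i t) is left h then
        sin t * (projT1 (cid h) < n)%:R else 0.
    case: pselect => [h|h]; last first.
      rewrite big1// => i _; rewrite indicE memNset ?mulr0// => Fi.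
      by apply: h; exists i.
    case: (cid h) => j Fj /=; rewrite -mulr_sumr; congr (_ * _).
    have FE i : \1_(F i) t = (i == j)%:R :> R.
      have [->|/eqP ij] := eqVneq i j; first by rewrite indicE mem_set.
      rewrite indicE memNset// => Fi; apply: ij.
      by apply: (tF i j) => //; exists t.
    elim: n => [|n ih]; first by rewrite big_ord0.
    rewrite big_ord_recr/= ih FE ltnS -natrD (leq_eqVlt j n) (eq_sym n j).
    by case: (eqVneq j n) => [->|_]; rewrite ?ltnn ?addn0.
  have indE t : \1_(\bigcup_k F k) t = (pselect (exists i, F i t) : bool)%:R :> R.
    rewrite indicE; case: pselect => [[i Fi]|h].
      by rewrite mem_set//; exists i.
    by rewrite memNset// => -[i _ Fi]; apply: h; exists i.
  apply: (@sine_approx_dominated (fun n t => \sum_(i < n) (sin t * \1_(F i) t)) _ G 0).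
  + by move=> n; exact: sine_approx_sum.
  + by apply: mE; exact: bigcup_measurable.
  + move=> n t; rewrite sumE GE; case: pselect => [h|h]; last by rewrite normr0.
    by rewrite normrM ler_piMr//; case: (_ < _)%N; rewrite ?normr1 ?normr0.
  + exact: dom.
  + move=> t It _; rewrite indE; under eq_fun do rewrite sumE.
    case: pselect => [h|h]; last by rewrite mulr0; exact: cvg_cst.
    apply: cvgM; first exact: cvg_cst.
    apply: cvg_near_cst; exists (projT1 (cid h)).+1 => // n /= hn.
    by rewrite hn.
Qed.

Lemma sine_approx_simple (h : {nnsfun R >-> R}) : sine_approx (fun t => sin t * h t).
Proof.
have -> : (fun t => sin t * h t) =
    (fun t => \sum_(y <- finmap.enum_fset (fset_set (range h))) (y * (sin t * \1_(h @^-1` [set y]) t))).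
  apply/funext => t; rewrite fimfunE fsbig_finite//= mulr_sumr; apply: eq_bigr => y _; ring.
apply: sine_approx_sum => y; apply: sine_approxZ; apply: sine_approx_indic.
exact: measurable_sfunP.
Qed.

Lemma sine_approx_ge0 (f : F2) : (forall t, 0 <= f t) -> sine_approx f.
Proof.
move=> f0.
pose g (t : R) : R := (f t * (sin t `^ (-1))) * \1_Ipi t.
have mf : measurable_fun setT (f : R -> R) by have /andP[+ _] := LfunP f; rewrite inE.
have ms : measurable_fun setT (@sin R) by exact: (continuous_measurable_fun (@continuous_sin R)).
have s0 t : Ipi t -> 0 < sin t.
  by rewrite /= in_itv/= => h; exact: sin_gt0_pi.
have g0 t : 0 <= g t.
  rewrite /g indicE; have [It|It] := boolP (t \in Ipi); last by rewrite mulr0.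
  by rewrite mulr1 mulr_ge0// powR_ge0.
have sg t : sin t * g t = f t * \1_Ipi t.
  rewrite /g indicE; have [It|It] := boolP (t \in Ipi); last by rewrite !mulr0.
  by rewrite !mulr1 powR_inv1 1?mulrC ?divfK// ?gt_eqF ?ltW// s0// -inE.
have mg : measurable_fun (setT : set R) (EFin \o g : R -> \bar R).
  apply/measurable_EFinP; apply: measurable_funM; last first.
    by apply: measurable_indic; exact: measurable_itv.
  apply: measurable_funM => //.
  by apply: (@measurableT_comp _ _ _ _ _ _ (@powR R ^~ (-1))).
have Lf : (fun t => f t * \1_Ipi t) \in Lfun mu 2%:E.
  apply: (@Lfun2_dominated _ f).
    by apply: measurable_funM => //; apply: measurable_indic; exact: measurable_itv.
  move=> t; rewrite normrM ler_piMr// indicE.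
  by case: (_ \in _); rewrite ?normr1 ?normr0.
apply: (@sine_approx_ae (fun t => f t * \1_Ipi t)).
- by move=> t It; rewrite indicE mem_set ?mulr1.
- exact: LfunP.
pose G := Lfun_Sub (lee1n 2) Lf.
have cg t : (EFin \o (nnsfun_approx measurableT mg ^~ t)) n @[n --> \oo] --> (g t)%:E.
  by apply: cvg_nnsfun_approx => // x _; rewrite lee_fin.
have lg n t : nnsfun_approx measurableT mg n t <= g t.
  have nd : nondecreasing_seq (EFin \o (nnsfun_approx measurableT mg ^~ t)).
    move=> i j ij; rewrite lee_fin.
    by have /lefP := nd_nnsfun_approx measurableT mg ij; apply.
  rewrite -lee_fin (cvg_unique _ (cg t) (ereal_nondecreasing_cvgn nd))//.
  by apply: ereal_sup_ubound; exists n.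
apply: (@sine_approx_dominated (fun n t => sin t * nnsfun_approx measurableT mg n t) _ G 0).
- by move=> n; exact: sine_approx_simple.
- by have /andP[+ _] := LfunP G; rewrite inE.
- move=> n t; rewrite -[G t]/(f t * \1_Ipi t) -sg normrM [leRHS]normrM ler_wpM2l//.
  by rewrite !ger0_norm.
- by [].
- move=> t It _; rewrite -sg; apply: cvgM; first exact: cvg_cst.
  exact: (fine_cvg (cg t)).
Qed.

Lemma sine_closure_all (x : U0 R) : sine_closure x.
Proof.
rewrite -(fun_ofK x); set f := fun_of x.
have mf : measurable_fun (setT : set R) (f : R -> R).
  by have /andP[+ _] := LfunP f; rewrite inE.
have La : (fun t => `|f t|) \in Lfun mu 2%:E.
  apply: (@Lfun2_dominated _ f); first exact: measurableT_comp.
  by move=> t; rewrite normr_id.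
pose G : F2 := Lfun_Sub (lee1n 2) La.
have aG : sine_approx G by apply: sine_approx_ge0 => t; exact: normr_ge0.
have aGf : sine_approx (G + f : F2).
  apply: sine_approx_ge0 => t; rewrite -[X in 0 <= X]/(`|f t| + f t).
  by rewrite -lerBlDr sub0r -normrN ler_norm.
have [F Ff cF] := sine_approxD aGf (sine_approxZ (-1) aG).
rewrite (_ : f = F)//; apply/LfuneqP => t; rewrite Ff.
by rewrite -[RHS]/(`|f t| + f t + -1 * `|f t|); ring.
Qed.

End SineClosure.

(** * Square roots of diagonal operators *)

Section SymmetricSqrt.
Context {R : realType} {V : lmodType R} (ip : V -> V -> R).
Hypothesis ipDl : forall x y z, ip (x + y) z = ip x z + ip y z.
Hypothesis ipZl : forall a x z, ip (a *: x) z = a * ip x z.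
Hypothesis ip_ge0 : forall x, 0 <= ip x x.
Hypothesis ip_eq0 : forall x, ip x x = 0 -> x = 0.
Variable S : V -> V.
Hypothesis Ssym : forall x y, ip (S x) y = ip x (S y).
Hypothesis Sge0 : forall x, 0 <= ip (S x) x.

Lemma ip_inj x y : (forall z, ip x z = ip y z) -> x = y.
Proof.
move=> xy; apply/eqP; rewrite -subr_eq0; apply/eqP/ip_eq0.
by rewrite -scaleN1r ipDl ipZl xy mulN1r subrr.
Qed.

Lemma symmetricD x y : S (x + y) = S x + S y.
Proof. by apply: ip_inj => z; rewrite ipDl !Ssym ipDl. Qed.

Lemma symmetricZ a x : S (a *: x) = a *: S x.
Proof. by apply: ip_inj => z; rewrite ipZl !Ssym ipZl. Qed.

Lemma symmetric_sqrt_eigen (m : R) f : 0 <= m ->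
  S (S f) = m ^+ 2 *: f -> S f = m *: f.
Proof.
rewrite le_eqVlt => /predU1P[<-|m0] SSf.
  rewrite scale0r; apply: ip_eq0.
  by rewrite -Ssym SSf expr0n/= scale0r -(scale0r 0) ipZl mul0r.
set y := S f + (- m) *: f.
have Sy : S y = (- m) *: y.
  rewrite symmetricD symmetricZ SSf /y scalerDr scalerA addrC; congr (_ + _ *: _).
  by rewrite mulrNN expr2.
have y0 : y = 0.
  apply: ip_eq0; apply/eqP; rewrite eq_le ip_ge0 andbT.
  have := Sge0 y; rewrite Sy ipZl mulNr oppr_ge0.
  by rewrite pmulr_rle0.
by apply/eqP; rewrite -subr_eq0 -scaleNr -/y y0.
Qed.

End SymmetricSqrt.

Section SineProjection.
Context {R : realType}.
Implicit Types (x y z : U0 R).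

Lemma dot_ge0 x : 0 <= dot x x.
Proof. by rewrite dotxx sqr_ge0. Qed.

Lemma dot_eq0 x : dot x x = 0 -> x = 0.
Proof. by rewrite dotxx => /eqP; rewrite sqrf_eq0 normr_eq0 => /eqP. Qed.

Lemma dotDr x y z : dot x (y + z) = dot x y + dot x z.
Proof. by rewrite dotC dotDl !(dotC _ x). Qed.

Lemma dotZr a x y : dot x (a *: y) = a * dot x y.
Proof. by rewrite dotC dotZl dotC. Qed.

Lemma dot0l x : dot 0 x = 0.
Proof. by rewrite -(scale0r 0) dotZl mul0r. Qed.

Lemma dot0r x : dot x 0 = 0.
Proof. by rewrite dotC dot0l. Qed.

Lemma dotBl x y z : dot (x - y) z = dot x z - dot y z.
Proof. by rewrite -scaleN1r dotDl dotZl mulN1r. Qed.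

Lemma dot_suml (I : Type) (r : seq I) (P : pred I) (f : I -> U0 R) y :
  dot (\sum_(i <- r | P i) f i) y = \sum_(i <- r | P i) dot (f i) y.
Proof.
elim/big_ind2: _ => [|a b c d <- <-|//]; [exact: dot0l|exact: dotDl].
Qed.

Definition sine_proj (M : nat) x : U0 R := \sum_(1 <= k < M.+1) dot x (e_ k) *: e_ k.

Lemma dot_sine_sum (M : nat) (c : nat -> R) l : (0 < l)%N ->
  dot (\sum_(1 <= k < M.+1) c k *: e_ k : U0 R) (e_ l) = if (l <= M)%N then c l else 0.
Proof.
move=> l0; rewrite dot_suml; under eq_big_nat => k /andP[k0 _].
  rewrite dotZl dot_e_//; over.
case: leqP => lM.
  rewrite (bigD1_seq l)/= ?iota_uniq ?mem_index_iota ?l0//= eqxx mulr1 big1_seq ?addr0//.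
  by move=> k /andP[kl _]; rewrite (negbTE kl) mulr0.
rewrite big1_seq// => k /andP[_]; rewrite mem_index_iota => /andP[_ kM].
by rewrite ltn_eqF ?mulr0// (leq_ltn_trans _ lM)//.
Qed.

Lemma dot_sine_proj M x l : (0 < l)%N ->
  dot (sine_proj M x) (e_ l) = if (l <= M)%N then dot x (e_ l) else 0.
Proof. exact: dot_sine_sum. Qed.

Lemma sine_projD M x y : sine_proj M (x + y) = sine_proj M x + sine_proj M y.
Proof.
by rewrite /sine_proj -big_split/=; apply: eq_bigr => k _; rewrite dotDl scalerDl.
Qed.

Lemma sine_projZ M a x : sine_proj M (a *: x) = a *: sine_proj M x.
Proof.
by rewrite /sine_proj scaler_sumr; apply: eq_bigr => k _; rewrite dotZl scalerA.
Qed.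

Lemma normr_sine_sum M (c : nat -> R) :
  `|\sum_(1 <= k < M.+1) c k *: e_ k : U0 R| ^+ 2 = \sum_(1 <= k < M.+1) c k ^+ 2.
Proof.
rewrite -dotxx {1}dot_suml; apply: eq_big_nat => l /andP[l0 lM].
by rewrite dotZl dotC dot_sine_sum// -ltnS lM expr2.
Qed.

Lemma normr_sine_proj M x :
  `|sine_proj M x| ^+ 2 = \sum_(1 <= k < M.+1) dot x (e_ k) ^+ 2.
Proof. exact: normr_sine_sum. Qed.

Lemma sine_pythagoras M x :
  `|x| ^+ 2 = `|sine_proj M x| ^+ 2 + `|x - sine_proj M x| ^+ 2.
Proof.
have h : dot (sine_proj M x) (x - sine_proj M x) = 0.
  rewrite /sine_proj dot_suml big1_seq// => k /andP[_].
  rewrite mem_index_iota ltnS => /andP[k0 kM].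
  by rewrite dotZl (dotC (e_ k)) dotBl dot_sine_proj// kM subrr mulr0.
have key (d p : U0 R) : dot p d = 0 -> `|d + p| ^+ 2 = `|p| ^+ 2 + `|d| ^+ 2.
  by move=> pd; rewrite -!dotxx dotDl !dotDr (dotC d p) pd addr0 add0r addrC.
by have := key _ _ h; rewrite subrK.
Qed.

Lemma sine_proj_span y : sine_span y ->
  exists N, forall M, (N <= M)%N -> sine_proj M y = y.
Proof.
elim=> {y} [|k k0|x y _ [N1 h1] _ [N2 h2]|a x _ [N h]].
- by exists 0%N => M _; rewrite /sine_proj big1// => k _; rewrite dot0l scale0r.
- exists k => M kM; rewrite /sine_proj (bigD1_seq k)/= ?iota_uniq ?mem_index_iota ?k0//=.
  rewrite dot_e_// eqxx scale1r big_seq_cond big1 ?addr0// => l.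
  rewrite mem_index_iota -andbA => /and3P[l0 _ lk].
  by rewrite dot_e_// eq_sym (negbTE lk) scale0r.
- by exists (maxn N1 N2) => M; rewrite geq_max => /andP[/h1 + /h2]; rewrite sine_projD => -> ->.
- by exists N => M /h; rewrite sine_projZ => ->.
Qed.

Lemma sine_proj_cvg x (eps : R) : 0 < eps ->
  exists N, forall M, (N <= M)%N -> `|x - sine_proj M x| < eps.
Proof.
move=> eps0; have [y sy xy] := sine_closure_all x eps0.
have [N hN] := sine_proj_span sy; exists N => M /hN yM.
rewrite (le_lt_trans _ xy)// -ler_sqr ?nnegrE//.
rewrite (sine_pythagoras M (x - y)).
suff -> : x - y - sine_proj M (x - y) = x - sine_proj M x by rewrite lerDr sqr_ge0.
have -> : sine_proj M (x - y) = sine_proj M x - y.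
  by rewrite -scaleN1r sine_projD sine_projZ yM scaleN1r.
by rewrite opprB addrA subrK.
Qed.

Lemma sine_proj_norm_cvg x : `|sine_proj M x| ^+ 2 @[M --> \oo] --> `|x| ^+ 2.
Proof.
apply/cvgrPdist_lt => eps eps0.
have s0 : 0 < Num.sqrt eps by rewrite sqrtr_gt0.
have [N hN] := sine_proj_cvg x s0; exists N => // M /hN.
rewrite (sine_pythagoras M x) addrAC subrr add0r ger0_norm ?sqr_ge0//.
by rewrite -ltr_sqr ?nnegrE ?sqrtr_ge0// sqr_sqrtr// ltW.
Qed.

Lemma sine_complete x : (forall k, (0 < k)%N -> dot x (e_ k) = 0) -> x = 0.
Proof.
move=> h; have h0 M : sine_proj M x = 0.
  rewrite /sine_proj big1_seq// => k /andP[_].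
  by rewrite mem_index_iota => /andP[/h -> _]; rewrite scale0r.
apply/eqP; rewrite -normr_eq0 eq_le normr_ge0 andbT; apply/ler_addgt0Pr => e e0.
have [N /(_ N (leqnn N))] := sine_proj_cvg x e0.
by rewrite h0 subr0 add0r => /ltW.
Qed.

End SineProjection.

Section H0coordinates.
Context {R : realType}.
Implicit Types (x y z : H0 R).

Definition rdot x y : R := dot (RePart x) (RePart y) + dot (ImPart x) (ImPart y).

Lemma Re_cdot x y : complex.Re (cdot x y) = rdot x y.
Proof. by []. Qed.

Lemma rdotDl x y z : rdot (x + y) z = rdot x z + rdot y z.
Proof. by rewrite /rdot !dotDl addrACA. Qed.

Lemma rdotZl a x z : rdot (a *: x) z = a * rdot x z.
Proof. by rewrite /rdot !dotZl mulrDr. Qed.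

Lemma rdotxx x : rdot x x = `|x| ^+ 2.
Proof. by rewrite /rdot !dotxx H0_normrE sqr_sqrtr// addr_ge0// sqr_ge0. Qed.

Lemma rdot_ge0 x : 0 <= rdot x x.
Proof. by rewrite rdotxx sqr_ge0. Qed.

Lemma rdot_eq0 x : rdot x x = 0 -> x = 0.
Proof. by rewrite rdotxx => /eqP; rewrite sqrf_eq0 normr_eq0 => /eqP. Qed.

Lemma H0_normE x : `|x| ^+ 2 = `|RePart x| ^+ 2 + `|ImPart x| ^+ 2.
Proof. by rewrite -rdotxx /rdot !dotxx. Qed.

Lemma cscale_ec (c : R[i]) k :
  Defs.cscale c (ec_ k : H0 R) = mkH0 (complex.Re c *: e_ k) (complex.Im c *: e_ k).
Proof. by rewrite /Defs.cscale /= !scaler0 subr0 add0r. Qed.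

Lemma Re_cdot_ec x k : complex.Re (cdot x (ec_ k)) = dot (RePart x) (e_ k).
Proof. by rewrite /= dot0r addr0. Qed.

Lemma Im_cdot_ec x k : complex.Im (cdot x (ec_ k)) = dot (ImPart x) (e_ k).
Proof. by rewrite /= dot0r subr0. Qed.

Lemma mkH0_sum (I : Type) (r : seq I) (P : pred I) (f g : I -> U0 R) :
  \sum_(i <- r | P i) mkH0 (f i) (g i) =
  mkH0 (\sum_(i <- r | P i) f i) (\sum_(i <- r | P i) g i).
Proof. by elim/big_rec3: _ => // i a b c _ ->. Qed.

Lemma sum_cscale_ec M (c : nat -> R[i]) :
  \sum_(1 <= k < M.+1) Defs.cscale (c k) (ec_ k : H0 R) =
  mkH0 (\sum_(1 <= k < M.+1) complex.Re (c k) *: e_ k)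
       (\sum_(1 <= k < M.+1) complex.Im (c k) *: e_ k).
Proof. by under eq_bigr do rewrite cscale_ec; rewrite mkH0_sum. Qed.

Lemma PME M x : PM M x = mkH0 (sine_proj M (RePart x)) (sine_proj M (ImPart x)).
Proof.
rewrite /PM sum_cscale_ec /sine_proj; congr mkH0; apply: eq_bigr => k _.
  by rewrite Re_cdot_ec.
by rewrite Im_cdot_ec.
Qed.

Lemma PM_HM M x : HM M (PM M x).
Proof. by exists (fun k => cdot x (ec_ k)). Qed.

Lemma HM_PM M x : HM M x -> PM M x = x.
Proof.
move=> [c ->]; rewrite PME sum_cscale_ec; congr mkH0.
  apply: eq_big_nat => k /andP[k0 kM]; rewrite /= dot_sine_sum// -ltnS kM//.
apply: eq_big_nat => k /andP[k0 kM]; rewrite /= dot_sine_sum// -ltnS kM//.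
Qed.

Lemma cdot_sum_ec M (c : nat -> R[i]) k : (0 < k <= M)%N ->
  cdot (\sum_(1 <= j < M.+1) Defs.cscale (c j) (ec_ j : H0 R)) (ec_ k) = c k.
Proof.
move=> /andP[k0 kM]; rewrite sum_cscale_ec.
apply/eqP; rewrite eq_complex Re_cdot_ec Im_cdot_ec /=.
by rewrite !dot_sine_sum// kM !eqxx.
Qed.

Lemma normr_sum_ec M (c : nat -> R[i]) :
  `|\sum_(1 <= j < M.+1) Defs.cscale (c j) (ec_ j : H0 R)| ^+ 2 =
  \sum_(1 <= k < M.+1) (complex.Re (c k) ^+ 2 + complex.Im (c k) ^+ 2).
Proof. by rewrite sum_cscale_ec H0_normE /= !normr_sine_sum big_split. Qed.

End H0coordinates.

Section GalerkinRate.
Context {R : realType}.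
Variables (eta : nat -> R) (Q : {linear U0 R -> U0 R}) (M : nat).
Hypothesis eta_gt0 : forall k, (0 < k <= M)%N -> 0 < eta k.
Hypothesis Q_eigen : forall k, (0 < k)%N -> Q (e_ k) = eta k *: e_ k.

Let S0 (x : H0 R) : H0 R :=
  \sum_(1 <= k < M.+1) Defs.cscale ((Num.sqrt (eta k))%:C * cdot x (ec_ k))%C (ec_ k).

Let lin_sine_sum (c : nat -> R) :
  Q (\sum_(1 <= k < M.+1) c k *: e_ k) = \sum_(1 <= k < M.+1) (eta k * c k) *: e_ k.
Proof.
rewrite linear_sum; apply: eq_big_nat => k /andP[k0 _].
by rewrite linearZ/= Q_eigen// scalerA mulrC.
Qed.

Lemma QM_E x : QM Q M x =
  mkH0 (\sum_(1 <= k < M.+1) (eta k * dot (RePart x) (e_ k)) *: e_ k)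
       (\sum_(1 <= k < M.+1) (eta k * dot (ImPart x) (e_ k)) *: e_ k).
Proof. by rewrite /QM PME /cext /= /sine_proj !lin_sine_sum. Qed.

Let S0E x : S0 x =
  mkH0 (\sum_(1 <= k < M.+1) (Num.sqrt (eta k) * dot (RePart x) (e_ k)) *: e_ k)
       (\sum_(1 <= k < M.+1) (Num.sqrt (eta k) * dot (ImPart x) (e_ k)) *: e_ k).
Proof.
rewrite /S0 sum_cscale_ec; congr mkH0; apply: eq_bigr => k _; congr (_ *: _).
  by rewrite /= !dot0r !addr0 mul0r subr0.
by rewrite /= !dot0r !addr0 subr0 mul0r addr0.
Qed.

Let dot_wsum (w : nat -> R) (f g : U0 R) :
  dot (\sum_(1 <= k < M.+1) (w k * dot f (e_ k)) *: e_ k) g =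
  \sum_(1 <= k < M.+1) w k * (dot f (e_ k) * dot g (e_ k)).
Proof.
by rewrite dot_suml; apply: eq_bigr => k _; rewrite dotZl (dotC (e_ k)) mulrA.
Qed.

Let S0_sqrt : is_sqrt_op (@cdot R) S0 (QM Q M).
Proof.
have sE (w : nat -> R) (f g : U0 R) :
    dot (\sum_(1 <= k < M.+1) (w k * dot f (e_ k)) *: e_ k) g =
    dot f (\sum_(1 <= k < M.+1) (w k * dot g (e_ k)) *: e_ k).
  rewrite (dotC f) !dot_wsum; apply: eq_bigr => k _; ring.
split; first split.
- move=> x y; apply/eqP; rewrite eq_complex /= !S0E /=.
  by rewrite !sE !eqxx.
- move=> x; rewrite lecE/= S0E /=.
  have -> : dot (\sum_(1 <= k < M.+1) (Num.sqrt (eta k) * dot (ImPart x) (e_ k)) *: e_ k)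
      (RePart x) = dot (\sum_(1 <= k < M.+1)
      (Num.sqrt (eta k) * dot (RePart x) (e_ k)) *: e_ k) (ImPart x).
    by rewrite !dot_wsum; apply: eq_bigr => k _; ring.
  rewrite subrr eqxx/=.
  rewrite !dot_wsum addr_ge0// sumr_ge0// => k _; rewrite mulr_ge0 ?sqrtr_ge0//.
    by rewrite -expr2 sqr_ge0.
  by rewrite -expr2 sqr_ge0.
- move=> x; rewrite (S0E (S0 x)) S0E QM_E /=.
  congr mkH0; apply: eq_big_nat => k /andP[k0 kM]; rewrite dot_sine_sum// -ltnS kM.
    by rewrite mulrA -expr2 sqr_sqrtr// ltW// eta_gt0// k0.
  by rewrite mulrA -expr2 sqr_sqrtr// ltW// eta_gt0// k0.
Qed.

Let Re_e k : H0 R := mkH0 (e_ k) 0.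
Let Im_e k : H0 R := mkH0 0 (e_ k).

Lemma is_sqrt_QM_unique (S : H0 R -> H0 R) :
  is_sqrt_op (@cdot R) S (QM Q M) -> S =1 S0.
Proof.
move=> [[Ssym Sge0] SS].
have rsym x y : rdot (S x) y = rdot x (S y) by rewrite -!Re_cdot Ssym.
have rge0 x : 0 <= rdot (S x) x.
  by rewrite -Re_cdot; have := Sge0 x; rewrite lecE => /andP[].
have SD := symmetricD (@rdotDl R) (@rdotZl R) (@rdot_eq0 R) rsym.
have SZ := symmetricZ (@rdotDl R) (@rdotZl R) (@rdot_eq0 R) rsym.
have Seig := symmetric_sqrt_eigen (@rdotDl R) (@rdotZl R) (@rdot_ge0 R)
  (@rdot_eq0 R) rsym rge0.
have QMD x y : QM Q M (x + y) = QM Q M x + QM Q M y by rewrite -!SS !SD.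
have S0' : S 0 = 0 by rewrite -(scale0r (0 : H0 R)) SZ !scale0r.
have eig k : (0 < k <= M)%N ->
    S (Re_e k) = Num.sqrt (eta k) *: Re_e k /\ S (Im_e k) = Num.sqrt (eta k) *: Im_e k.
  move=> /[dup] kM /andP[k0 kM']; have sq := sqr_sqrtr (ltW (eta_gt0 kM)).
  have h : \sum_(1 <= j < M.+1) (eta j * dot (e_ k) (e_ j)) *: (e_ j : U0 R) = eta k *: e_ k.
    rewrite (bigD1_seq k)/= ?iota_uniq ?mem_index_iota ?k0//= dot_e_// eqxx mulr1.
    rewrite big_seq_cond big1 ?addr0// => l.
    rewrite mem_index_iota -andbA => /and3P[l0 _ lk].
    by rewrite dot_e_// eq_sym (negbTE lk) mulr0 scale0r.
  have h0 : \sum_(1 <= j < M.+1) (eta j * dot 0 (e_ j)) *: (e_ j : U0 R) = 0.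
    by rewrite big1// => j _; rewrite dot0l mulr0 scale0r.
  split; apply: Seig; rewrite ?sqrtr_ge0// SS QM_E /= sq h h0 //.
    by apply: (congr2 (@mkH0 R)); rewrite // scaler0.
  by apply: (congr2 (@mkH0 R)); rewrite // scaler0.
have Ssum (f : nat -> H0 R) : S (\sum_(1 <= k < M.+1) f k) = \sum_(1 <= k < M.+1) S (f k).
  exact: (big_morph S SD S0').
move=> x; rewrite -[in LHS](subrK (PM M x) x) SD.
have -> : S (x - PM M x) = 0.
  rewrite (Seig 0)// ?scale0r// SS expr0n/= scale0r /QM.
  have -> : PM M (x - PM M x) = 0.
    rewrite !PME; apply: (congr2 (@mkH0 R)) => /=.
      rewrite /sine_proj big1_seq// => k /andP[_].
      rewrite mem_index_iota ltnS => /andP[k0 kM].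
      by rewrite dotBl dot_sine_proj// kM subrr scale0r.
    rewrite /sine_proj big1_seq// => k /andP[_].
    rewrite mem_index_iota ltnS => /andP[k0 kM].
    by rewrite dotBl dot_sine_proj// kM subrr scale0r.
  by apply: (congr2 (@mkH0 R)); exact: linear0.
rewrite add0r /PM Ssum; apply: eq_big_nat => k; rewrite ltnS => kM.
have [e1 e2] := eig _ kM.
have cE (c : R[i]) : Defs.cscale c (ec_ k : H0 R) =
    complex.Re c *: Re_e k + complex.Im c *: Im_e k.
  by rewrite cscale_ec; apply: (congr2 (@mkH0 R)); rewrite /= scaler0 ?addr0 ?add0r.
rewrite !cE SD !SZ e1 e2 !scalerA; congr (_ *: _ + _ *: _).
  by rewrite /= mul0r subr0 mulrC.
by rewrite /= mul0r addr0 mulrC.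
Qed.

Lemma QM12E x : QM12 Q M x = S0 x.
Proof.
apply: is_sqrt_QM_unique; rewrite /QM12.
exact: (@xgetI _ (fun=> 0) [set S | is_sqrt_op (@cdot R) S (QM Q M)] S0 S0_sqrt).
Qed.

Lemma rate_IM_E alpha x : rate_IM alpha Q M x =
  if `[< HM M x >] then
    ((alpha ^+ 2)^-1 * \sum_(1 <= k < M.+1)
      (dot (RePart x) (e_ k) ^+ 2 + dot (ImPart x) (e_ k) ^+ 2) / eta k)%:E
  else +oo%E.
Proof.
rewrite /rate_IM /op_rate.
pose c k := ((Num.sqrt (eta k))^-1%:C * cdot x (ec_ k))%C.
pose z0 : H0 R := \sum_(1 <= k < M.+1) Defs.cscale (c k) (ec_ k).
have rangeE : range (QM12 Q M) x <-> HM M x.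
  split=> [[y _ <-]|xM].
    by rewrite QM12E; exists (fun k => ((Num.sqrt (eta k))%:C * cdot y (ec_ k))%C).
  exists z0 => //; rewrite QM12E -[RHS](HM_PM xM) /S0 /PM.
  apply: eq_big_nat => k; rewrite ltnS => kM; rewrite cdot_sum_ec//; congr Defs.cscale.
  rewrite /c mulrA -rmorphM/= mulfV ?mul1r// gt_eqF// sqrtr_gt0; exact: eta_gt0.
have -> : `[< range (QM12 Q M) x >] = `[< HM M x >] by apply: asbool_equiv_eq.
case: asboolP => // xM; congr (_ * _)%:E.
have z0M : HM M z0 by exists c.
have Sz0 : QM12 Q M z0 = x.
  rewrite QM12E -[RHS](HM_PM xM) /S0 /PM.
  apply: eq_big_nat => k; rewrite ltnS => kM; rewrite cdot_sum_ec//; congr Defs.cscale.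
  rewrite /c mulrA -rmorphM/= mulfV ?mul1r// gt_eqF// sqrtr_gt0; exact: eta_gt0.
have uniq w : HM M w -> QM12 Q M w = x -> w = z0.
  move=> wM; rewrite QM12E => Sw; rewrite -(HM_PM wM) /PM /z0.
  apply: eq_big_nat => k; rewrite ltnS => kM; congr Defs.cscale.
  rewrite /c -Sw /S0 cdot_sum_ec// mulrA -rmorphM/= mulVf ?mul1r// gt_eqF// sqrtr_gt0.
  exact: eta_gt0.
have -> : min_norm_preimage (HM M) (QM12 Q M) x = z0.
  apply: xget_subset1.
    by split=> // w wM Sw; rewrite (uniq w).
  by move=> u v [uM Su _] [vM Sv _]; rewrite (uniq u)// (uniq v).
rewrite normr_sum_ec; apply: eq_big_nat => k; rewrite ltnS => kM.
have sq : (Num.sqrt (eta k))^-1 ^+ 2 = (eta k)^-1.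
  by rewrite exprVn sqr_sqrtr// ltW// eta_gt0.
have -> : complex.Re (c k) = (Num.sqrt (eta k))^-1 * dot (RePart x) (e_ k).
  by rewrite /c /= !dot0r !addr0 mul0r subr0.
have -> : complex.Im (c k) = (Num.sqrt (eta k))^-1 * dot (ImPart x) (e_ k).
  by rewrite /c /= !dot0r !addr0 subr0 mul0r addr0.
by rewrite !exprMn sq -mulrDr mulrC.
Qed.

End GalerkinRate.

Section SchroedingerRate.
Context {R : realType}.
Variables (eta : nat -> R) (Q Q12 : {linear U0 R -> U0 R}).
Hypothesis eta_ge0 : forall k, (0 < k)%N -> 0 <= eta k.
Hypothesis Q_eigen : forall k, (0 < k)%N -> Q (e_ k) = eta k *: e_ k.
Hypothesis Q12_sqrt : is_sqrt_op (@dot R) Q12 Q.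
Hypothesis Q12_bounded : exists C : R, forall f, U1_norm (Q12 f) <= C * `|f|.

Lemma Q12_eigen k : (0 < k)%N -> Q12 (e_ k) = Num.sqrt (eta k) *: e_ k.
Proof.
move=> k0; have [[Ssym Sge0] SS] := Q12_sqrt.
apply: (symmetric_sqrt_eigen (@dotDl R) (@dotZl R) (@dot_ge0 R) (@dot_eq0 R) Ssym Sge0).
  exact: sqrtr_ge0.
by rewrite SS sqr_sqrtr ?eta_ge0// Q_eigen.
Qed.

Lemma dot_Q12 z k : (0 < k)%N -> dot (Q12 z) (e_ k) = Num.sqrt (eta k) * dot z (e_ k).
Proof.
by move=> k0; have [[Ssym _] _] := Q12_sqrt; rewrite Ssym Q12_eigen// dotZr.
Qed.

Lemma normr_U1_norm (f : U0 R) : `|f| <= U1_norm f.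
Proof.
rewrite -ler_sqr ?nnegrE ?sqrtr_ge0// sqr_sqrtr ?lerDl ?sqr_ge0//.
Qed.

Lemma Q12_sine_proj M z : Q12 (sine_proj M z) =
  \sum_(1 <= k < M.+1) (Num.sqrt (eta k) * dot z (e_ k)) *: e_ k.
Proof.
rewrite linear_sum; apply: eq_big_nat => k /andP[k0 _].
by rewrite linearZ/= Q12_eigen// scalerA mulrC.
Qed.

(* Q12 is diagonal in the basis, so it vanishes on the closed span of the e_k
   with eta k = 0. *)
Lemma Q12_eq0 z : (forall k, (0 < k)%N -> eta k * dot z (e_ k) = 0) -> Q12 z = 0.
Proof.
move=> hz.
have h M : Q12 (sine_proj M z) = 0.
  rewrite Q12_sine_proj big1_seq// => k /andP[_].
  rewrite mem_index_iota => /andP[k0 _].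
  have /eqP := hz _ k0; rewrite mulf_eq0 => /orP[/eqP ->|/eqP ->].
    by rewrite sqrtr0 mul0r scale0r.
  by rewrite mulr0 scale0r.
have [C hC] := Q12_bounded.
have C0 : 0 < `|C| + 1 by rewrite ltr_wpDl.
apply/eqP; rewrite -normr_eq0 eq_le normr_ge0 andbT; apply/ler_addgt0Pr => e e0.
have [N /(_ N (leqnn N)) zN] := sine_proj_cvg z (divr_gt0 e0 C0).
rewrite add0r -[z](subrK (sine_proj N z)) linearD h addr0.
rewrite (le_trans (normr_U1_norm _))// (le_trans (hC _))//.
rewrite (@le_trans _ _ ((`|C| + 1) * `|z - sine_proj N z|))//.
  by rewrite ler_wpM2r// (le_trans (ler_norm C))// lerDl.
by rewrite mulrC -ler_pdivlMr// ltW.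
Qed.

Lemma rate_I_E alpha (z z0 : H0 R) :
  cext Q12 z = cext Q12 z0 ->
  (forall w, cext Q12 w = cext Q12 z0 -> `|z0| <= `|w|) ->
  (forall w, cext Q12 w = cext Q12 z0 -> `|w| <= `|z0| -> w = z0) ->
  rate_I alpha Q12 (cext Q12 z) = ((alpha ^+ 2)^-1 * `|z0| ^+ 2)%:E.
Proof.
move=> zz0 z0min z0uniq; rewrite /rate_I /op_rate asboolT; last by exists z.
congr (_ * `|_| ^+ 2)%:E; apply: xget_unique.
  by split=> // w _; rewrite zz0; exact: z0min.
move=> w [_ wz wmin]; apply: z0uniq; first by rewrite wz.
by apply: wmin.
Qed.

Lemma rate_I_inj alpha z : (forall k, (0 < k)%N -> 0 < eta k) ->
  rate_I alpha Q12 (cext Q12 z) = ((alpha ^+ 2)^-1 * `|z| ^+ 2)%:E.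
Proof.
move=> eta0.
have inj : injective Q12.
  move=> x y xy; apply/eqP; rewrite -subr_eq0; apply/eqP; apply: sine_complete => k k0.
  have : dot (Q12 (x - y)) (e_ k) = 0 by rewrite linearB xy subrr dot0l.
  rewrite dot_Q12// => /eqP; rewrite mulf_eq0 => /orP[|/eqP//].
  by rewrite sqrtr_eq0 leNgt eta0.
have cinj (w : H0 R) : cext Q12 w = cext Q12 z -> w = z.
  case: w => w1 w2; case: (z) => z1 z2 h.
  have h1 : Q12 w1 = Q12 z1 by exact: (congr1 (@RePart R) h).
  have h2 : Q12 w2 = Q12 z2 by exact: (congr1 (@ImPart R) h).
  by rewrite (inj _ _ h1) (inj _ _ h2).
by apply: rate_I_E => // w /cinj ->.
Qed.

Lemma rate_I_finite_rank alpha m z : (forall k, (0 < k <= m)%N -> 0 < eta k) ->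
  (forall k, (m < k)%N -> eta k = 0) ->
  rate_I alpha Q12 (cext Q12 z) = ((alpha ^+ 2)^-1 * `|PM m z| ^+ 2)%:E.
Proof.
move=> eta0 etam.
have projQ (x : U0 R) : Q12 (sine_proj m x) = Q12 x.
  apply/eqP; rewrite -subr_eq0 -linearB; apply/eqP/Q12_eq0 => k k0.
  rewrite dotBl dot_sine_proj//; case: leqP => km.
    by rewrite subrr mulr0.
  by rewrite etam// mul0r.
have projE (x y : U0 R) : Q12 x = Q12 y -> sine_proj m x = sine_proj m y.
  move=> xy; apply: eq_big_nat => k /andP[k0]; rewrite ltnS => km; congr (_ *: _).
  have := congr1 (fun u => dot u (e_ k)) xy; rewrite !dot_Q12//; apply: mulfI.
  by rewrite gt_eqF// sqrtr_gt0 eta0// k0.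
have cE (w : H0 R) : cext Q12 w = cext Q12 (PM m z) -> PM m w = PM m z.
  rewrite PME /cext /= !projQ => h.
  have h1 := congr1 (@RePart R) h; have h2 := congr1 (@ImPart R) h.
  by rewrite !PME (projE _ _ h1) (projE _ _ h2).
have pyth (w : H0 R) : `|w| ^+ 2 = `|PM m w| ^+ 2 + `|w - PM m w| ^+ 2.
  rewrite !H0_normE !PME /= (sine_pythagoras m (RePart w)) (sine_pythagoras m (ImPart w)).
  exact: addrACA.
apply: rate_I_E.
- by rewrite PME /cext /= !projQ.
- move=> w /cE <-; rewrite -ler_sqr ?nnegrE// (pyth w) lerDl sqr_ge0//.
- move=> w /cE <-; rewrite -ler_sqr ?nnegrE// (pyth w) gerDl => h.
  apply/eqP; rewrite -subr_eq0 -normr_eq0 -sqrf_eq0 eq_le h sqr_ge0//.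
Qed.

End SchroedingerRate.

(** * Gaussian walks with independent steps *)

Section IndependentPair.
Context d (Omega : measurableType d) (R : realType) (P : probability Omega R).
Context d1 (E1 : measurableType d1) d2 (E2 : measurableType d2).
Local Open Scope ereal_scope.

Lemma integral_indep_pair (X : Omega -> E1) (Y : Omega -> E2) (F : E1 * E2 -> \bar R) :
  measurable_fun setT X -> measurable_fun setT Y ->
  (forall A B, measurable A -> measurable B ->
    P (X @^-1` A `&` Y @^-1` B) = P (X @^-1` A) * P (Y @^-1` B)) ->
  measurable_fun setT F -> (forall z, 0 <= F z) ->
  \int[P]_w F (X w, Y w) = \int[P]_w \int[pushforward P Y]_y F (X w, y).
Proof.
move=> mX mY indep mF F0.
pose X' : {RV P >-> E1} := mfun_Sub (mem_set mX).
pose Y' : {RV P >-> E2} := mfun_Sub (mem_set mY).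
have mXY : measurable_fun setT (fun w => (X w, Y w)) by exact: measurable_fun_pair.
pose XY : {RV P >-> (E1 * E2)%type} := mfun_Sub (mem_set mXY).
have -> : \int[P]_w F (X w, Y w) = \int[distribution P XY]_z F z.
  by rewrite ge0_integral_distribution.
rewrite (eq_measure_integral (distribution P X' \x distribution P Y')%E); last first.
  by move=> A mA _; apply/esym; apply: product_measure_unique.
rewrite fubini_tonelli1//= ge0_integral_distribution//.
- exact: measurable_fun_fubini_tonelli_F.
- by move=> x; apply: integral_ge0.
Qed.

End IndependentPair.

Section Chain.
Context d (Omega : measurableType d) (R : realType) (P : probability Omega R).
Context d1 (E : measurableType d1).
Variables (X : nat -> {RV P >-> R}) (y0 : E) (phi : nat -> E * R -> E).
Hypothesis mphi : forall n, measurable_fun setT (phi n).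

Fixpoint chain (n : nat) (w : Omega) : E :=
  if n is m.+1 then phi m (chain m w, X m w) else y0.

Lemma measurable_chain n : measurable_fun setT (chain n).
Proof.
elim: n => [|n ih] /=; first exact: measurable_cst.
apply: (@measurableT_comp _ _ _ _ _ _ (phi n)); first exact: mphi.
by apply: measurable_fun_pair => //; exact: measurable_funP.
Qed.

Hypothesis indep : mutually_independent P (fun n => sigma_rv (X n)).
Local Open Scope ereal_scope.

Let tail (B : nat -> set R) n m : set Omega := \bigcap_(j in [set` index_iota n m]) (X j @^-1` B j).

Let tail_recl B n m : (n < m)%N -> tail B n m = X n @^-1` B n `&` tail B n.+1 m.
Proof.
move=> nm; rewrite /tail /index_iota -(subnSK nm) /=.
apply/seteqP; split=> [w h|w [h1 h2] j]; last by rewrite /= inE => /predU1P[->|/h2].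
by split=> [|j jt]; apply: h; rewrite /= inE ?eqxx// [j \in _]jt orbT.
Qed.

Let measurable_tail B n m : (forall j, measurable (B j)) -> measurable (tail B n m).
Proof.
move=> mB; apply: fin_bigcap_measurable => [|j _]; first exact: finite_seq.
by rewrite -[X in measurable X]setTI; exact: measurable_funP.
Qed.

Let indep_tail B n m : (forall j, measurable (B j)) ->
  P (tail B n m) = \prod_(n <= j < m) P (X j @^-1` B j).
Proof.
move=> mB; apply: indep; first exact: iota_uniq.
by move=> j _; exists (B j) => //; rewrite setTI.
Qed.

Lemma chain_indep_tail n m (A : set E) (B : nat -> set R) :
  (n <= m)%N -> measurable A -> (forall j, measurable (B j)) ->
  P (chain n @^-1` A `&` tail B n m) = P (chain n @^-1` A) * P (tail B n m).
Proof.
elim: n m A B => [|n ih] m A B nm mA mB.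
  have [Ay|Ay] := pselect (A y0).
    rewrite (_ : chain 0 @^-1` A = setT) ?setTI ?probability_setT ?mul1e//.
    by apply/seteqP; split.
  rewrite (_ : chain 0 @^-1` A = set0) ?set0I ?measure0 ?mul0e//.
  by apply/seteqP; split.
have mD := measurable_tail n.+1 m mB.
set D := tail B n.+1 m in mD *.
pose pair w := (chain n w, X n w).
have mpair : measurable_fun setT pair.
  by apply: measurable_fun_pair; [exact: measurable_chain|exact: measurable_funP].
pose G : set (set (E * R)) := [set C | exists A1 B1, [/\ measurable A1, measurable B1 & C = A1 `*` B1]].
have rect (A1 : set E) (B1 : set R) : measurable A1 -> measurable B1 ->
    P (chain n @^-1` A1 `&` X n @^-1` B1 `&` D) =
    P (chain n @^-1` A1 `&` X n @^-1` B1) * P D.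
  move=> mA1 mB1; pose B' j := if j == n then B1 else B j.
  have mB' j : measurable (B' j) by rewrite /B'; case: eqP.
  have tB' l : (n < l)%N -> tail B' n l = X n @^-1` B1 `&` tail B n.+1 l.
    move=> nl; rewrite tail_recl// /B' eqxx; congr (_ `&` _).
    apply: eq_bigcapr => j; rewrite /= mem_index_iota => /andP[nj _].
    by rewrite gtn_eqF.
  have -> : chain n @^-1` A1 `&` X n @^-1` B1 = chain n @^-1` A1 `&` tail B' n n.+1.
    rewrite tB'// (_ : tail B n.+1 n.+1 = setT) ?setIT//.
    by apply/seteqP; split => // w _ j; rewrite /= /index_iota subnn.
  rewrite ih// {1}/D -setIA.
  have -> : tail B' n n.+1 `&` tail B n.+1 m = tail B' n m.
    rewrite [in RHS]tB'// tB'// (_ : tail B n.+1 n.+1 = setT) ?setIT//.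
    by apply/seteqP; split => // w _ j; rewrite /= /index_iota subnn.
  rewrite ih ?(ltnW nm)// -muleA; congr (_ * _).
  rewrite !indep_tail// big_nat1 (big_ltn nm)/=; congr (_ * _).
  apply: eq_big_nat => j /andP[nj _]; rewrite /B' gtn_eqF//.
have key : forall C : set (E * R), measurable C ->
    P (pair @^-1` C `&` D) = P D * P (pair @^-1` C).
  have PD0 : (0 <= fine (P D))%R by rewrite fine_ge0.
  have PDE : (fine (P D))%:E = P D by rewrite fineK// fin_num_measure.
  pose m1 : {measure set (E * R) -> \bar R} := pushforward (mrestr P mD) pair.
  pose m2 : {measure set (E * R) -> \bar R} := mscale (NngNum PD0) (pushforward P pair).
  move=> C mC; rewrite -PDE -[LHS]/(m1 mpair C) -[RHS]/(m2 mpair C).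
  apply: (@measure_unique _ _ _ G (fun=> setT)) => //.
  - rewrite measurable_prod_measurableType; congr (<<s _ >>).
    apply/seteqP; split=> [_ [A1 mA1 [B1 mB1 <-]]|_ [A1 [B1 [mA1 mB1 ->]]]].
      by exists A1, B1.
    by exists A1 => //; exists B1.
  - move=> _ _ [A1 [B1 [mA1 mB1 ->]]] [A2 [B2 [mA2 mB2 ->]]].
    exists (A1 `&` A2), (B1 `&` B2); split; [exact: measurableI|exact: measurableI|].
    by rewrite setXI.
  - by move=> _; exists setT, setT; split => //; rewrite setXTT.
  - by rewrite bigcup_const//; exists 0%N.
  - move=> _ [A1 [B1 [mA1 mB1 ->]]].
    rewrite -[LHS]/(P (chain n @^-1` A1 `&` X n @^-1` B1 `&` D)) rect// muleC -PDE.
    by [].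
  - move=> _; rewrite -[X in X < _]/(P (setT `&` D)) setTI.
    by rewrite -PDE ltry.
have mC : measurable (phi n @^-1` A) by rewrite -[X in measurable X]setTI; exact: mphi.
by rewrite -[chain n.+1 @^-1` A]/(pair @^-1` (phi n @^-1` A)) key// muleC.
Qed.

Lemma integral_chain n (F : E * R -> \bar R) :
  measurable_fun setT F -> (forall z, 0 <= F z) ->
  \int[P]_w F (chain n w, X n w) =
  \int[P]_w \int[pushforward P (X n)]_x F (chain n w, x).
Proof.
move=> mF F0; apply: integral_indep_pair => //; first exact: measurable_chain.
move=> A B mA mB.
have := @chain_indep_tail n n.+1 A (fun=> B) (leqnSn n) mA (fun=> mB).
by rewrite /tail /index_iota subSnn /= bigcap_seq big_seq1.
Qed.

End Chain.

Lemma gauss_exponent (F : fieldType) (x s r b : F) : s != 0 -> r != 0 ->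
  2 != 0 :> F -> r ^+ 2 = 1 - b * s ^+ 2 ->
  b * x ^+ 2 / 2 + - x ^+ 2 / (s ^+ 2 *+ 2) = - x ^+ 2 / ((s / r) ^+ 2 *+ 2).
Proof.
move=> s0 r0 n2 r2.
have -> : b = (1 - r ^+ 2) / s ^+ 2 by rewrite r2 opprB addrCA subrr addr0 mulfK ?expf_neq0.
by rewrite -(mulr_natr (s ^+ 2)) -(mulr_natr ((s / r) ^+ 2)); field; rewrite n2 r0 s0.
Qed.

Section GaussianIntegrals.
Context {R : realType}.
Notation leb := (@lebesgue_measure R).
Local Open Scope ereal_scope.

Lemma integral_normal_probE (m s : R) (f : R -> \bar R) : measurable_fun setT f ->
  (forall x, 0 <= f x) ->
  \int[normal_prob m s]_x f x = \int[leb]_x (f x * (normal_pdf m s x)%:E).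
Proof.
move=> mf f0; have dom := normal_prob_dominates m s.
rewrite -(@Radon_Nikodym_SigmaFinite.change_of_variables _ _ _ _ leb dom)//.
have mpdf : measurable_fun setT (EFin \o normal_pdf m s).
  by apply/measurable_EFinP; exact: measurable_normal_pdf.
have iRN := Radon_Nikodym_SigmaFinite.f_integrable dom.
have mRN := measurable_int _ iRN.
apply: ae_eq_integral => //.
- exact: emeasurable_funM.
- exact: emeasurable_funM.
apply: ae_eqe_mul2l; apply: integral_ae_eq => // A _ mA.
by rewrite -Radon_Nikodym_SigmaFinite.f_integral.
Qed.

Lemma lebesgue_measure_shift (c : R) (A : set R) : measurable A ->
  pushforward leb ((fun x => x + c)%R : _ -> measurableTypeR R) A = leb A.
Proof.
move=> mA; apply/esym/lebesgue_measure_unique => //=; first exact: measurable_funD.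
move=> ? _ [[a b]] _ <-.
have pre : (fun x => x + c)%R @^-1` `]a, b] = `](a - c)%R, (b - c)%R]%classic.
  by apply/seteqP; split=> x; rewrite /= !in_itv/= ltrBlDr lerBrDr.
rewrite /pushforward /= [in RHS]pre !lebesgue_measure_itv/= !lte_fin ltrD2r.
by case: ifP => // _; rewrite -!EFinD; congr EFin; ring.
Qed.

Lemma ge0_integral_shift (c : R) (f : R -> \bar R) : measurable_fun setT f ->
  (forall x, 0 <= f x) -> \int[leb]_x f (x + c)%R = \int[leb]_x f x.
Proof.
move=> mf f0.
have mc : measurable_fun setT ((fun x => x + c)%R : measurableTypeR R -> measurableTypeR R).
  exact: (@measurable_funD _ R R).
have := @ge0_integral_pushforward _ _ (measurableTypeR R) (measurableTypeR R) R _ mc leb setT f measurableT mf.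
rewrite preimage_setT /comp => <- //.
by apply: eq_measure_integral => A mA _; exact: (lebesgue_measure_shift c mA).
Qed.

Lemma integral_normal_tilt (s a : R) (f : R -> \bar R) : s != 0%R ->
  measurable_fun setT f -> (forall x, 0 <= f x) ->
  \int[normal_prob 0 s]_x (f x * (expR (a * x))%:E) =
  (expR (s ^+ 2 * a ^+ 2 / 2))%:E * \int[normal_prob 0 s]_x f (x + s ^+ 2 * a)%R.
Proof.
move=> s0 mf f0.
have mexp : measurable_fun setT (fun x : R => (expR (a * x))%:E).
  by apply/measurable_EFinP; apply: measurableT_comp => //; exact: measurable_funM.
have mpdf : measurable_fun setT (EFin \o normal_pdf 0 s).
  by apply/measurable_EFinP; exact: measurable_normal_pdf.
have mshift g : measurable_fun setT g -> measurable_fun setT (fun x : R => g (x + s ^+ 2 * a)%R : \bar R).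
  by move=> mg; apply: (measurableT_comp mg); exact: measurable_funD.
have mfe : measurable_fun setT (fun x => f x * (expR (a * x))%:E) by exact: emeasurable_funM.
have fe0 x : 0 <= f x * (expR (a * x))%:E by rewrite mule_ge0// lee_fin expR_ge0.
have mfs := mshift _ mf.
have mfp : measurable_fun setT (fun x : R => f (x + s ^+ 2 * a)%R * (normal_pdf 0 s x)%:E).
  exact: emeasurable_funM.
have fp0 (x : R) : [set: R] x -> 0 <= f (x + s ^+ 2 * a)%R * (normal_pdf 0 s x)%:E.
  by move=> _; rewrite mule_ge0// lee_fin normal_pdf_ge0.
rewrite !integral_normal_probE// -ge0_integralZl//.
rewrite -[LHS](ge0_integral_shift (s ^+ 2 * a)).
- apply: eq_integral => x _; rewrite -muleA [RHS]muleCA; congr (_ * _).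
  rewrite -!EFinM !normal_pdfE//; congr EFin.
  rewrite mulrCA [RHS]mulrCA; congr (_ * _)%R.
  rewrite /normal_fun -!expRD; congr expR.
  by rewrite !subr0 -mulr_natr; field.
- by apply: emeasurable_funM => //; exact: emeasurable_funM.
- by move=> x; rewrite !mule_ge0// lee_fin ?expR_ge0 ?normal_pdf_ge0.
Qed.

Lemma integral_normal_expR (s a : R) : s != 0%R ->
  \int[normal_prob 0 s]_x (expR (a * x))%:E = (expR (s ^+ 2 * a ^+ 2 / 2))%:E.
Proof.
move=> s0; have := @integral_normal_tilt s a (cst 1) s0.
under eq_integral do rewrite mul1e.
move=> ->//.
by rewrite integral_cst// mul1e [X in _ * X](@probability_setT _ _ _ (normal_prob 0 s)) mule1.
Qed.

Lemma integral_normal_expR_sqr (s b : R) : s != 0%R -> (b * s ^+ 2 < 1)%R ->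
  \int[normal_prob 0 s]_x (expR (b * x ^+ 2 / 2))%:E =
  ((Num.sqrt (1 - b * s ^+ 2))^-1)%:E.
Proof.
move=> s0 bs.
have D0 : (0 < 1 - b * s ^+ 2)%R by rewrite subr_gt0.
set r := Num.sqrt (1 - b * s ^+ 2).
have r0 : (0 < r)%R by rewrite sqrtr_gt0.
have r2 : (r ^+ 2 = 1 - b * s ^+ 2)%R by rewrite sqr_sqrtr// ltW.
have mexp : measurable_fun setT (fun x : R => (expR (b * x ^+ 2 / 2))%:E).
  apply/measurable_EFinP; apply: measurableT_comp => //.
  by apply: measurable_funM => //; apply: measurable_funM => //; exact: measurable_funX.
rewrite integral_normal_probE//.
have sr0 : (s / r != 0)%R by rewrite mulf_neq0// invr_eq0 gt_eqF.
have mpdf : measurable_fun setT (fun x : R => (normal_pdf 0 (s / r) x)%:E).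
  by apply/measurable_EFinP; exact: measurable_normal_pdf.
have pdf0 (x : R) : [set: R] x -> 0 <= (normal_pdf 0 (s / r) x)%:E.
  by move=> _; rewrite lee_fin normal_pdf_ge0.
have r'0 : 0 <= r^-1%:E by rewrite lee_fin invr_ge0 ltW.
transitivity (\int[leb]_x (r^-1%:E * (normal_pdf 0 (s / r) x)%:E)); last first.
  by rewrite (ge0_integralZl leb measurableT mpdf pdf0 r'0) integral_normal_pdf mule1.
apply: eq_integral => x _; rewrite -!EFinM !normal_pdfE//; congr EFin.
rewrite mulrCA [RHS]mulrA; congr (_ * _)%R; last first.
  rewrite /normal_fun -expRD; congr expR; rewrite !subr0.
  by apply: gauss_exponent; rewrite // gt_eqF.
rewrite /normal_peak.
have -> : ((s / r) ^+ 2 * pi *+ 2 = (s ^+ 2 * pi *+ 2) * (r^-1) ^+ 2)%R.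
  by rewrite exprMn -!mulrnAl mulrAC.
rewrite sqrtrM; last by rewrite mulrn_wge0// mulr_ge0 ?sqr_ge0 ?pi_ge0.
by rewrite sqrtr_sqr ger0_norm ?invr_ge0 ?ltW// invfM invrK mulrCA mulVf ?mulr1// gt_eqF.
Qed.

End GaussianIntegrals.

Section CenteredGaussian.
Context {R : realType}.

Let measurable_id_R : measurable_fun setT (idfun : measurableTypeR R -> R).
Proof. by move=> _ B mB; rewrite setTI. Qed.

Let id_R : {mfun measurableTypeR R >-> R} :=
  @mfun_Sub _ _ (measurableTypeR R) R idfun (mem_set measurable_id_R).

(* [normal_prob] lives on [measurableTypeR R], whose Borel structure is not the
   canonical one on [R]; [gauss] transports it. *)
Definition gauss (s : R) : probability R R := distribution (normal_prob 0 s) id_R.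

Lemma integral_gauss s (f : R -> \bar R) : measurable_fun setT f ->
  (forall x, (0 <= f x)%E) ->
  (\int[gauss s]_x f x = \int[normal_prob 0 s]_x f x)%E.
Proof. by move=> mf f0; rewrite ge0_integral_distribution. Qed.

Lemma gauss_tilt (s a : R) (f : R -> \bar R) : s != 0 ->
  measurable_fun setT f -> (forall x, (0 <= f x)%E) ->
  (\int[gauss s]_x (f x * (expR (a * x))%:E) =
   (expR (s ^+ 2 * a ^+ 2 / 2))%:E * \int[gauss s]_x f (x + s ^+ 2 * a)%R)%E.
Proof.
move=> s0 mf f0.
have mexp : measurable_fun setT (fun x : R => (expR (a * x))%:E).
  by apply/measurable_EFinP; apply: measurableT_comp => //; exact: measurable_funM.
have mfe : measurable_fun setT (fun x : R => f x * (expR (a * x))%:E)%E.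
  exact: emeasurable_funM.
have fe0 x : (0 <= f x * (expR (a * x))%:E)%E by rewrite mule_ge0// lee_fin expR_ge0.
have mfs : measurable_fun setT (fun x : R => f (x + s ^+ 2 * a)%R).
  by apply: (measurableT_comp mf); exact: measurable_funD.
by rewrite !integral_gauss// integral_normal_tilt.
Qed.

Lemma gauss_expR (s a : R) : s != 0 ->
  (\int[gauss s]_x (expR (a * x))%:E = (expR (s ^+ 2 * a ^+ 2 / 2))%:E)%E.
Proof.
move=> s0; rewrite integral_gauss ?integral_normal_expR//.
by apply/measurable_EFinP; apply: measurableT_comp => //; exact: measurable_funM.
Qed.

Lemma gauss_expR_sqr (s b : R) : s != 0 -> b * s ^+ 2 < 1 ->
  (\int[gauss s]_x (expR (b * x ^+ 2 / 2))%:E = ((Num.sqrt (1 - b * s ^+ 2))^-1)%:E)%E.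
Proof.
move=> s0 bs; rewrite integral_gauss ?integral_normal_expR_sqr//.
apply/measurable_EFinP; apply: measurableT_comp => //.
by apply: measurable_funM => //; apply: measurable_funM => //; exact: measurable_funX.
Qed.

Lemma integral_law_gauss d (Omega : measurableType d) (P : probability Omega R)
    (X : {RV P >-> R}) (s : R) (f : R -> \bar R) :
  (forall B, measurable B -> P (X @^-1` B) = normal_prob 0 s B) ->
  (\int[pushforward P X]_x f x = \int[gauss s]_x f x)%E.
Proof.
move=> lawX; rewrite -[pushforward P X]/(distribution P X).
by apply: eq_measure_integral => A mA _; exact: lawX.
Qed.

End CenteredGaussian.

Section GaussianWalk.
Context d (Omega : measurableType d) (R : realType) (P : probability Omega R).
Variables (X : nat -> {RV P >-> R}) (s : R) (c1 c2 : nat -> R) (y0 : R * R).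
Hypothesis s0 : s != 0.
Hypothesis indep : mutually_independent P (fun n => sigma_rv (X n)).
Hypothesis lawX : forall n B, measurable B -> P (X n @^-1` B) = normal_prob 0 s B.

Definition walk_step (n : nat) (yx : (R * R) * R) : R * R :=
  (yx.1.1 + c1 n * yx.2, yx.1.2 + c2 n * yx.2).

Definition walk : nat -> Omega -> R * R := chain X y0 walk_step.

Lemma measurable_walk_step n : measurable_fun setT (walk_step n).
Proof.
apply: measurable_fun_pair; apply: measurable_funD.
- by apply: (measurableT_comp measurable_fst); exact: measurable_fst.
- by apply: measurable_funM => //; exact: measurable_snd.
- by apply: (measurableT_comp measurable_snd); exact: measurable_fst.
- by apply: measurable_funM => //; exact: measurable_snd.
Qed.

Lemma measurable_walk n : measurable_fun setT (walk n).
Proof. by apply: measurable_chain; exact: measurable_walk_step. Qed.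

Definition walk_mean1 (l : R * R) n : R :=
  \sum_(j < n) c1 j * (l.1 * c1 j + l.2 * c2 j).
Definition walk_mean2 (l : R * R) n : R :=
  \sum_(j < n) c2 j * (l.1 * c1 j + l.2 * c2 j).
Definition walk_var (l : R * R) n : R :=
  \sum_(j < n) (l.1 * c1 j + l.2 * c2 j) ^+ 2.

Local Open Scope ereal_scope.

Lemma integral_walkS n (F : R * R -> \bar R) : measurable_fun setT F ->
  (forall z, 0 <= F z) ->
  \int[P]_w F (walk n.+1 w) =
  \int[P]_w \int[gauss s]_x F (walk_step n (walk n w, x)).
Proof.
move=> mF F0.
have mFs : measurable_fun setT (fun z => F (walk_step n z)).
  by apply: (measurableT_comp mF); exact: measurable_walk_step.
have h := integral_chain y0 measurable_walk_step indep n mFs (fun z => F0 _).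
rewrite /walk/= h; apply: eq_integral => w _.
exact: integral_law_gauss (lawX n).
Qed.

Lemma measurable_integral_step (F : (R * R) * R -> \bar R) : measurable_fun setT F ->
  (forall z, 0 <= F z) ->
  measurable_fun setT (fun y => \int[gauss s]_x F (y, x)).
Proof. by move=> mF F0; exact: measurable_fun_fubini_tonelli_F. Qed.

Lemma integral_walk_tilt (l : R * R) n (F : R * R -> \bar R) :
  measurable_fun setT F -> (forall z, 0 <= F z) ->
  \int[P]_w (F (walk n w) * (expR (l.1 * (walk n w).1 + l.2 * (walk n w).2))%:E) =
  (expR (l.1 * y0.1 + l.2 * y0.2 + s ^+ 2 * walk_var l n / 2))%:E *
  \int[P]_w F ((walk n w).1 + s ^+ 2 * walk_mean1 l n, (walk n w).2 + s ^+ 2 * walk_mean2 l n)%R.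
Proof.
have mE : measurable_fun setT (fun y : R * R => (expR (l.1 * y.1 + l.2 * y.2))%:E).
  apply/measurable_EFinP; apply: measurableT_comp => //; apply: measurable_funD.
    by apply: measurable_funM => //; exact: measurable_fst.
  by apply: measurable_funM => //; exact: measurable_snd.
have mS (a b : R) : measurable_fun setT (fun y : R * R => (y.1 + a, y.2 + b)%R).
  by apply: measurable_fun_pair; apply: measurable_funD.
elim: n F => [|n ih] F mF F0.
  rewrite /walk_mean1 /walk_mean2 /walk_var !big_ord0 !mulr0 mul0r !addr0 /walk /=.
  rewrite !integral_cst//= probability_setT !mule1 muleC.
  by rewrite !addr0 -surjective_pairing.
set a := (l.1 * c1 n + l.2 * c2 n)%R.
pose G (z : (R * R) * R) : \bar R :=
  F (z.1.1 + c1 n * (z.2 + s ^+ 2 * a), z.1.2 + c2 n * (z.2 + s ^+ 2 * a))%R.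
have mG : measurable_fun setT G.
  have m2 : measurable_fun setT (fun z : (R * R) * R => (z.2 + s ^+ 2 * a)%R).
    by apply: measurable_funD => //; exact: measurable_snd.
  apply: (measurableT_comp mF); apply: measurable_fun_pair; apply: measurable_funD.
  - by apply: (measurableT_comp measurable_fst); exact: measurable_fst.
  - exact: measurable_funM.
  - by apply: (measurableT_comp measurable_snd); exact: measurable_fst.
  - exact: measurable_funM.
have mFE : measurable_fun setT (fun y => F y * (expR (l.1 * y.1 + l.2 * y.2))%:E).
  exact: emeasurable_funM.
have mIG : measurable_fun setT (fun y => \int[gauss s]_x G (y, x)).
  by apply: measurable_integral_step => // z; exact: F0.
have IG0 y : 0 <= \int[gauss s]_x G (y, x) by apply: integral_ge0 => x _; exact: F0.
have mwE n' : measurable_fun setT (fun w => (expR (l.1 * (walk n' w).1 + l.2 * (walk n' w).2))%:E).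
  exact: (measurableT_comp mE (measurable_walk n')).
rewrite (@integral_walkS n _ mFE); last by move=> z; rewrite mule_ge0// lee_fin expR_ge0.
transitivity (\int[P]_w ((expR (s ^+ 2 * a ^+ 2 / 2))%:E *
  ((\int[gauss s]_x G (walk n w, x)) *
   (expR (l.1 * (walk n w).1 + l.2 * (walk n w).2))%:E))).
  apply: eq_integral => w _; move: (walk n w) => y.
  have mFy : measurable_fun setT (fun x : R => F (walk_step n (y, x))).
    apply: (measurableT_comp mF); apply: (measurableT_comp (measurable_walk_step n)).
    by apply: measurable_fun_pair => //; exact: measurable_cst.
  have mexp : measurable_fun setT (fun x : R => (expR (a * x))%:E).
    by apply/measurable_EFinP; apply: measurableT_comp => //; exact: measurable_funM.
  rewrite muleA -[X in X * _](gauss_tilt a s0 mFy (fun x => F0 _)).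
  rewrite -ge0_integralZr//.
  - apply: eq_integral => x _; rewrite -muleA -EFinM -expRD; congr (_ * (expR _)%:E).
    by rewrite /walk_step /a /=; ring.
  - exact: emeasurable_funM.
  - by move=> x _; rewrite mule_ge0// lee_fin expR_ge0.
rewrite ge0_integralZl//=; last 2 first.
- by apply: emeasurable_funM => //; exact: (measurableT_comp mIG (measurable_walk n)).
- by move=> w _; rewrite mule_ge0// lee_fin expR_ge0.
rewrite (ih _ mIG IG0) muleA -EFinM -expRD; congr ((expR _)%:E * _).
  by rewrite /walk_var big_ord_recr/= -/a; field.
pose F' (y : R * R) := F (y.1 + s ^+ 2 * walk_mean1 l n.+1, y.2 + s ^+ 2 * walk_mean2 l n.+1)%R.
have mF' : measurable_fun setT F' by exact: (measurableT_comp mF (mS _ _)).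
rewrite -[RHS]/(\int[P]_w F' (walk n.+1 w)) (integral_walkS n mF' (fun z => F0 _)).
apply: eq_integral => w _; apply: eq_integral => x _.
rewrite /G /F' /walk_step /walk_mean1 /walk_mean2 !big_ord_recr/= -/a.
by congr (F (_, _)); ring.
Qed.

End GaussianWalk.

Section HubbardStratonovich.
Context d (Omega : measurableType d) (R : realType) (P : probability Omega R).
Local Open Scope ereal_scope.

(* A square in the exponent is a Gaussian average of linear exponents
   (Hubbard-Stratonovich), which reduces [walk_exp_moment] to [walk_mgf]. *)
Lemma integral_expR_sqr (r : R) (g : Omega -> R) (K : Omega -> \bar R) : r != 0%R ->
  measurable_fun setT g -> measurable_fun setT K -> (forall w, 0 <= K w) ->
  \int[P]_w (K w * (expR (r ^+ 2 * g w ^+ 2 / 2))%:E) =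
  \int[gauss r]_e \int[P]_w (K w * (expR (e * g w))%:E).
Proof.
move=> r0 mg mK K0.
have mexp (w : Omega) : measurable_fun setT (fun x : R => (expR (g w * x))%:E).
  by apply/measurable_EFinP; apply: measurableT_comp => //; exact: measurable_funM.
have mF : measurable_fun setT (fun z : Omega * R => K z.1 * (expR (g z.1 * z.2))%:E).
  apply: emeasurable_funM; first by apply: (measurableT_comp mK); exact: measurable_fst.
  apply/measurable_EFinP; apply: measurableT_comp => //; apply: measurable_funM.
    by apply: (measurableT_comp mg); exact: measurable_fst.
  exact: measurable_snd.
transitivity (\int[P]_w \int[gauss r]_e (K w * (expR (g w * e))%:E)).
  apply: eq_integral => w _.
  rewrite ge0_integralZl//.
  by rewrite gauss_expR.
have F0 (z : Omega * R) : 0 <= K z.1 * (expR (g z.1 * z.2))%:E.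
  by rewrite mule_ge0// lee_fin expR_ge0.
have E := @fubini_tonelli _ _ _ _ R P (gauss r) _ mF F0.
rewrite [LHS]E.
by apply: eq_integral => e _; apply: eq_integral => w _; rewrite mulrC.
Qed.

End HubbardStratonovich.

Section WalkMoment.
Context d (Omega : measurableType d) (R : realType) (P : probability Omega R).
Variables (X : nat -> {RV P >-> R}) (s : R) (c1 c2 : nat -> R) (y0 : R * R).
Hypothesis s0 : s != 0.
Hypothesis indep : mutually_independent P (fun n => sigma_rv (X n)).
Hypothesis lawX : forall n B, measurable B -> P (X n @^-1` B) = normal_prob 0 s B.
Notation walk := (walk X c1 c2 y0).

Let mw1 n : measurable_fun setT (fun w => (walk n w).1).
Proof. by apply: (measurableT_comp measurable_fst); exact: measurable_walk. Qed.
Let mw2 n : measurable_fun setT (fun w => (walk n w).2).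
Proof. by apply: (measurableT_comp measurable_snd); exact: measurable_walk. Qed.

Local Open Scope ereal_scope.

Lemma walk_mgf (l : R * R) n :
  \int[P]_w (expR (l.1 * (walk n w).1 + l.2 * (walk n w).2))%:E =
  (expR (l.1 * y0.1 + l.2 * y0.2 + s ^+ 2 * walk_var c1 c2 l n / 2))%:E.
Proof.
have h := integral_walk_tilt c1 c2 y0 s0 indep lawX l n (@measurable_cst _ _ _ _ _ 1) (fun=> lee01).
under eq_integral do rewrite -[X in (expR X)%:E]addr0 -[X in X%:E]mul1r EFinM addr0.
rewrite h /= integral_cst//= probability_setT !mule1//.
Qed.

Lemma walk_exp_moment n (r V K : R) : r != 0%R -> (V * r ^+ 2 < 1)%R ->
  (forall l : R * R, l.1 * y0.1 + l.2 * y0.2 + s ^+ 2 * walk_var c1 c2 l n / 2 <=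
    K + V * (l.1 ^+ 2 + l.2 ^+ 2) / 2)%R ->
  \int[P]_w (expR (r ^+ 2 * ((walk n w).1 ^+ 2 + (walk n w).2 ^+ 2) / 2))%:E <=
  (expR K / (1 - V * r ^+ 2))%:E.
Proof.
move=> r0 Vr hV.
have me (f : Omega -> R) : measurable_fun setT f -> measurable_fun setT (fun w => (expR (f w))%:E).
  by move=> mf; apply/measurable_EFinP; exact: measurableT_comp.
have meM (b : R) (f : Omega -> R) : measurable_fun setT f -> measurable_fun setT (fun w : Omega => (expR (b * f w))%:E).
  by move=> mf; apply: me; exact: measurable_funM.
have meS (f : Omega -> R) : measurable_fun setT f -> measurable_fun setT (fun w : Omega => (expR (r ^+ 2 * f w ^+ 2 / 2))%:E).
  move=> mf; apply: me; apply: measurable_funM => //; apply: measurable_funM => //.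
  exact: measurable_funX.
have e0 (f : Omega -> R) w : 0 <= (expR (f w))%:E by rewrite lee_fin expR_ge0.
have -> : \int[P]_w (expR (r ^+ 2 * ((walk n w).1 ^+ 2 + (walk n w).2 ^+ 2) / 2))%:E =
    \int[P]_w ((expR (r ^+ 2 * (walk n w).1 ^+ 2 / 2))%:E * (expR (r ^+ 2 * (walk n w).2 ^+ 2 / 2))%:E).
  by apply: eq_integral => w _; rewrite -EFinM -expRD; congr (expR _)%:E; ring.
rewrite (@integral_expR_sqr _ _ _ P r (fun w => (walk n w).2) _ r0 (mw2 n) (meS _ (mw1 n)) (e0 _)).
have inner e2 : \int[P]_w ((expR (r ^+ 2 * (walk n w).1 ^+ 2 / 2))%:E * (expR (e2 * (walk n w).2))%:E) =
    \int[gauss r]_e1 (expR (e1 * y0.1 + e2 * y0.2 + s ^+ 2 * walk_var c1 c2 (e1, e2) n / 2))%:E.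
  under eq_integral do rewrite muleC.
  rewrite (@integral_expR_sqr _ _ _ P r (fun w => (walk n w).1) _ r0 (mw1 n) (meM _ _ (mw2 n)) (e0 _)).
  have mgf e1 : \int[P]_w ((expR (e2 * (walk n w).2))%:E * (expR (e1 * (walk n w).1))%:E) =
      (expR (e1 * y0.1 + e2 * y0.2 + s ^+ 2 * walk_var c1 c2 (e1, e2) n / 2))%:E.
    have h := walk_mgf (e1, e2) n; rewrite /= in h; rewrite -h.
    by apply: eq_integral => w _; rewrite -EFinM -expRD addrC.
  by apply: eq_integral => e1 _; exact: mgf.
under eq_integral do rewrite inner.
pose Q := ((Num.sqrt (1 - V * r ^+ 2))^-1)%R.
have Q0 : (0 <= Q)%R by rewrite invr_ge0 sqrtr_ge0.
pose E (z : R * R) := (expR (z.2 * y0.1 + z.1 * y0.2 + s ^+ 2 * walk_var c1 c2 (z.2, z.1) n / 2))%:E.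
have mE : measurable_fun setT E.
  apply/measurable_EFinP; apply: measurableT_comp => //.
  apply: measurable_funD; first by apply: measurable_funD; apply: measurable_funM.
  apply: measurable_funM => //; apply: measurable_funM => //.
  apply: measurable_sum => j; apply: measurable_funX.
  apply: measurable_funD; apply: measurable_funM => //=; [exact: measurable_snd|exact: measurable_fst].
have E0 z : 0 <= E z by rewrite lee_fin expR_ge0.
have mEr (b : R) : measurable_fun setT (fun e : R => (expR (b * e ^+ 2 / 2))%:E).
  apply/measurable_EFinP; apply: measurableT_comp => //.
  by apply: measurable_funM => //; apply: measurable_funM => //; exact: measurable_funX.
have step e2 : \int[gauss r]_e1 E (e2, e1) <= (Q * expR K)%:E * (expR (V * e2 ^+ 2 / 2))%:E.
  rewrite (@le_trans _ _ (\int[gauss r]_e1 ((expR K)%:E * (expR (V * e2 ^+ 2 / 2))%:E * (expR (V * e1 ^+ 2 / 2))%:E)))//.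
    apply: ge0_le_integral => //.
    - by apply: (measurableT_comp mE); apply: measurable_fun_pair => //; exact: measurable_cst.
    - exact: measurable_funeM.
    - move=> e1 _; rewrite -!EFinM lee_fin -!expRD ler_expR (le_trans (hV (e1, e2)))//=.
      lra.
  rewrite ge0_integralZl//.
  by rewrite gauss_expR_sqr// -!EFinM lee_fin -/Q mulrC mulrA.
apply: (@le_trans _ _ (\int[gauss r]_e2 ((Q * expR K)%:E * (expR (V * e2 ^+ 2 / 2))%:E))).
  apply: ge0_le_integral => //.
  - by move=> e2 _; exact: integral_ge0.
  - by apply: (measurable_fun_fubini_tonelli_F (m2:=gauss r) E mE E0).
  - exact: measurable_funeM.
  - by move=> e2 _; exact: step.
have QK0 : 0 <= (Q * expR K)%:E by rewrite lee_fin mulr_ge0// expR_ge0.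
rewrite ge0_integralZl//.
rewrite gauss_expR_sqr// -!EFinM lee_fin -/Q mulrAC -expr2 mulrC.
by rewrite /Q exprVn sqr_sqrtr// subr_ge0 ltW.
Qed.

End WalkMoment.

Section RotationSums.
Context {R : realType} (theta : R).
Hypothesis sin0 : sin theta != 0.

Definition rot1 (j : nat) : R := cos (j.+1%:R * theta).
Definition rot2 (j : nat) : R := - sin (j.+1%:R * theta).

Lemma rot_sqr j : rot1 j ^+ 2 + rot2 j ^+ 2 = 1.
Proof. by rewrite /rot1 /rot2 sqrrN cos2Dsin2. Qed.

Let telesc (f g : nat -> R) (n : nat) : (forall j, `|f j| <= 1) ->
  (forall j, 2 * sin theta * g j = f j.+1 - f j) ->
  `|\sum_(j < n) g j| <= `|sin theta|^-1.
Proof.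
move=> f1 fg.
have s2 : 0 < `|sin theta| by rewrite normr_gt0.
have h : 2 * sin theta * (\sum_(j < n) g j) = f n - f 0%N.
  rewrite mulr_sumr; elim: n => [|n ih]; first by rewrite big_ord0 subrr.
  by rewrite big_ord_recr/= ih fg; ring.
rewrite -[leRHS]mul1r ler_pdivlMr// mulrC.
have h2 : `|2 * sin theta * (\sum_(j < n) g j)| <= 2.
  by rewrite h (le_trans (ler_normB _ _))// -[leRHS]/(1 + 1) lerD.
move: h2; rewrite -mulrA normrM ger0_norm// normrM; lra.
Qed.

Lemma rot_sum_diff n : `|\sum_(j < n) (rot1 j ^+ 2 - rot2 j ^+ 2)| <= `|sin theta|^-1.
Proof.
apply: (@telesc (fun j => sin (2 * j%:R * theta + theta))
  (fun j => rot1 j ^+ 2 - rot2 j ^+ 2)) => j.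
  by rewrite ler_norml sin_geN1 sin_le1.
rewrite /rot1 /rot2 sqrrN.
have -> : 2 * j.+1%:R * theta + theta = (j.+1%:R * theta + j.+1%:R * theta) + theta by ring.
have -> : 2 * j%:R * theta + theta = (j.+1%:R * theta + j.+1%:R * theta) - theta.
  by rewrite -natr1; ring.
move: (j.+1%:R * theta) => a; rewrite (sinD (a + a)) (sinB (a + a)) sinD cosD; ring.
Qed.

Lemma rot_sum_prod n : `|\sum_(j < n) (2 * rot1 j * rot2 j)| <= `|sin theta|^-1.
Proof.
apply: (@telesc (fun j => cos (2 * j%:R * theta + theta))
  (fun j => 2 * rot1 j * rot2 j)) => j.
  by rewrite ler_norml cos_geN1 cos_le1.
rewrite /rot1 /rot2.
have -> : 2 * j.+1%:R * theta + theta = (j.+1%:R * theta + j.+1%:R * theta) + theta by ring.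
have -> : 2 * j%:R * theta + theta = (j.+1%:R * theta + j.+1%:R * theta) - theta.
  by rewrite -natr1; ring.
move: (j.+1%:R * theta) => a; rewrite (cosD (a + a)) (cosB (a + a)) sinD cosD; ring.
Qed.

End RotationSums.

Lemma exp_markov d (Omega : measurableType d) (R : realType) (P : probability Omega R)
    (f : Omega -> R) (c : R) : measurable_fun setT f ->
  ((expR c)%:E * P [set w | (c <= f w)%R] <= \int[P]_w (expR (f w))%:E)%E.
Proof.
move=> mf.
have mA : measurable [set w | c <= f w].
  rewrite (_ : [set w | _] = f @^-1` `[c, +oo[%classic).
    by rewrite -[X in measurable X]setTI; apply: mf => //; exact: measurable_itv.
  by apply/seteqP; split => w /=; rewrite in_itv/= andbT.
have me : measurable_fun setT (fun w => (expR (f w))%:E).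
  by apply/measurable_EFinP; exact: measurableT_comp.
have mi : measurable_fun setT (fun w => (\1_[set w | c <= f w] w)%:E : \bar R).
  by apply/measurable_EFinP; exact: measurable_indic.
have i0 w : setT w -> (0 <= (\1_[set w | c <= f w] w)%:E :> \bar R)%E by rewrite lee_fin.
have ec0 : (0 <= (expR c)%:E)%E by rewrite lee_fin expR_ge0.
rewrite -(setIT [set w | _]) -integral_indic// -ge0_integralZl//.
apply: ge0_le_integral => //.
- exact: measurable_funeM.
move=> w _; rewrite -EFinM lee_fin indicE.
have [wA|wA] := boolP (w \in _); last by rewrite mulr0 expR_ge0.
by rewrite mulr1 ler_expR; rewrite inE in wA.
Qed.

Section WalkBounds.
Context d (Omega : measurableType d) (R : realType) (P : probability Omega R).
Variables (X : nat -> {RV P >-> R}) (s : R) (c1 c2 : nat -> R) (y0 : R * R) (C : R).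
Hypothesis s0 : s != 0.
Hypothesis indep : mutually_independent P (fun n => sigma_rv (X n)).
Hypothesis lawX : forall n B, measurable B -> P (X n @^-1` B) = normal_prob 0 s B.
Hypothesis csqr : forall j, c1 j ^+ 2 + c2 j ^+ 2 = 1.
Hypothesis cdiff : forall n, `|\sum_(j < n) (c1 j ^+ 2 - c2 j ^+ 2)| <= C.
Hypothesis cprod : forall n, `|\sum_(j < n) (2 * c1 j * c2 j)| <= C.
Notation walk := (walk X c1 c2 y0).

Let S n := \sum_(j < n) (c1 j ^+ 2 - c2 j ^+ 2).
Let T n := \sum_(j < n) (2 * c1 j * c2 j).

Let walk_varE l n : walk_var c1 c2 l n =
  (l.1 ^+ 2 + l.2 ^+ 2) * n%:R / 2 + (l.1 ^+ 2 - l.2 ^+ 2) * S n / 2 + l.1 * l.2 * T n.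
Proof.
rewrite /walk_var /S /T; elim: n => [|n ih]; first by rewrite !big_ord0; ring.
rewrite !big_ord_recr/= ih -[n.+1%:R]natr1.
have := csqr n; move: (c1 n) (c2 n) => a b ab.
have := congr1 (fun z => (l.1 ^+ 2 + l.2 ^+ 2) * z) ab => /=.
move: (\sum_(i < n) _) (\sum_(i < n) _) => u v; lra.
Qed.

Let walk_mean1E l n : walk_mean1 c1 c2 l n = l.1 * (n%:R + S n) / 2 + l.2 * T n / 2.
Proof.
rewrite /walk_mean1 /S /T; elim: n => [|n ih]; first by rewrite !big_ord0; ring.
rewrite !big_ord_recr/= ih -[n.+1%:R]natr1.
have := csqr n; move: (c1 n) (c2 n) => a b ab.
have -> : b ^+ 2 = 1 - a ^+ 2 by rewrite -ab addrAC subrr add0r.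
lra.
Qed.

Let walk_mean2E l n : walk_mean2 c1 c2 l n = l.1 * T n / 2 + l.2 * (n%:R - S n) / 2.
Proof.
rewrite /walk_mean2 /S /T; elim: n => [|n ih]; first by rewrite !big_ord0; ring.
rewrite !big_ord_recr/= ih -[n.+1%:R]natr1.
have := csqr n; move: (c1 n) (c2 n) => a b ab.
have -> : a ^+ 2 = 1 - b ^+ 2 by rewrite -ab addrK.
lra.
Qed.

Let quad_bound n (l1 l2 : R) :
  (l1 ^+ 2 - l2 ^+ 2) * S n / 2 + l1 * l2 * T n <= C * (l1 ^+ 2 + l2 ^+ 2).
Proof.
have := cdiff n; rewrite -/(S n) ler_norml => /andP[a1 a2].
have := cprod n; rewrite -/(T n) ler_norml => /andP[b1 b2].
have p1 : 0 <= l1 ^+ 2 * (C - S n) by rewrite mulr_ge0 ?sqr_ge0 ?subr_ge0.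
have p2 : 0 <= l2 ^+ 2 * (C + S n) by rewrite mulr_ge0 ?sqr_ge0//; lra.
have p3 : 0 <= (l1 + l2) ^+ 2 * (C - T n) by rewrite mulr_ge0 ?sqr_ge0 ?subr_ge0.
have p4 : 0 <= (l1 - l2) ^+ 2 * (C + T n) by rewrite mulr_ge0 ?sqr_ge0//; lra.
lra.
Qed.

Let C0 : 0 <= C. Proof. exact: le_trans (cdiff 0). Qed.

Lemma walk_upper (rho : R) : 1 < rho ->
  exists K : R, 0 < K /\ \forall N \near \oo,
  (\int[P]_w (expR (((walk N w).1 ^+ 2 + (walk N w).2 ^+ 2) / (rho * N%:R * s ^+ 2)))%:E
   <= K%:E)%E.
Proof.
move=> rho1; have rho0 : 0 < rho by rewrite (lt_trans _ rho1).
have s2 : 0 < s ^+ 2 by rewrite exprn_even_gt0.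
pose D := 1 - rho^-1; have D0 : 0 < D by rewrite subr_gt0 invf_lt1.
pose K0 := (y0.1 ^+ 2 + y0.2 ^+ 2) / 2.
exists (expR K0 / (D / 2)); split; first by rewrite divr_gt0 ?expR_gt0 ?divr_gt0.
near=> N.
have N0 : 0 < N%:R :> R by rewrite ltr0n; near: N; exists 1%N.
pose V := s ^+ 2 * (N%:R / 2 + C) + 1.
pose r := Num.sqrt (2 / (rho * N%:R * s ^+ 2)).
have q0 : 0 < rho * N%:R * s ^+ 2 by rewrite mulr_gt0// mulr_gt0.
have r0 : r != 0 by apply: lt0r_neq0; rewrite /r sqrtr_gt0 divr_gt0.
have r2 : r ^+ 2 = 2 / (rho * N%:R * s ^+ 2).
  by rewrite sqr_sqrtr// divr_ge0// ltW.
have hN : (2 * s ^+ 2 * C + 2) / (rho * s ^+ 2) <= D / 2 * N%:R.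
  rewrite [leRHS]mulrC -ler_pdivrMr ?divr_gt0//.
  near: N; exact: nbhs_infty_ger.
have Vr : V * r ^+ 2 <= 1 - D / 2.
  have -> : V * r ^+ 2 = rho^-1 + (2 * s ^+ 2 * C + 2) / (rho * s ^+ 2) / N%:R.
    by rewrite r2 /V; field; rewrite ?s0 ?(lt0r_neq0 N0) ?(lt0r_neq0 rho0).
  have : (2 * s ^+ 2 * C + 2) / (rho * s ^+ 2) / N%:R <= D / 2 by rewrite ler_pdivrMr.
  rewrite /D; lra.
have Vr1 : V * r ^+ 2 < 1 by lra.
have -> : (\int[P]_w (expR (((walk N w).1 ^+ 2 + (walk N w).2 ^+ 2) / (rho * N%:R * s ^+ 2)))%:E =
   \int[P]_w (expR (r ^+ 2 * ((walk N w).1 ^+ 2 + (walk N w).2 ^+ 2) / 2))%:E)%E.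
  apply: eq_integral => w _; congr (expR _)%:E; rewrite r2.
  by field; rewrite ?s0 ?(lt0r_neq0 N0) ?(lt0r_neq0 rho0).
apply: (@le_trans _ _ (expR K0 / (1 - V * r ^+ 2))%:E).
  apply: (walk_exp_moment s0 indep lawX r0 Vr1) => -[l1 l2] /=.
  rewrite walk_varE /= /V /K0.
  have h1 : l1 * y0.1 <= (l1 ^+ 2 + y0.1 ^+ 2) / 2 by have := sqr_ge0 (l1 - y0.1); nra.
  have h2 : l2 * y0.2 <= (l2 ^+ 2 + y0.2 ^+ 2) / 2 by have := sqr_ge0 (l2 - y0.2); nra.
  have h3 : (l1 ^+ 2 - l2 ^+ 2) * S N / 2 + l1 * l2 * T N <= C * (l1 ^+ 2 + l2 ^+ 2).
    exact: quad_bound.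
  have h4 := ler_wpM2l (ltW s2) h3.
  lra.
have D1 : 0 < 1 - V * r ^+ 2 by lra.
have D2 : 0 < D / 2 by lra.
have D3 : D / 2 <= 1 - V * r ^+ 2 by lra.
by rewrite lee_fin ler_pM2l ?expR_gt0// lef_pV2.
Unshelve. all: by end_near.
Qed.

Let mw1 n : measurable_fun setT (fun w => (walk n w).1).
Proof. by apply: (measurableT_comp measurable_fst); exact: measurable_walk. Qed.
Let mw2 n : measurable_fun setT (fun w => (walk n w).2).
Proof. by apply: (measurableT_comp measurable_snd); exact: measurable_walk. Qed.

Lemma measurable_walk_box (u1 u2 e : R) n :
  measurable [set w | `|(walk n w).1 - u1| <= e /\ `|(walk n w).2 - u2| <= e].
Proof.
have h (f : Omega -> R) u : measurable_fun setT f -> measurable [set w | `|f w - u| <= e].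
  move=> mf; rewrite (_ : [set w | _] = (fun w => `|f w - u|) @^-1` `]-oo, e]%classic).
    have mg : measurable_fun setT (fun w => `|f w - u|).
      by apply: measurableT_comp => //; exact: measurable_funB.
    by rewrite -[X in measurable X]setTI; apply: mg => //; exact: measurable_itv.
  by apply/seteqP; split => w /=; rewrite in_itv.
rewrite -[X in measurable X]/([set w | _] `&` [set w | _]).
by apply: measurableI; exact: h.
Qed.

Lemma walk_concentration (eps : R) : 0 < eps -> \forall N \near \oo,
  ((2^-1)%:E <= P [set w | (`|(walk N w).1 - 0| <= eps * N%:R)%R /\ (`|(walk N w).2 - 0| <= eps * N%:R)%R])%E.
Proof.
move=> eps0; have s2 : 0 < s ^+ 2 by rewrite exprn_even_gt0.
have [K [K0 hK]] := walk_upper (ltr1n R 2 : 1 < 2).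
near=> N.
have N0 : 0 < N%:R :> R by rewrite ltr0n; near: N; exists 1%N.
have hKN : (\int[P]_w (expR (((walk N w).1 ^+ 2 + (walk N w).2 ^+ 2) / (2 * N%:R * s ^+ 2)))%:E
   <= K%:E)%E by near: N; exact: hK.
set A := [set w | _].
have mA : measurable A by exact: measurable_walk_box.
pose f w := ((walk N w).1 ^+ 2 + (walk N w).2 ^+ 2) / (2 * N%:R * s ^+ 2).
pose c := eps ^+ 2 * N%:R / (2 * s ^+ 2).
have mf : measurable_fun setT f.
  by apply: measurable_funM => //; apply: measurable_funD; exact: measurable_funX.
have c0 : 0 < c by rewrite /c divr_gt0// mulr_gt0// exprn_gt0.
have hA : ~` A `<=` [set w | c <= f w].
  move=> w /= /not_andP h.
  have q0 : 0 < 2 * N%:R * s ^+ 2 by rewrite mulr_gt0// mulr_gt0.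
  have -> : c = (eps * N%:R) ^+ 2 / (2 * N%:R * s ^+ 2).
    by rewrite /c; field; rewrite ?s0 ?(lt0r_neq0 N0).
  rewrite /f ler_pM2r ?invr_gt0//.
  have e0 : 0 <= eps * N%:R by rewrite mulr_ge0// ltW.
  have aux (x : R) : ~ (`|x - 0| <= eps * N%:R) -> (eps * N%:R) ^+ 2 <= x ^+ 2.
    move=> /negP; rewrite -ltNge subr0 => /ltW; rewrite -ler_sqr ?nnegrE//.
    by rewrite real_normK ?num_real.
  case: h => /aux h; first by rewrite (le_trans h)// lerDl sqr_ge0.
  by rewrite (le_trans h)// lerDr sqr_ge0.
have hP : ((expR c)%:E * P (~` A) <= K%:E)%E.
  have mcf : measurable [set w | c <= f w].
    rewrite (_ : [set w | _] = f @^-1` `[c, +oo[%classic).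
      by rewrite -[X in measurable X]setTI; apply: mf => //; exact: measurable_itv.
    by apply/seteqP; split => w /=; rewrite in_itv/= andbT.
  apply: (@le_trans _ _ ((expR c)%:E * P [set w | (c <= f w)%R])%E).
    apply: lee_wpmul2l; first by rewrite lee_fin expR_ge0.
    by apply: le_measure; rewrite ?inE//; exact: measurableC.
  exact: (le_trans (exp_markov P c mf) hKN).
have Kc : K / c <= 2^-1.
  rewrite ler_pdivrMr// /c mulrC.
  have -> : eps ^+ 2 * N%:R / (2 * s ^+ 2) * 2^-1 = N%:R * (eps ^+ 2 / (4 * s ^+ 2)).
    by field; exact: s0.
  have q0 : 0 < eps ^+ 2 / (4 * s ^+ 2) by rewrite divr_gt0// ?exprn_gt0// mulr_gt0.
  by rewrite -ler_pdivrMr//; near: N; exact: nbhs_infty_ger.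
have PA : P (~` A) = (1 - P A)%E by rewrite probability_setC.
move: hP; rewrite PA.
have /fineK <- : P A \is a fin_num by exact: fin_num_measure.
move: (fine (P A)) => p; rewrite -EFinB -EFinM !lee_fin => hp.
have e1 : 1 + c <= expR c by exact: expR_ge1Dx.
rewrite leNgt; apply/negP => p2.
have p1 : 2^-1 < 1 - p by lra.
have : expR c * 2^-1 < K.
  by rewrite (lt_le_trans _ hp)// ltr_pM2l// expR_gt0.
move: Kc; rewrite ler_pdivrMr//; lra.
Unshelve. all: by end_near.
Qed.

Lemma walk_lower (B eps del : R) : 0 < B -> 0 < eps -> 0 < del ->
  \forall N \near \oo, forall u1 u2 : R, `|u1| <= B -> `|u2| <= B ->
  ((2^-1 * expR (- (N%:R * ((u1 ^+ 2 + u2 ^+ 2) / s ^+ 2 + del))))%:E <=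
   P [set w | (`|(walk N w).1 - N%:R * u1| <= eps * N%:R)%R /\
              (`|(walk N w).2 - N%:R * u2| <= eps * N%:R)%R])%E.
Proof.
move=> B0 eps0 del0; have s2 : 0 < s ^+ 2 by rewrite exprn_even_gt0.
pose L := 4 * B / s ^+ 2.
have L0 : 0 < L by rewrite divr_gt0// mulr_gt0.
pose e' := Num.min (eps / 2) (del / 2 / L).
have e'0 : 0 < e'.
  by rewrite lt_min (divr_gt0 eps0)//= (divr_gt0 _ L0)// divr_gt0.
have e'1 : e' <= eps / 2 by rewrite ge_min lexx.
have e'2 : L * e' <= del / 2.
  by rewrite mulrC -ler_pdivlMr// ge_min lexx orbT.
pose K1 := L * (`|y0.1| + `|y0.2|) + 4 * B ^+ 2 * C / s ^+ 2.
near=> N => u1 u2 u1B u2B.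
have N0 : 0 < N%:R :> R by rewrite ltr0n; near: N; exists 1%N.
have hN1 : 2 * B * C <= eps / 2 * N%:R.
  rewrite [leRHS]mulrC -ler_pdivrMr ?divr_gt0//; near: N; exact: nbhs_infty_ger.
have hN2 : K1 <= del / 2 * N%:R.
  rewrite [leRHS]mulrC -ler_pdivrMr ?divr_gt0//; near: N; exact: nbhs_infty_ger.
have conc : ((2^-1)%:E <= P [set w | (`|(walk N w).1 - 0| <= e' * N%:R)%R /\ (`|(walk N w).2 - 0| <= e' * N%:R)%R])%E.
  near: N; exact: walk_concentration.
pose l : R * R := (- 2 * u1 / s ^+ 2, - 2 * u2 / s ^+ 2).
pose box : set (R * R) := [set y | `|y.1 - 0| <= e' * N%:R /\ `|y.2 - 0| <= e' * N%:R].
have mbox : measurable box.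
  have h (f : R * R -> R) : measurable_fun setT f -> measurable [set y | `|f y - 0| <= e' * N%:R].
    move=> mf; rewrite (_ : [set y | _] = (fun y => `|f y - 0|) @^-1` `]-oo, (e' * N%:R)]%classic).
      have mg : measurable_fun setT (fun y => `|f y - 0|).
        by apply: measurableT_comp => //; exact: measurable_funB.
      by rewrite -[X in measurable X]setTI; apply: mg => //; exact: measurable_itv.
    by apply/seteqP; split => w /=; rewrite in_itv.
  by apply: measurableI; apply: h; [exact: measurable_fst|exact: measurable_snd].
pose F (y : R * R) : \bar R := (\1_box y)%:E.
have mF : measurable_fun setT F by apply/measurable_EFinP; exact: measurable_indic.
have F0 y : (0 <= F y)%E by rewrite lee_fin.
pose X0 := l.1 * y0.1 + l.2 * y0.2 + s ^+ 2 * walk_var c1 c2 l N / 2.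
pose A' := [set w | box ((walk N w).1 + s ^+ 2 * walk_mean1 c1 c2 l N, (walk N w).2 + s ^+ 2 * walk_mean2 c1 c2 l N)].
set A := [set w | _ /\ _].
have mA' : measurable A'.
  have := measurable_walk_box (- (s ^+ 2 * walk_mean1 c1 c2 l N)) (- (s ^+ 2 * walk_mean2 c1 c2 l N)) (e' * N%:R) N.
  congr measurable; apply/seteqP; split=> w [/=]; rewrite ?opprK => h1 h2; split=> /=; rewrite ?subr0 ?opprK; move: h1 h2; rewrite ?subr0//.
pose A0 := [set w | box (walk N w)].
have mA0 : measurable A0 by exact: measurable_walk_box.
have tilt : (\int[P]_w (F (walk N w) * (expR (l.1 * (walk N w).1 + l.2 * (walk N w).2))%:E)
    = (expR X0)%:E * P A')%E.
  rewrite (integral_walk_tilt c1 c2 y0 s0 indep lawX l N mF F0) -/X0; congr (_ * _)%E.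
  transitivity (\int[P]_w (\1_A' w)%:E)%E; first exact: eq_integral.
  by rewrite integral_indic// setIT.
have low : ((expR (- (L * (e' * N%:R))))%:E * P A0 <=
    \int[P]_w (F (walk N w) * (expR (l.1 * (walk N w).1 + l.2 * (walk N w).2))%:E))%E.
  have mi : measurable_fun setT (fun w => (\1_A0 w)%:E : \bar R).
    by apply/measurable_EFinP; exact: measurable_indic.
  have i0 w : setT w -> (0 <= (\1_A0 w)%:E :> \bar R)%E by rewrite lee_fin.
  have ec0 : (0 <= (expR (- (L * (e' * N%:R))))%:E)%E by rewrite lee_fin expR_ge0.
  rewrite -(setIT A0) -integral_indic// -ge0_integralZl//.
  apply: ge0_le_integral => //.
  - exact: measurable_funeM.
  - apply: emeasurable_funM; first exact: (measurableT_comp mF (measurable_walk X c1 c2 y0 N)).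
    apply/measurable_EFinP; apply: measurableT_comp => //.
    by apply: measurable_funD; apply: measurable_funM.
  move=> w _; rewrite /F -!EFinM lee_fin.
  rewrite -[\1_A0 w]/(\1_box (walk N w)) indicE.
  have [wA|wA] := boolP (_ \in _); last by rewrite mulr0 mul0r.
  rewrite mulr1 mul1r ler_expR lerNl.
  move: wA; rewrite inE => -[]; rewrite !subr0 => h1 h2.
  have lu (u : R) : `|u| <= B -> `|- 2 * u / s ^+ 2| <= L / 2.
    move=> uB; rewrite !normrM normrN normfV (ger0_norm (ltW s2)) (ger0_norm (ler0n _ 2)).
    have -> : L / 2 = 2 * B / s ^+ 2 by rewrite /L; field; exact: s0.
    by rewrite ler_pM2r ?invr_gt0// ler_pM2l.
  have aux (x y : R) : `|x| <= L / 2 -> `|y| <= e' * N%:R -> - (x * y) <= L / 2 * (e' * N%:R).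
    by move=> xL yN; rewrite (le_trans (ler_norm _))// normrN normrM ler_pM.
  have g1 := aux _ _ (lu _ u1B) h1; have g2 := aux _ _ (lu _ u2B) h2.
  rewrite /l /=; lra.
have SN := cdiff N; rewrite -/(S N) in SN.
have TN := cprod N; rewrite -/(T N) in TN.
have A'A : A' `<=` A.
  move=> w [/= h1 h2]; rewrite /A /=.
  have m1 : s ^+ 2 * walk_mean1 c1 c2 l N = - (N%:R * u1) - (u1 * S N + u2 * T N).
    by rewrite walk_mean1E /l /=; field; exact: s0.
  have m2 : s ^+ 2 * walk_mean2 c1 c2 l N = - (N%:R * u2) - (u1 * T N - u2 * S N).
    by rewrite walk_mean2E /l /=; field; exact: s0.
  have aux (x y : R) : `|x| <= B -> `|y| <= C -> `|x * y| <= B * C.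
    by move=> xB yC; rewrite normrM ler_pM.
  have b1 : `|u1 * S N + u2 * T N| <= 2 * B * C.
    by rewrite (le_trans (ler_normD _ _))// (le_trans (lerD (aux _ _ u1B SN) (aux _ _ u2B TN)))//; lra.
  have b2 : `|u1 * T N - u2 * S N| <= 2 * B * C.
    by rewrite (le_trans (ler_normB _ _))// (le_trans (lerD (aux _ _ u1B TN) (aux _ _ u2B SN)))//; lra.
  have e'N : e' * N%:R <= eps / 2 * N%:R by rewrite ler_pM2r.
  have fin (x m v D : R) : `|x + m - 0| <= e' * N%:R -> m = - (N%:R * v) - D -> `|D| <= 2 * B * C ->
      `|x - N%:R * v| <= eps * N%:R.
    move=> xm mE DB.
    have -> : x - N%:R * v = (x + m - 0) + D by rewrite mE; ring.
    by rewrite (le_trans (ler_normD _ _))//; lra.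
  by split; [exact: fin h1 m1 b1|exact: fin h2 m2 b2].
have X0b : X0 <= N%:R * ((u1 ^+ 2 + u2 ^+ 2) / s ^+ 2) + K1.
  have lu (u y : R) : `|u| <= B -> - 2 * u / s ^+ 2 * y <= L * `|y|.
    move=> uB; rewrite (le_trans (ler_norm _))// normrM ler_wpM2r//.
    rewrite /L !normrM normrN normfV (ger0_norm (ltW s2)) (ger0_norm (ler0n _ 2)).
    by rewrite ler_pM2r ?invr_gt0//; lra.
  have g1 := lu _ y0.1 u1B; have g2 := lu _ y0.2 u2B.
  have qb := quad_bound N u1 u2.
  have uB (u : R) : `|u| <= B -> u ^+ 2 <= B ^+ 2.
    by move=> h; rewrite -(real_normK (num_real u)) ler_sqr ?nnegrE// ltW.
  have qC : C * (u1 ^+ 2 + u2 ^+ 2) <= C * (2 * B ^+ 2).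
    by rewrite ler_wpM2l//; have := uB _ u1B; have := uB _ u2B; lra.
  have vE : s ^+ 2 * walk_var c1 c2 l N / 2 = N%:R * ((u1 ^+ 2 + u2 ^+ 2) / s ^+ 2) +
      2 * ((u1 ^+ 2 - u2 ^+ 2) * S N / 2 + u1 * u2 * T N) / s ^+ 2.
    by rewrite walk_varE /l /=; field; exact: s0.
  have vB : 2 * ((u1 ^+ 2 - u2 ^+ 2) * S N / 2 + u1 * u2 * T N) / s ^+ 2 <= 4 * B ^+ 2 * C / s ^+ 2.
    by rewrite ler_pM2r ?invr_gt0//; lra.
  rewrite /X0 vE /K1 /l /=; lra.
have mA : measurable A by exact: measurable_walk_box.
apply: (@le_trans _ _ (P A')); last by apply: le_measure; rewrite ?inE.
move: low conc; rewrite tilt -[X in (_ <= P X)%E -> _]/A0.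
have /fineK <- : P A' \is a fin_num by exact: fin_num_measure.
have /fineK <- : P A0 \is a fin_num by exact: fin_num_measure.
move: (fine (P A')) (fine (P A0)) => p p0; rewrite -!EFinM !lee_fin => low conc.
have e1 : expR (- (L * (e' * N%:R))) / 2 <= expR X0 * p.
  by rewrite (le_trans _ low)// ler_pM2l ?expR_gt0.
rewrite -(ler_pM2l (expR_gt0 X0)) (le_trans _ e1)//.
rewrite mulrCA -expRD mulrC ler_pM2r ?invr_gt0// ler_expR.
have : L * e' * N%:R <= del / 2 * N%:R by rewrite ler_pM2r.
move: X0b hN2; rewrite mulrDr; lra.
Unshelve. all: by end_near.
Qed.

End WalkBounds.

(** * One Fourier mode *)

Section EllipticAlgebra.
Context {R : realType}.
Variables (A : 'M[R]_2) (B : 'cV[R]_2).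
Notation a11 := (A 0 0).
Notation a12 := (A 0 1).
Notation a21 := (A 1 0).
Notation a22 := (A 1 1).
Notation b1 := (B 0 0).
Notation b2 := (B 1 0).

(* The determinant of the pair (v, A v), for v = (p, q): up to a factor, the
   quadratic form invariant under A when det A = 1. *)
Definition pair_det (p q : R) : R := a21 * p ^+ 2 + (a22 - a11) * p * q - a12 * q ^+ 2.

Lemma ord2_lift (i : 'I_1) : lift 0 i = 1 :> 'I_2.
Proof. by apply/val_inj; rewrite (ord1 i). Qed.

Lemma det2 : \det A = a11 * a22 - a12 * a21.
Proof.
rewrite (expand_det_row _ 0) big_ord_recl big_ord1 /cofactor !det_mx11 !mxE /=.
rewrite !ord2_lift.
have -> : lift (1 : 'I_2) (0 : 'I_1) = 0 by apply/val_inj.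
rewrite -[ord0]/(0 : 'I_2) -[bump 0 0]/1%N !add0n expr0 expr1; ring.
Qed.

Lemma trace2 : \tr A = a11 + a22.
Proof. by rewrite /mxtrace big_ord_recl big_ord1 ord2_lift. Qed.

Lemma mulmx2 (v : 'cV[R]_2) i : (A *m v) i 0 = A i 0 * v 0 0 + A i 1 * v 1 0.
Proof. by rewrite mxE big_ord_recl big_ord1 ord2_lift. Qed.

Hypothesis det1 : \det A = 1.
Hypothesis elliptic : 0 < 4 * \det A - \tr A ^+ 2.

Let dt : a11 * a22 - a12 * a21 = 1. Proof. by rewrite -det2. Qed.
Let el : (a11 + a22) ^+ 2 < 4.
Proof. by move: elliptic; rewrite det1 trace2 mulr1 subr_gt0. Qed.

Lemma pair_det_eq0 p q : pair_det p q = 0 -> p = 0 /\ q = 0.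
Proof.
move=> h.
have a21n0 : a21 != 0.
  apply/eqP => a0; move: dt el; rewrite a0 mulr0 subr0 => d1 d2.
  have := sqr_ge0 (a11 - a22); lra.
have sq : (2 * a21 * p + (a22 - a11) * q) ^+ 2 + (4 - (a11 + a22) ^+ 2) * q ^+ 2 = 0.
  transitivity (4 * a21 * pair_det p q); last by rewrite h mulr0.
  rewrite /pair_det; have e : a12 * a21 = a11 * a22 - 1 by rewrite -dt; ring.
  have := congr1 (fun z => z * q ^+ 2) e => /= e2; lra.
have q0 : q = 0.
  apply/eqP; rewrite -sqrf_eq0; apply/eqP.
  have h1 := sqr_ge0 (2 * a21 * p + (a22 - a11) * q).
  have h2 := sqr_ge0 q.
  have h3 : 0 < 4 - (a11 + a22) ^+ 2 by rewrite subr_gt0.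
  by apply/eqP; rewrite eq_le h2 andbT -(pmulr_rle0 _ h3); lra.
split=> //; move: sq; rewrite q0 expr0n /= !mulr0 !addr0 => /eqP.
by rewrite sqrf_eq0 !mulf_eq0 (negbTE a21n0) pnatr_eq0 /= => /eqP.
Qed.

Hypothesis Bn0 : b1 ^+ 2 + b2 ^+ 2 != 0.

Definition gram : R := pair_det b1 b2.

Lemma gram_neq0 : gram != 0.
Proof.
apply/eqP => /pair_det_eq0[h1 h2]; move: Bn0.
by rewrite h1 h2 expr0n addr0 eqxx.
Qed.

End EllipticAlgebra.

Section CoefIdentities.
Context {R : realType}.
Variables (A : R -> 'M[R]_2) (B : R -> 'cV[R]_2) (h : R).
Hypothesis det1 : \det (A h) = 1.

Let dt : A h 0 0 * A h 1 1 - A h 0 1 * A h 1 0 = 1. Proof. by rewrite -det2. Qed.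

Lemma coef_aE : coef_a A B h = - A h 0 1 * gram (A h) (B h).
Proof.
rewrite /coef_a /gram /pair_det trace2 /=.
have := congr1 (fun z => z * B h 0 0 ^+ 2) dt => /= e; lra.
Qed.

Lemma coef_bE : coef_b A B h = A h 1 0 * gram (A h) (B h).
Proof.
rewrite /coef_b /gram /pair_det trace2 /=.
have := congr1 (fun z => z * B h 1 0 ^+ 2) dt => /= e; lra.
Qed.

Lemma coef_cE : coef_c A B h = (A h 1 1 - A h 0 0) * gram (A h) (B h) / 2.
Proof.
rewrite /coef_c /gram /pair_det trace2 /=.
have := congr1 (fun z => z * B h 0 0 * B h 1 0) dt => /= e; lra.
Qed.

Lemma coef_discE : coef_a A B h * coef_b A B h - coef_c A B h ^+ 2 =
  gram (A h) (B h) ^+ 2 * (4 - \tr (A h) ^+ 2) / 4.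
Proof.
rewrite coef_aE coef_bE coef_cE trace2; move: (gram _ _) => k.
have := congr1 (fun z => z * k ^+ 2) dt => /= e; lra.
Qed.

Lemma rate_summandE (tau al p q : R) : 0 < 4 - \tr (A h) ^+ 2 ->
  gram (A h) (B h) != 0 ->
  tau * (4 - \tr (A h) ^+ 2) /
    (4 * (coef_a A B h * coef_b A B h - coef_c A B h ^+ 2) * al ^+ 2) *
  (coef_b A B h * p ^+ 2 + coef_a A B h * q ^+ 2 + 2 * coef_c A B h * p * q) =
  tau * (pair_det (A h) p q / gram (A h) (B h)) / al ^+ 2.
Proof.
move=> t4 k0; rewrite coef_discE coef_aE coef_bE coef_cE.
have -> : A h 1 0 * gram (A h) (B h) * p ^+ 2 + - A h 0 1 * gram (A h) (B h) * q ^+ 2 +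
   2 * ((A h 1 1 - A h 0 0) * gram (A h) (B h) / 2) * p * q = gram (A h) (B h) * pair_det (A h) p q.
  rewrite /pair_det; lra.
move: (4 - _) t4 (gram _ _) k0 (pair_det _ _ _) => t t0 k k0 e.
have [->|al0] := eqVneq al 0; first by rewrite expr0n /= invr0 !mulr0 invr0 mulr0 mul0r.
by field; rewrite k0 al0 gt_eqF.
Qed.

End CoefIdentities.

Lemma mutually_independent_sub d (Omega : measurableType d) (R : realType)
    (P : probability Omega R) (I : choiceType) (F G : I -> set (set Omega)) :
  (forall i, F i `<=` G i) -> mutually_independent P G -> mutually_independent P F.
Proof. by move=> FG hG J E uJ hE; apply: hG => // i iJ; exact/FG/hE. Qed.

Section Mode.
Context d (Omega : measurableType d) (R : realType) (P : probability Omega R).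
Variables (W : R -> {RV P >-> R}) (tau al : R) (A : 'M[R]_2) (B : 'cV[R]_2).
Variables (z0 : 'cV[R]_2) (v : nat -> Omega -> 'cV[R]_2).
Hypothesis W_BM : brownian_motion W.
Hypothesis tau_gt0 : 0 < tau.
Hypothesis al_gt0 : 0 < al.
Hypothesis det1 : \det A = 1.
Hypothesis elliptic : 0 < 4 * \det A - \tr A ^+ 2.
Hypothesis Bn0 : B 0 0 ^+ 2 + B 1 0 ^+ 2 != 0.
Hypothesis v_0 : forall w, v 0%N w = z0.
Hypothesis v_S : forall n w,
  v n.+1 w = A *m v n w + (al * (W (n.+1%:R * tau) w - W (n%:R * tau) w)) *: B.

Let incr (n : nat) (w : Omega) : R := W (n.+1%:R * tau) w - W (n%:R * tau) w.

Let mincr n : measurable_fun setT (incr n).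
Proof. by apply: measurable_funB; exact: measurable_funP. Qed.

Let X (n : nat) : {RV P >-> R} := mfun_Sub (mem_set (mincr n)).

Let s : R := Num.sqrt tau.
Let s0 : s != 0. Proof. by rewrite gt_eqF// sqrtr_gt0. Qed.
Let s2 : s ^+ 2 = tau. Proof. by rewrite sqr_sqrtr// ltW. Qed.

Let lawX n C : measurable C -> P (X n @^-1` C) = normal_prob 0 s C.
Proof.
move=> mC; have [_ _ + _] := W_BM.
have n0 : 0 <= n%:R * tau by rewrite mulr_ge0// ltW.
have nn : n%:R * tau < n.+1%:R * tau by rewrite ltr_pM2r// ltr_nat.
have e : n.+1%:R * tau - n%:R * tau = tau.
  by rewrite -mulrBl -natr1 addrAC subrr add0r mul1r.
by move=> /(_ _ _ n0 nn _ mC); rewrite e.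
Qed.

Let indepX : mutually_independent P (fun n => sigma_rv (X n)).
Proof.
have [_ + _ _] := W_BM => /(_ (fun n => n%:R * tau)); apply.
  by rewrite mul0r.
by move=> i; rewrite ler_pM2r// ler_nat.
Qed.

Let c : R := \tr A / 2.
Let theta : R := acos c.

Let c1 : -1 < c < 1.
Proof.
move: elliptic; rewrite det1 mulr1 subr_gt0 => h.
have : c ^+ 2 < 1 by rewrite /c expr_div_n ltr_pdivrMr ?exprn_gt0//; lra.
have [c0|c0] := leP 0 c => h2.
  have : c < 1 by rewrite -ltr_sqr ?nnegrE// expr1n.
  by lra.
have : - c < 1 by rewrite -ltr_sqr ?nnegrE ?sqrrN ?expr1n//; lra.
by lra.
Qed.

Let cosE : cos theta = c.
Proof. by case/andP: c1 => h1 h2; rewrite /theta acosK// in_itv/= !ltW. Qed.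

Let sinE : sin theta ^+ 2 = 1 - c ^+ 2.
Proof. by rewrite -cosE; have := cos2Dsin2 theta; lra. Qed.

Let sinn0 : sin theta != 0.
Proof.
rewrite -sqrf_eq0 sinE subr_eq0 eq_sym; apply/eqP => h.
have := c1 => /andP[h1 h2]; nra.
Qed.

Let D i : R := ((A *m B) i 0 - c * B i 0) / sin theta.

Let AB i : A i 0 * B 0 0 + A i 1 * B 1 0 = c * B i 0 + sin theta * D i.
Proof. by rewrite -mulmx2 /D (mulrC (sin theta)) divfK//; ring. Qed.

Let AD i : A i 0 * D 0 + A i 1 * D 1 = - sin theta * B i 0 + c * D i.
Proof.
apply: (mulfI sinn0).
have e0 : sin theta * D 0 = A 0 0 * B 0 0 + A 0 1 * B 1 0 - c * B 0 0 by rewrite AB; ring.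
have e1 : sin theta * D 1 = A 1 0 * B 0 0 + A 1 1 * B 1 0 - c * B 1 0 by rewrite AB; ring.
have ei : sin theta * D i = A i 0 * B 0 0 + A i 1 * B 1 0 - c * B i 0 by rewrite AB; ring.
have -> : sin theta * (A i 0 * D 0 + A i 1 * D 1) = A i 0 * (sin theta * D 0) + A i 1 * (sin theta * D 1) by ring.
have -> : sin theta * (- sin theta * B i 0 + c * D i) = - sin theta ^+ 2 * B i 0 + c * (sin theta * D i) by ring.
rewrite e0 e1 ei sinE /c trace2.
have dt : A 0 0 * A 1 1 - A 0 1 * A 1 0 = 1 by rewrite -det2.
have [->|->] : i = 0 \/ i = 1.
  by case: i {ei} => -[|[|//]] ?; [left|right]; apply/val_inj.
- have := congr1 (fun z => z * B 0 0) dt => /= e; lra.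
- have := congr1 (fun z => z * B 1 0) dt => /= e; lra.
Qed.

Let wedge : R := B 0 0 * D 1 - B 1 0 * D 0.

Let pair_detE x y :
  pair_det A (x * B 0 0 + y * D 0) (x * B 1 0 + y * D 1) = (x ^+ 2 + y ^+ 2) * (sin theta * wedge).
Proof.
set p := x * B 0 0 + y * D 0; set q := x * B 1 0 + y * D 1.
have e0 : A 0 0 * p + A 0 1 * q = x * (c * B 0 0 + sin theta * D 0) + y * (- sin theta * B 0 0 + c * D 0).
  by rewrite -AB -AD /p /q; ring.
have e1 : A 1 0 * p + A 1 1 * q = x * (c * B 1 0 + sin theta * D 1) + y * (- sin theta * B 1 0 + c * D 1).
  by rewrite -AB -AD /p /q; ring.
transitivity (p * (A 1 0 * p + A 1 1 * q) - q * (A 0 0 * p + A 0 1 * q)).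
  by rewrite /pair_det; ring.
by rewrite e0 e1 /p /q /wedge; ring.
Qed.

Let gramE : gram A B = sin theta * wedge.
Proof.
have := pair_detE 1 0; rewrite !mul1r !mul0r !addr0 expr1n expr0n /= addr0 mul1r => <- //.
Qed.

Let gram0 : gram A B != 0. Proof. exact: gram_neq0. Qed.

Let wedge0 : wedge != 0.
Proof. by move: gram0; rewrite gramE mulf_eq0 negb_or => /andP[]. Qed.

Definition mode_rate (p q : R) : R := tau * (pair_det A p q / gram A B) / al ^+ 2.

Let mode_rateE x y :
  mode_rate (x * B 0 0 + y * D 0) (x * B 1 0 + y * D 1) = tau * (x ^+ 2 + y ^+ 2) / al ^+ 2.
Proof. by rewrite /mode_rate pair_detE -gramE mulfK. Qed.

Let coordP p q : exists x y : R, p = x * B 0 0 + y * D 0 /\ q = x * B 1 0 + y * D 1.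
Proof.
exists ((p * D 1 - q * D 0) / wedge), ((B 0 0 * q - B 1 0 * p) / wedge).
by split; rewrite /wedge; field; exact: wedge0.
Qed.

Lemma mode_rate_coercive : exists2 e : R, 0 < e &
  forall p q, e * (p ^+ 2 + q ^+ 2) <= mode_rate p q.
Proof.
pose S := B 0 0 ^+ 2 + B 1 0 ^+ 2 + D 0 ^+ 2 + D 1 ^+ 2.
have S0 : 0 < S.
  have b0 : 0 < B 0 0 ^+ 2 + B 1 0 ^+ 2 by rewrite lt0r Bn0 addr_ge0 ?sqr_ge0.
  by rewrite /S -addrA ltr_pwDl// addr_ge0 ?sqr_ge0.
have e0 : 0 < tau / al ^+ 2 / (2 * S).
  by apply: divr_gt0; [apply: divr_gt0 => //; exact: exprn_gt0|exact: mulr_gt0].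
exists (tau / al ^+ 2 / (2 * S)) => //.
move=> p q; have [x [y [-> ->]]] := coordP p q; rewrite mode_rateE.
have -> : tau * (x ^+ 2 + y ^+ 2) / al ^+ 2 = tau / al ^+ 2 / (2 * S) * (2 * S * (x ^+ 2 + y ^+ 2)).
  by field; rewrite !gt_eqF.
apply: ler_wpM2l; first exact: ltW.
have cs (b e : R) : (x * b + y * e) ^+ 2 <= (b ^+ 2 + e ^+ 2) * (x ^+ 2 + y ^+ 2).
  by have := sqr_ge0 (x * e - y * b); lra.
have := cs (B 0 0) (D 0); have := cs (B 1 0) (D 1); rewrite /S.
have := mulr_ge0 (ltW S0) (addr_ge0 (sqr_ge0 x) (sqr_ge0 y)); rewrite /S; lra.
Qed.

Lemma measurable_state d' (T : measurableType d') (e : T -> Omega) :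
  (forall t, 0 <= t -> measurable_fun setT (W t \o e)) ->
  forall n i, measurable_fun setT (fun x => v n (e x) i 0).
Proof.
move=> mW; elim=> [|n ih] i.
  rewrite (_ : (fun x => _) = cst (z0 i 0)); last by apply/funext => x; rewrite v_0.
  exact: measurable_cst.
rewrite (_ : (fun x => _) = (fun x => A i 0 * v n (e x) 0 0 + A i 1 * v n (e x) 1 0 +
    al * ((W (n.+1%:R * tau) \o e) x - (W (n%:R * tau) \o e) x) * B i 0)); last first.
  by apply/funext => x; rewrite v_S mxE mulmx2 !mxE.
have nt m : 0 <= m%:R * tau by rewrite mulr_ge0// ltW.
apply: measurable_funD; first by apply: measurable_funD; exact: measurable_funM.
apply: measurable_funM => //; apply: measurable_funM => //.
by apply: measurable_funB; exact: mW.
Qed.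

Lemma measurable_state_box d' (T : measurableType d') (e : T -> Omega) (p q eps : R) n :
  (forall t, 0 <= t -> measurable_fun setT (W t \o e)) ->
  measurable [set x | `|v n (e x) 0 0 / (n%:R * tau) - p| <= eps /\
                      `|v n (e x) 1 0 / (n%:R * tau) - q| <= eps].
Proof.
move=> mW.
have h (f : T -> R) u : measurable_fun setT f -> measurable [set x | `|f x - u| <= eps].
  move=> mf; rewrite (_ : [set x | _] = (fun x => `|f x - u|) @^-1` `]-oo, eps]%classic).
    have mg : measurable_fun setT (fun x => `|f x - u|).
      by apply: measurableT_comp => //; exact: measurable_funB.
    by rewrite -[X in measurable X]setTI; apply: mg => //; exact: measurable_itv.
  by apply/seteqP; split => x /=; rewrite in_itv.
apply: measurableI; apply: h; apply: measurable_funM => //; exact: measurable_state.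
Qed.

Let mW_id t : 0 <= t -> measurable_fun setT (W t \o id).
Proof. by move=> _; exact: measurable_funP. Qed.

(* On the space endowed with the sigma-algebra of the process W. *)
Let Ts : measurableType _ :=
  g_sigma_algebraType (\bigcup_(t in [set t | 0 <= t]) sigma_rv (W t)).

Let mW_sigma t : 0 <= t -> measurable_fun setT (W t \o (id : Ts -> Omega)).
Proof.
move=> t0 _ C mC; apply: sub_sigma_algebra; exists t => //.
by exists C.
Qed.

Lemma sigma_state_box (p q eps : R) n : sigma_process (fun t w => W t w)
  [set w | `|v n w 0 0 / (n%:R * tau) - p| <= eps /\
           `|v n w 1 0 / (n%:R * tau) - q| <= eps].
Proof. exact: (measurable_state_box p q eps n mW_sigma). Qed.

Lemma sigma_state_rate (a : R) n : sigma_rv (fun w =>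
    a * mode_rate (v n w 0 0 / (n%:R * tau)) (v n w 1 0 / (n%:R * tau)))
  `<=` sigma_process (fun t w => W t w).
Proof.
have mv i : measurable_fun setT (fun w : Ts => v n w i 0 / (n%:R * tau)).
  by apply: measurable_funM => //; exact: measurable_state.
have mf : measurable_fun setT (fun w : Ts =>
    a * mode_rate (v n w 0 0 / (n%:R * tau)) (v n w 1 0 / (n%:R * tau))).
  apply: measurable_funM => //; apply: measurable_funM => //; apply: measurable_funM => //.
  apply: measurable_funM => //; apply: measurable_funB; first apply: measurable_funD.
  - by apply: measurable_funM => //; exact: measurable_funX.
  - by apply: measurable_funM => //; exact: measurable_funM.
  - by apply: measurable_funM => //; exact: measurable_funX.
by move=> _ [C mC <-]; exact: mf.
Qed.

Lemma measurable_state_rate (a : R) n : measurable_fun setT (fun w =>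
    a * mode_rate (v n w 0 0 / (n%:R * tau)) (v n w 1 0 / (n%:R * tau))).
Proof.
have mv i : measurable_fun setT (fun w => v n w i 0 / (n%:R * tau)).
  by apply: measurable_funM => //; exact: (measurable_state mW_id).
apply: measurable_funM => //; apply: measurable_funM => //; apply: measurable_funM => //.
apply: measurable_funM => //; apply: measurable_funB; first apply: measurable_funD.
- by apply: measurable_funM => //; exact: measurable_funX.
- by apply: measurable_funM => //; exact: measurable_funM.
- by apply: measurable_funM => //; exact: measurable_funX.
Qed.

Let Y (y0 : R * R) := walk X (rot1 theta) (rot2 theta) y0.

Let stateE (y0 : R * R) :
  (forall i, z0 i 0 = al * (y0.1 * B i 0 + y0.2 * D i)) ->
  forall n w i, v n w i 0 =
    al * ((cos (n%:R * theta) * (Y y0 n w).1 - sin (n%:R * theta) * (Y y0 n w).2) * B i 0 +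
          (sin (n%:R * theta) * (Y y0 n w).1 + cos (n%:R * theta) * (Y y0 n w).2) * D i).
Proof.
move=> hz; elim=> [|n ih] w i.
  by rewrite v_0 hz mul0r cos0 sin0 !mul1r !mul0r subr0 add0r.
rewrite v_S mxE mulmx2 !mxE !ih.
set y1 := (Y y0 n w).1; set y2 := (Y y0 n w).2.
have -> : (Y y0 n.+1 w).1 = y1 + rot1 theta n * incr n w by [].
have -> : (Y y0 n.+1 w).2 = y2 + rot2 theta n * incr n w by [].
rewrite -/(incr n w); set x := incr n w.
rewrite /rot1 /rot2.
have cS : cos (n.+1%:R * theta) = cos (n%:R * theta) * c - sin (n%:R * theta) * sin theta.
  by rewrite -natr1 mulrDl mul1r cosD cosE.
have sS : sin (n.+1%:R * theta) = sin (n%:R * theta) * c + cos (n%:R * theta) * sin theta.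
  by rewrite -natr1 mulrDl mul1r sinD cosE.
set c' := cos (n.+1%:R * theta) in cS *; set s' := sin (n.+1%:R * theta) in sS *.
have u1 : c' ^+ 2 + s' ^+ 2 = 1 by rewrite cos2Dsin2.
set u := cos (n%:R * theta) * y1 - sin (n%:R * theta) * y2.
set t := sin (n%:R * theta) * y1 + cos (n%:R * theta) * y2.
have -> : (c' * (y1 + c' * x) - s' * (y2 + - s' * x)) = c * u - sin theta * t + x.
  transitivity (c' * y1 - s' * y2 + (c' ^+ 2 + s' ^+ 2) * x); first by ring.
  by rewrite u1 mul1r cS sS /u /t; ring.
have -> : (s' * (y1 + c' * x) + c' * (y2 + - s' * x)) = sin theta * u + c * t.
  by rewrite /u /t; transitivity (s' * y1 + c' * y2); rewrite ?cS ?sS; ring.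
have -> : A i 0 * (al * (u * B 0 0 + t * D 0)) + A i 1 * (al * (u * B 1 0 + t * D 1)) =
   al * (u * (A i 0 * B 0 0 + A i 1 * B 1 0) + t * (A i 0 * D 0 + A i 1 * D 1)) by ring.
by rewrite AB AD; ring.
Qed.

Let exists_start : exists y0 : R * R, forall i, z0 i 0 = al * (y0.1 * B i 0 + y0.2 * D i).
Proof.
have [x [y [h0 h1]]] := coordP (z0 0 0 / al) (z0 1 0 / al).
exists (x, y) => i /=.
have [->|->] : i = 0 \/ i = 1.
  by case: i => -[|[|//]] ?; [left|right]; apply/val_inj.
- by rewrite -h0 mulrC divfK// gt_eqF.
- by rewrite -h1 mulrC divfK// gt_eqF.
Qed.

Lemma mode_upper (rho : R) : 1 < rho -> exists K : R, 0 < K /\ \forall N \near \oo,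
  (\int[P]_w (expR (N%:R * mode_rate (v N w 0 0 / (N%:R * tau)) (v N w 1 0 / (N%:R * tau)) / rho))%:E
   <= K%:E)%E.
Proof.
move=> rho1; have [y0 hy0] := exists_start.
have [K [K0 hK]] := walk_upper y0 s0 indepX lawX (rot_sqr theta)
  (rot_sum_diff sinn0) (rot_sum_prod sinn0) rho1.
exists K; split; first exact: K0.
near=> N.
have N0 : 0 < N%:R :> R by rewrite ltr0n; near: N; exists 1%N.
have rho0 : 0 < rho by rewrite (lt_trans _ rho1).
have : (\int[P]_w (expR (((Y y0 N w).1 ^+ 2 + (Y y0 N w).2 ^+ 2) / (rho * N%:R * s ^+ 2)))%:E
   <= K%:E)%E by near: N; exact: hK.
apply: le_trans; rewrite le_eqVlt; apply/orP; left; apply/eqP.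
apply: eq_integral => w _; congr (expR _)%:E.
rewrite !(stateE hy0) s2.
set y1 := (Y y0 N w).1; set y2 := (Y y0 N w).2.
set u := _ - sin _ * y2; set t := _ + cos _ * y2.
have -> : al * (u * B 0 0 + t * D 0) / (N%:R * tau) =
    (al / (N%:R * tau) * u) * B 0 0 + (al / (N%:R * tau) * t) * D 0 by ring.
have -> : al * (u * B 1 0 + t * D 1) / (N%:R * tau) =
    (al / (N%:R * tau) * u) * B 1 0 + (al / (N%:R * tau) * t) * D 1 by ring.
rewrite mode_rateE.
have -> : y1 ^+ 2 + y2 ^+ 2 = u ^+ 2 + t ^+ 2.
  have u1 : cos (N%:R * theta) ^+ 2 + sin (N%:R * theta) ^+ 2 = 1 by exact: cos2Dsin2.
  transitivity ((cos (N%:R * theta) ^+ 2 + sin (N%:R * theta) ^+ 2) * (y1 ^+ 2 + y2 ^+ 2)).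
    by rewrite u1 mul1r.
  by rewrite /u /t; ring.
clearbody u t; field.
by rewrite (lt0r_neq0 N0) (lt0r_neq0 rho0) (lt0r_neq0 tau_gt0) (lt0r_neq0 al_gt0).
Unshelve. all: by end_near.
Qed.

Lemma mode_lower (p q eps del : R) : 0 < eps -> 0 < del -> \forall N \near \oo,
  ((2^-1 * expR (- (N%:R * (mode_rate p q + del))))%:E <=
   P [set w | (`|v N w 0 0 / (N%:R * tau) - p| <= eps)%R /\
              (`|v N w 1 0 / (N%:R * tau) - q| <= eps)%R])%E.
Proof.
move=> eps0 del0; have [y0 hy0] := exists_start.
have [a [b [pE qE]]] := coordP p q.
pose K := 1 + `|B 0 0| + `|D 0| + `|B 1 0| + `|D 1|.
have K1 : 0 < K by rewrite /K -!addrA ltr_pwDl// !addr_ge0.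
pose e' := eps * tau / (al * 2 * K).
have q0 : 0 < al * 2 * K by rewrite mulr_gt0// mulr_gt0.
have e'0 : 0 < e' by rewrite divr_gt0// mulr_gt0.
pose Bd := tau / al * (`|a| + `|b| + 1).
have ta0 : 0 < tau / al by rewrite divr_gt0.
have Bd0 : 0 < Bd by rewrite mulr_gt0// ltr_wpDl// addr_ge0.
have low := walk_lower y0 s0 indepX lawX (rot_sqr theta)
  (rot_sum_diff sinn0) (rot_sum_prod sinn0) Bd0 e'0 del0.
near=> N.
have N0 : 0 < N%:R :> R by rewrite ltr0n; near: N; exists 1%N.
pose cN := cos (N%:R * theta); pose sN := sin (N%:R * theta).
have cs1 : cN ^+ 2 + sN ^+ 2 = 1 by exact: cos2Dsin2.
have cN1 : `|cN| <= 1 by rewrite ler_norml cos_geN1 cos_le1.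
have sN1 : `|sN| <= 1 by rewrite ler_norml sin_geN1 sin_le1.
pose u1 := tau / al * (cN * a + sN * b).
pose u2 := tau / al * (cN * b - sN * a).
have ub (x y : R) : `|x| <= 1 -> `|y| <= 1 -> `|tau / al * (x * a + y * b)| <= Bd.
  move=> x1 y1; rewrite normrM (ger0_norm (ltW ta0)) ler_pM2l// (le_trans (ler_normD _ _))//.
  rewrite !normrM -[leRHS]addrA lerD//; first by rewrite ler_piMl.
  by rewrite (le_trans (ler_piMl (normr_ge0 b) y1))// lerDl.
have u1B : `|u1| <= Bd by exact: ub.
have u2B : `|u2| <= Bd.
  rewrite /u2 (_ : cN * b - sN * a = - sN * a + cN * b); last by ring.
  by apply: ub; rewrite ?normrN.
have lowN : ((2^-1 * expR (- (N%:R * ((u1 ^+ 2 + u2 ^+ 2) / s ^+ 2 + del))))%:E <=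
   P [set w | (`|(Y y0 N w).1 - N%:R * u1| <= e' * N%:R)%R /\
              (`|(Y y0 N w).2 - N%:R * u2| <= e' * N%:R)%R])%E.
  by move: u1 u2 u1B u2B {cs1 cN1 sN1}; near: N; exact: low.
have -> : mode_rate p q = (u1 ^+ 2 + u2 ^+ 2) / s ^+ 2.
  rewrite pE qE mode_rateE s2.
  have -> : a ^+ 2 + b ^+ 2 = (cN * a + sN * b) ^+ 2 + (cN * b - sN * a) ^+ 2.
    by transitivity ((cN ^+ 2 + sN ^+ 2) * (a ^+ 2 + b ^+ 2)); [rewrite cs1 mul1r|ring].
  rewrite /u1 /u2; field.
  by rewrite (lt0r_neq0 tau_gt0) (lt0r_neq0 al_gt0).
apply: (le_trans lowN); apply: le_measure; rewrite ?inE.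
- exact: measurable_walk_box.
- exact: (measurable_state_box p q eps N mW_id).
move=> w [/= h1 h2].
have key i : `|v N w i 0 / (N%:R * tau) - (a * B i 0 + b * D i)| <= eps / K * (`|B i 0| + `|D i|).
  rewrite (stateE hy0).
  have aE : a = al / tau * (cN * u1 - sN * u2).
    transitivity ((cN ^+ 2 + sN ^+ 2) * a); first by rewrite cs1 mul1r.
    by rewrite /u1 /u2; field; rewrite (lt0r_neq0 tau_gt0) (lt0r_neq0 al_gt0).
  have bE : b = al / tau * (sN * u1 + cN * u2).
    transitivity ((cN ^+ 2 + sN ^+ 2) * b); first by rewrite cs1 mul1r.
    by rewrite /u1 /u2; field; rewrite (lt0r_neq0 tau_gt0) (lt0r_neq0 al_gt0).
  pose d1 := (Y y0 N w).1 - N%:R * u1; pose d2 := (Y y0 N w).2 - N%:R * u2.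
  have -> : al * ((cos (N%:R * theta) * (Y y0 N w).1 - sin (N%:R * theta) * (Y y0 N w).2) * B i 0 +
     (sin (N%:R * theta) * (Y y0 N w).1 + cos (N%:R * theta) * (Y y0 N w).2) * D i) / (N%:R * tau) -
     (a * B i 0 + b * D i) = al / (N%:R * tau) * ((cN * d1 - sN * d2) * B i 0 + (sN * d1 + cN * d2) * D i).
    rewrite aE bE -/cN -/sN /d1 /d2; field.
    by rewrite (lt0r_neq0 tau_gt0) (lt0r_neq0 N0).
  have aN0 : 0 < al / (N%:R * tau) by rewrite divr_gt0// mulr_gt0.
  have dd (x y : R) : `|x| <= 1 -> `|y| <= 1 -> `|x * d1 + y * d2| <= 2 * (e' * N%:R).
    move=> x1 y1; rewrite (le_trans (ler_normD _ _))// !normrM mulr_natl mulr2n lerD//.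
      by rewrite (le_trans (ler_piMl (normr_ge0 d1) x1)).
    by rewrite (le_trans (ler_piMl (normr_ge0 d2) y1)).
  have -> : eps / K * (`|B i 0| + `|D i|) =
      al / (N%:R * tau) * (2 * (e' * N%:R) * `|B i 0| + 2 * (e' * N%:R) * `|D i|).
    rewrite /e'; field.
    by rewrite (lt0r_neq0 tau_gt0) (lt0r_neq0 N0) (lt0r_neq0 K1) (lt0r_neq0 al_gt0).
  rewrite normrM (ger0_norm (ltW aN0)) ler_pM2l// (le_trans (ler_normD _ _))// !normrM lerD//.
    by rewrite ler_wpM2r// -mulNr; apply: dd; rewrite ?normrN.
  by rewrite ler_wpM2r//; apply: dd.
have Kle i : i = 0 \/ i = 1 -> eps / K * (`|B i 0| + `|D i|) <= eps.
  move=> i01; rewrite mulrAC ler_pdivrMr// ler_pM2l// /K.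
  have := normr_ge0 (B 0 0); have := normr_ge0 (B 1 0).
  have := normr_ge0 (D 0); have := normr_ge0 (D 1).
  by case: i01 => ->; lra.
split; rewrite /= ?pE ?qE.
- by apply: (le_trans (key 0)); apply: Kle; left.
- by apply: (le_trans (key 1)); apply: Kle; right.
Unshelve. all: by end_near.
Qed.

End Mode.

(** * Large deviations of finitely many modes *)

Section LimitBounds.
Context {R : realType}.
Local Open Scope ereal_scope.

Lemma limn_esup_le (u : (\bar R)^nat) (b : \bar R) :
  (\forall n \near \oo, u n <= b) -> limn_esup u <= b.
Proof.
move=> ub; apply: (@le_trans _ _ (ereal_sup (u @` [set n | u n <= b]))).
  by apply: ereal_inf_lbound; exists [set n | u n <= b].
by apply: ge_ereal_sup => _ [n + <-].
Qed.

Lemma le_limn_einf (u : (\bar R)^nat) (b : \bar R) :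
  (\forall n \near \oo, b <= u n) -> b <= limn_einf u.
Proof.
move=> ub; rewrite /limn_einf leeNr; apply: limn_esup_le.
by apply: filterS ub => n; rewrite leeN2.
Qed.

Lemma near_infty_div_le (c e : R) : (0 < e)%R -> \forall N \near \oo, (c / N%:R <= e)%R.
Proof.
move=> e0; near=> N.
have N0 : (0 < N%:R :> R)%R by rewrite ltr0n; near: N; exists 1%N.
rewrite ler_pdivrMr// mulrC -ler_pdivrMr//; near: N; exact: nbhs_infty_ger.
Unshelve. all: by end_near.
Qed.

Lemma log_speed_upper (p : nat -> \bar R) (r K : R) : (0 < K)%R ->
  (forall N, 0 <= p N) ->
  (\forall N \near \oo, p N <= (K * expR (- (N%:R * r)))%:E) ->
  forall e : R, (0 < e)%R ->
  limn_esup (fun N => (N%:R^-1)%:E * lne (p N)) <= (- r + e)%:E.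
Proof.
move=> K0 p0 pK e e0; apply: limn_esup_le; near=> N.
have N0 : (0 < N%:R :> R)%R by rewrite ltr0n; near: N; exists 1%N.
have pN : p N <= (K * expR (- (N%:R * r)))%:E by near: N; exact: pK.
have q0 : (0 < K * expR (- (N%:R * r)))%R by rewrite mulr_gt0// expR_gt0.
have lp : lne (p N) <= (ln K - N%:R * r)%:E.
  apply: (@le_trans _ _ (lne (K * expR (- (N%:R * r)))%:E)).
    by rewrite lee_lne// in_itv/= ?leey ?andbT// lee_fin ltW.
  by rewrite lne_EFin// lnM ?posrE ?expR_gt0// expRK.
apply: (@le_trans _ _ ((N%:R^-1)%:E * (ln K - N%:R * r)%:E)).
  by rewrite lee_pmul2l// lte_fin invr_gt0.
rewrite -EFinM lee_fin mulrBr mulrA mulVf ?gt_eqF// mul1r addrC lerD2l mulrC.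
by near: N; exact: near_infty_div_le.
Unshelve. all: by end_near.
Qed.

Lemma log_speed_lower (p : nat -> \bar R) (r K : R) : (0 < K)%R ->
  (forall N, p N <= 1) ->
  (\forall N \near \oo, (K * expR (- (N%:R * r)))%:E <= p N) ->
  forall e : R, (0 < e)%R ->
  (- r - e)%:E <= limn_einf (fun N => (N%:R^-1)%:E * lne (p N)).
Proof.
move=> K0 p1 pK e e0; apply: le_limn_einf; near=> N.
have N0 : (0 < N%:R :> R)%R by rewrite ltr0n; near: N; exists 1%N.
have pN : (K * expR (- (N%:R * r)))%:E <= p N by near: N; exact: pK.
have q0 : (0 < K * expR (- (N%:R * r)))%R by rewrite mulr_gt0// expR_gt0.
have lp : (ln K - N%:R * r)%:E <= lne (p N).
  apply: (@le_trans _ _ (lne (K * expR (- (N%:R * r)))%:E)).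
    by rewrite lne_EFin// lnM ?posrE ?expR_gt0// expRK.
  rewrite lee_lne// in_itv/= ?leey ?andbT ?lee_fin ?(ltW q0)//.
  by apply: le_trans pN; rewrite lee_fin ltW.
apply: (@le_trans _ _ ((N%:R^-1)%:E * (ln K - N%:R * r)%:E)); last first.
  by rewrite lee_pmul2l// lte_fin invr_gt0.
rewrite -EFinM lee_fin mulrBr mulrA mulVf ?gt_eqF// mul1r addrC lerD2r mulrC.
rewrite lerNl -mulNr; near: N; exact: near_infty_div_le.
Unshelve. all: by end_near.
Qed.

End LimitBounds.

Section LdpOfBounds.
Context d (Omega : measurableType d) (R : realType) (P : probability Omega R).
Context (X : topologicalType) (Z : nat -> Omega -> X) (J : X -> \bar R).
Local Open Scope ereal_scope.
Hypothesis J_rate : rate_function J.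
Hypothesis Z_meas : forall N G, open G -> measurable [set w | G (Z N w)].
Hypothesis upper : forall rho : R, (1 < rho)%R -> exists2 K : R, (0 < K)%R &
  \forall N \near \oo, forall (r : R) (E : set Omega), (0 <= r)%R -> measurable E ->
    (forall w, E w -> r%:E <= J (Z N w)) -> P E <= (K * expR (- (N%:R * (r / rho))))%:E.
Hypothesis lower : forall (G : set X) (x : X) (r del : R), open G -> G x ->
  J x = r%:E -> (0 < del)%R -> exists2 K : R, (0 < K)%R &
  \forall N \near \oo, (K * expR (- (N%:R * (r + del))))%:E <= P [set w | G (Z N w)].

Lemma measurable_closed_event N C : closed C -> measurable [set w | C (Z N w)].
Proof.
move=> cC; rewrite -[X in measurable X]setCK; apply: measurableC.
by apply: (Z_meas N (G := ~` C)); exact: closed_openC.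
Qed.

Lemma ldp_of_bounds : ldp P Z J.
Proof.
split => // [G oG|C cC].
  rewrite leeNl; apply: le_ereal_inf_tmp => _ [x Gx <-].
  have [J0 _] := J_rate; rewrite leeNl.
  have := J0 x; case E : (J x) => [r| |] // _; last by rewrite leNye.
  apply/lee_subgt0Pr => e e0.
  have e2 : (0 < e / 2)%R by rewrite divr_gt0.
  have [K K0 hK] := lower oG Gx E e2.
  have p1 N : P [set w | G (Z N w)] <= 1 by apply: probability_le1; exact: Z_meas.
  apply: le_trans (log_speed_lower K0 p1 hK e2).
  by rewrite -EFinB lee_fin; lra.
have [J0 _] := J_rate.
have key (r : R) : (0 <= r)%R -> (forall x, C x -> r%:E <= J x) ->
    limn_esup (fun N => (N%:R^-1)%:E * lne (P [set w | C (Z N w)])) <= (- r)%:E.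
  move=> r0 hr; apply/lee_addgt0Pr => e e0; rewrite -EFinD.
  pose rho := (1 + e / (2 * (r + 1)))%R.
  have r1 : (0 < 2 * (r + 1))%R by rewrite mulr_gt0// ltr_wpDl.
  have er : (0 < e / (2 * (r + 1)))%R by rewrite divr_gt0.
  have rho1 : (1 < rho)%R by rewrite /rho ltrDl.
  have rho0 : (0 < rho)%R by apply: lt_trans rho1.
  have [K K0 hK] := upper rho1.
  have e2 : (0 < e / 2)%R by rewrite divr_gt0.
  apply: (le_trans (@log_speed_upper _ (fun N => P [set w | C (Z N w)]) (r / rho) K K0 _ _ (e / 2) e2)).
  - by move=> N; exact: measure_ge0.
  - near=> N.
    have h : forall (r : R) (E : set Omega), (0 <= r)%R -> measurable E ->
      (forall w, E w -> r%:E <= J (Z N w)) -> P E <= (K * expR (- (N%:R * (r / rho))))%:E.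
      by near: N; exact: hK.
    by apply: h => //; [exact: measurable_closed_event|move=> w; exact: hr].
  rewrite lee_fin; suff : (r - r / rho <= e / 2)%R by lra.
  have -> : (r - r / rho = r * (rho - 1) / rho)%R by field; rewrite gt_eqF.
  rewrite ler_pdivrMr//.
  apply: (@le_trans _ _ (e / 2)%R); last by rewrite ler_peMr// ltW.
  rewrite /rho addrAC subrr add0r mulrA ler_pdivrMr//; lra.
have inf0 : 0 <= ereal_inf (J @` C) by apply: le_ereal_inf_tmp => _ [x _ <-].
case E : (ereal_inf (J @` C)) inf0 => [r| |] // inf0.
  apply: key => // x Cx; rewrite -E; apply: ereal_inf_lbound; by exists x.
rewrite leeNr; suff -> : - limn_esup (fun N => (N%:R^-1)%:E * lne (P [set w | C (Z N w)])) = +oo by [].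
apply/eqyP => a a0; rewrite leeNr; apply: key => [|x Cx]; first exact: ltW.
by apply: le_trans (ereal_inf_lbound (imageP J Cx)); rewrite E leey.
Unshelve. all: by end_near.
Qed.

End LdpOfBounds.

Lemma measurable_open_rV d (T : measurableType d) (R : realType) n
    (f : T -> 'rV[R]_n) (G : set 'rV[R]_n) :
  (forall i, measurable_fun setT (fun t => f t 0 i)) -> open G ->
  measurable (f @^-1` G).
Proof.
move=> mf oG.
pose box (m : nat) (q : {ffun 'I_n -> int}) :=
  [set x : 'rV[R]_n | forall i, Num.floor (m.+1%:R * x 0 i) = q i].
have mbox m q : measurable (f @^-1` box m q).
  rewrite (_ : f @^-1` _ = \bigcap_(i in [set: 'I_n])
      (fun t => m.+1%:R * f t 0 i) @^-1` `[(q i)%:~R, (q i + 1)%:~R[%classic).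
    apply: fin_bigcap_measurable => // i _; rewrite -[X in measurable X]setTI.
    have mg : measurable_fun setT (fun t => m.+1%:R * f t 0 i) by exact: measurable_funM.
    by apply: mg => //; exact: measurable_itv.
  apply/seteqP; split => t /= h.
    by move=> i _; rewrite /= in_itv /= -(h i) floor_le floorD1_gt.
  move=> i; have := h i I; rewrite /= in_itv /= => /andP[h1 h2].
  by apply/eqP; rewrite floor_eq h1 h2.
have -> : f @^-1` G = \bigcup_(mq in [set mq | box mq.1 mq.2 `<=` G]) f @^-1` box mq.1 mq.2.
  apply/seteqP; split=> [t Gt|t [[m q] /= bG]]; last by move=> /bG.
  have /nbhs_ballP[e e0 eG] : nbhs (f t) G by exact: open_nbhs_nbhs.
  have [m me] : exists m : nat, m.+1%:R^-1 < e.
    have [m _ /(_ m (leqnn m))] := near_infty_natSinv_lt (PosNum e0).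
    by exists m.
  exists (m, [ffun i => Num.floor (m.+1%:R * f t 0 i)]) => /=; last by move=> i; rewrite ffunE.
  move=> y hy; apply: eG; split => // i j; rewrite !ord1 /ball /=.
  have := hy j; rewrite ffunE => fl.
  have := floor_itv (m.+1%:R * f t 0 j); have := floor_itv (m.+1%:R * y 0 j).
  rewrite fl !intrD => /andP[h1 h2] /andP[h3 h4].
  apply: lt_trans me; rewrite -[ltRHS]mul1r ltr_pdivlMr// mulrC -[X in X * _]ger0_norm//.
  rewrite -normrM mulrBr ltr_norml; apply/andP; split; lra.
rewrite bigcup_mkcond; apply: countable_bigcupT_measurable => // -[m q].
by case: ifP => _; [exact: mbox|exact: measurable0].
Qed.

Section ModeSum.
Context {R : realType}.
Implicit Types (M : nat) (p q : nat -> R) (G : set (H0 R)).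

Definition mode_sum M p q : H0 R :=
  \sum_(1 <= k < M.+1) Defs.cscale (p k +i* q k)%C (ec_ k).

Definition mode_embed M (v : 'rV[R]_(M + M)) : H0 R :=
  \sum_(i < M) Defs.cscale (v 0 (lshift M i) +i* v 0 (rshift M i))%C (ec_ i.+1).

Definition mode_row M p q : 'rV[R]_(M + M) :=
  row_mx (\row_(i < M) p i.+1) (\row_(i < M) q i.+1).

Lemma mode_embed_row M p q : mode_embed (mode_row M p q) = mode_sum M p q.
Proof.
rewrite /mode_embed /mode_sum big_add1 big_mkord.
by apply: eq_bigr => i _; rewrite row_mxEl row_mxEr !mxE.
Qed.

Lemma mode_sumZ M p q (t : R) : t *: mode_sum M p q = mode_sum M (fun k => t * p k) (fun k => t * q k).
Proof.
by rewrite /mode_sum scaler_sumr; apply: eq_bigr => k _; rewrite !cscale_ec /= -!scalerA.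
Qed.

Lemma HM_mode_sum M p q : HM M (mode_sum M p q).
Proof. by exists (fun k => p k +i* q k)%C. Qed.

Lemma cdot_mode_sum M p q k : (0 < k <= M)%N ->
  cdot (mode_sum M p q) (ec_ k) = (p k +i* q k)%C.
Proof. by move=> kM; rewrite /mode_sum (cdot_sum_ec (fun k => p k +i* q k)%C). Qed.

Lemma mode_sum_cdot M (x : H0 R) : HM M x ->
  x = mode_sum M (fun k => complex.Re (cdot x (ec_ k))) (fun k => complex.Im (cdot x (ec_ k))).
Proof.
move=> /HM_PM {1}<-; rewrite /PM /mode_sum; apply: eq_bigr => k _.
by congr (Defs.cscale _ _); case: (cdot _ _).
Qed.

Lemma continuous_mode_embed M : continuous (@mode_embed M).
Proof.
move=> v; rewrite /mode_embed.
have -> : (fun v : 'rV[R]_(M + M) => mode_embed v) = (fun v : 'rV[R]_(M + M) =>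
    \sum_(i < M) (v 0 (lshift M i) *: mkH0 (e_ i.+1) 0 + v 0 (rshift M i) *: mkH0 0 (e_ i.+1))).
  apply/funext => u; apply: eq_bigr => i _; rewrite cscale_ec /=.
  by congr pair; rewrite /= scaler0 ?addr0 ?add0r.
apply: cvg_big => [||i _]; [exact: add_continuous|exact: nbhs_filter|].
by apply: (cvgD (cvgZr_tmp (a := mkH0 (e_ i.+1) 0) (@coord_continuous R 1 (M + M) 0 (lshift M i) v))
  (cvgZr_tmp (a := mkH0 0 (e_ i.+1)) (@coord_continuous R 1 (M + M) 0 (rshift M i) v))).
Qed.

Lemma measurable_mode_sum d (T : measurableType d) M (p q : T -> nat -> R) G :
  (forall k, measurable_fun setT (p^~ k)) -> (forall k, measurable_fun setT (q^~ k)) ->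
  open G -> measurable [set w | G (mode_sum M (p w) (q w))].
Proof.
move=> mp mq oG.
have := @measurable_open_rV _ T R _ (fun w => mode_row M (p w) (q w)) (@mode_embed M @^-1` G).
rewrite (_ : _ @^-1` _ = [set w | G (mode_sum M (p w) (q w))]); last first.
  by apply/funext => w; rewrite /= mode_embed_row.
apply; last by move/continuousP: (@continuous_mode_embed M); apply.
move=> i; case: (splitP i) => j ij.
  have -> : i = lshift M j by exact/val_inj.
  by rewrite (_ : (fun w => _) = p^~ j.+1)//; apply/funext => w; rewrite row_mxEl mxE.
have -> : i = rshift M j by exact/val_inj.
by rewrite (_ : (fun w => _) = q^~ j.+1)//; apply/funext => w; rewrite row_mxEr mxE.
Qed.

Lemma mode_sum_box M p q G : open G -> G (mode_sum M p q) ->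
  exists2 e : R, 0 < e & forall p' q',
    (forall k, (0 < k <= M)%N -> `|p' k - p k| <= e /\ `|q' k - q k| <= e) ->
    G (mode_sum M p' q').
Proof.
move=> oG; rewrite -mode_embed_row => Gx.
have : nbhs (mode_row M p q) (@mode_embed M @^-1` G).
  by apply: continuous_mode_embed; exact: open_nbhs_nbhs.
move=> /nbhs_ballP[e e0 eG]; exists (e / 2); first by rewrite divr_gt0.
have e2 : e / 2 < e by rewrite ltr_pdivrMr// ltr_pMr// ltr1n.
move=> p' q' h; rewrite -mode_embed_row; apply: eG; split => // a i; rewrite ord1 /ball /=.
have hj (j : 'I_M) : (0 < j.+1 <= M)%N by rewrite ltn_ord.
case: (splitP i) => j ij.
  have -> : i = lshift M j by exact/val_inj.
  by rewrite !row_mxEl !mxE distrC (le_lt_trans _ e2)//; have [] := h _ (hj j).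
have -> : i = rshift M j by exact/val_inj.
by rewrite !row_mxEr !mxE distrC (le_lt_trans _ e2)//; have [] := h _ (hj j).
Qed.

Section ModeRates.
Variables (M : nat) (j : nat -> R -> R -> R).

Definition mode_sum_rate (x : H0 R) : \bar R :=
  if `[< HM M x >] then
    (\sum_(1 <= k < M.+1) j k (complex.Re (cdot x (ec_ k))) (complex.Im (cdot x (ec_ k))))%:E
  else +oo%E.

Lemma mode_sum_rateE p q : mode_sum_rate (mode_sum M p q) =
  (\sum_(1 <= k < M.+1) j k (p k) (q k))%:E.
Proof.
rewrite /mode_sum_rate asboolT; last exact: HM_mode_sum.
by congr EFin; apply: eq_big_nat => k; rewrite ltnS => kM; rewrite cdot_mode_sum.
Qed.

Hypothesis j_continuous : forall k, (0 < k <= M)%N -> continuous (fun z : R * R => j k z.1 z.2).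
Hypothesis j_coercive : forall k, (0 < k <= M)%N -> exists2 e : R, 0 < e &
  forall a b, e * (a ^+ 2 + b ^+ 2) <= j k a b.

Lemma mode_sum_rate_ge0 x : (0 <= mode_sum_rate x)%E.
Proof.
rewrite /mode_sum_rate; case: ifP => _; last exact: leey.
rewrite lee_fin big_nat; apply: sumr_ge0 => k; rewrite ltnS => /j_coercive[e e0 he]; apply: (le_trans _ (he _ _)).
by rewrite mulr_ge0 ?(ltW e0)// addr_ge0// sqr_ge0.
Qed.

Let F (v : 'rV[R]_(M + M)) : R := \sum_(i < M) j i.+1 (v 0 (lshift M i)) (v 0 (rshift M i)).

Let F_continuous : continuous F.
Proof.
move=> v; rewrite /F; apply: cvg_big => [||i _]; [exact: add_continuous|exact: nbhs_filter|].
have iM : (0 < i.+1 <= M)%N by rewrite ltn_ord.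
apply: (@continuous_comp _ _ _ (fun v : 'rV[R]_(M + M) => (v 0 (lshift M i), v 0 (rshift M i)))
  (fun z : R * R => j i.+1 z.1 z.2)); last exact: j_continuous.
exact: (cvg_pair (@coord_continuous R 1 (M + M) 0 (lshift M i) v)
  (@coord_continuous R 1 (M + M) 0 (rshift M i) v)).
Qed.

Lemma compact_mode_sum_rate (r : R) : compact [set x | (mode_sum_rate x <= r%:E)%E].
Proof.
have -> : [set x | (mode_sum_rate x <= r%:E)%E] = @mode_embed M @` [set v | F v <= r].
  apply/seteqP; split=> [x /=|_ [v /= Fv <-]].
    rewrite /mode_sum_rate; case: asboolP => // /mode_sum_cdot {3}->; rewrite lee_fin => h.
    exists (mode_row M (fun k => complex.Re (cdot x (ec_ k))) (fun k => complex.Im (cdot x (ec_ k)))).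
      rewrite /= /F; apply: le_trans h; rewrite big_add1 big_mkord.
      by rewrite le_eqVlt; apply/orP; left; apply/eqP/eq_bigr => i _; rewrite row_mxEl row_mxEr !mxE.
    exact: mode_embed_row.
  pose f (s : 'I_M -> 'I_(M + M)) k := if insub k.-1 is Some i then v 0 (s i) else 0.
  have fE s (i : 'I_M) : f s i.+1 = v 0 (s i) by rewrite /f valK.
  have -> : v = mode_row M (f (lshift M)) (f (@rshift M M)).
    apply/rowP => i; case: (splitP i) => l il.
      have -> : i = lshift M l by exact/val_inj.
      by rewrite row_mxEl mxE fE.
    have -> : i = rshift M l by exact/val_inj.
    by rewrite row_mxEr mxE fE.
  rewrite mode_embed_row mode_sum_rateE lee_fin big_add1 big_mkord; apply: le_trans Fv.
  by rewrite le_eqVlt; apply/orP; left; apply/eqP/eq_bigr => i _; rewrite !fE.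
apply: continuous_compact; first by apply: continuous_subspaceT; exact: continuous_mode_embed.
have : forall i : 'I_M, exists e, 0 < e /\ forall a b, e * (a ^+ 2 + b ^+ 2) <= j i.+1 a b.
  move=> i; have iM : (0 < i.+1 <= M)%N by rewrite ltn_ord.
  by have [e e0 he] := j_coercive iM; exists e.
move=> /choice[e he].
pose K (i : 'I_M) := r / e i + 1.
pose c (i : 'I_(M + M)) := match fintype.split i with inl l => K l | inr l => K l end.
have hc : compact [set v : 'rV[R]_(M + M) | forall i, v ord0 i \in `[- c i, c i]].
  by apply: (@rV_compact _ _ (fun i => `[- c i, c i]%classic)) => i; exact: segment_compact.
have cF : closed [set v | F v <= r].
  rewrite (_ : [set v | _] = F @^-1` [set x | x <= r])//.
  by move/continuous_closedP: F_continuous; apply; exact: closed_le.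
apply: subclosed_compact cF hc _ => v /= Fv i.
have bd (l : 'I_M) : v 0 (lshift M l) ^+ 2 <= r / e l /\ v 0 (rshift M l) ^+ 2 <= r / e l.
  have [e0 he'] := he l.
  have h : e l * (v 0 (lshift M l) ^+ 2 + v 0 (rshift M l) ^+ 2) <= r.
    apply: le_trans Fv; apply: (le_trans (he' _ _)).
    rewrite /F (bigD1 l)//= lerDl; apply: sumr_ge0 => k _; have [k0 hk] := he k.
    by apply: le_trans (hk _ _); rewrite mulr_ge0 ?(ltW k0)// addr_ge0// sqr_ge0.
  have := sqr_ge0 (v 0 (lshift M l)); have := sqr_ge0 (v 0 (rshift M l)).
  by split; rewrite ler_pdivlMr//; nra.
have sqb (x y : R) : x ^+ 2 <= y -> - (y + 1) <= x <= y + 1.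
  by move=> xy; apply/andP; split; nra.
rewrite in_itv /= /c; case: (splitP i) => l il.
  have -> : i = lshift M l by exact/val_inj.
  by apply: sqb; case: (bd l).
have -> : i = rshift M l by exact/val_inj.
by apply: sqb; case: (bd l).
Qed.

Lemma good_mode_sum_rate : good_rate_function mode_sum_rate.
Proof.
split; last by move=> r _; exact: compact_mode_sum_rate.
split; first exact: mode_sum_rate_ge0.
apply/lower_semicontinuousP => a.
have -> : [set x | (a%:E < mode_sum_rate x)%E] = ~` [set x | (mode_sum_rate x <= a%:E)%E].
  by apply/seteqP; split => x /=; rewrite ltNge => /negP.
apply: closed_openC; apply: compact_closed; last exact: compact_mode_sum_rate.
exact: norm_hausdorff.
Qed.

End ModeRates.
End ModeSum.

Lemma integral_expR_sum d (Omega : measurableType d) (R : realType) (P : probability Omega R)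
    (X : nat -> {RV P >-> R}) (K : nat -> R) (M : nat) :
  mutually_independent P (fun n => sigma_rv (X n)) ->
  (forall n, (n < M)%N -> 0 < K n /\ (\int[P]_w (expR (X n w))%:E <= (K n)%:E)%E) ->
  (\int[P]_w (expR (\sum_(n < M) X n w))%:E <= (\prod_(n < M) K n)%:E)%E.
Proof.
move=> indep; pose phi (n : nat) (z : R * R) := z.1 + z.2.
have mphi n : measurable_fun setT (phi n).
  by apply: measurable_funD; [exact: measurable_fst|exact: measurable_snd].
have chE n w : chain X (0 : R) phi n w = \sum_(i < n) X i w.
  by elim: n => [|n ih] /=; rewrite ?big_ord0// big_ord_recr /= -ih.
have mexp : measurable_fun setT (fun z : R * R => (expR (z.1 + z.2))%:E).
  by apply/measurable_EFinP; apply: measurableT_comp => //; exact: (mphi 0%N).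
have e0 (x : R) : (0 <= (expR x)%:E)%E by rewrite lee_fin expR_ge0.
elim: M => [_|M ih hK].
  under eq_integral do rewrite big_ord0 expR0.
  by rewrite big_ord0 integral_cst// [X in (_ * X)%E](@probability_setT _ _ _ P) mul1e.
have [KM0 KM] := hK M (ltnSn M).
rewrite [in leRHS]big_ord_recr /=.
have -> : (\int[P]_w (expR (\sum_(n < M.+1) X n w))%:E =
    \int[P]_w (expR (chain X (0 : R) phi M w + X M w))%:E)%E.
  by apply: eq_integral => w _; rewrite chE big_ord_recr.
rewrite (integral_chain (0 : R) mphi indep M (F := fun z => (expR (z.1 + z.2))%:E) mexp); last first.
  by move=> z; exact: e0.
have step w : (\int[pushforward P (X M)]_x (expR (chain X (0 : R) phi M w + x))%:E =
    (expR (chain X (0 : R) phi M w))%:E * \int[P]_w (expR (X M w))%:E)%E.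
  have mX : measurable_fun [set: R] (fun x : R => (expR x)%:E).
    by apply/measurable_EFinP; exact: measurable_expR.
  under eq_integral do rewrite expRD EFinM.
  by rewrite ge0_integralZl// ge0_integral_pushforward.
under eq_integral do rewrite step.
have mch : measurable_fun setT (fun w => (expR (chain X (0 : R) phi M w))%:E).
  by apply/measurable_EFinP; apply: measurableT_comp => //; exact: (measurable_chain X (0 : R) mphi).
have i0 (f : Omega -> R) : (0 <= \int[P]_w (expR (f w))%:E)%E by exact: integral_ge0.
rewrite ge0_integralZr// EFinM; apply: lee_pmul => //.
under eq_integral do rewrite chE.
by apply: ih => n nM; apply: hK; rewrite ltnS ltnW.
Qed.

Lemma lee_prod_fin (R : realType) (I : Type) (s : seq I) (a : I -> R) (p : I -> \bar R) :
  (forall i, 0 <= a i) -> (forall i, ((a i)%:E <= p i)%E) ->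
  ((\prod_(i <- s) a i)%:E <= \prod_(i <- s) p i)%E.
Proof.
move=> a0 ap; elim: s => [|i s ih]; rewrite ?big_nil// !big_cons EFinM.
by apply: lee_pmul => //; rewrite lee_fin// prodr_ge0.
Qed.

Section ModesLdp.
Context d (Omega : measurableType d) (R : realType) (P : probability Omega R).
Variables (M : nat) (W : nat -> R -> {RV P >-> R}) (tau : R) (al : nat -> R).
Variables (A : nat -> 'M[R]_2) (B : nat -> 'cV[R]_2) (z0 : nat -> 'cV[R]_2).
Variable v : nat -> nat -> Omega -> 'cV[R]_2.
Hypothesis W_BM : forall k, (0 < k <= M)%N -> brownian_motion (W k).
Hypothesis W_indep :
  mutually_independent P (fun k : nat => sigma_process (fun t w => W k.+1 t w)).
Hypothesis tau_gt0 : 0 < tau.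
Hypothesis al_gt0 : forall k, (0 < k <= M)%N -> 0 < al k.
Hypothesis det1 : forall k, (0 < k <= M)%N -> \det (A k) = 1.
Hypothesis elliptic : forall k, (0 < k <= M)%N -> 0 < 4 * \det (A k) - \tr (A k) ^+ 2.
Hypothesis Bn0 : forall k, (0 < k <= M)%N -> B k 0 0 ^+ 2 + B k 1 0 ^+ 2 != 0.
Hypothesis v_0 : forall k w, v k 0%N w = z0 k.
Hypothesis v_S : forall k n w, v k n.+1 w = A k *m v k n w +
  (al k * (W k (n.+1%:R * tau) w - W k (n%:R * tau) w)) *: B k.

Let rate k := mode_rate tau (al k) (A k) (B k).

Let p N w k := v k N w 0 0 / (N%:R * tau).
Let q N w k := v k N w 1 0 / (N%:R * tau).
Let Z N w : H0 R := mode_sum M (p N w) (q N w).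

Let ordM (i : 'I_M) : (0 < i.+1 <= M)%N. Proof. by rewrite ltn_ord. Qed.

Let mW k (t : R) : 0 <= t -> measurable_fun setT (W k t \o id).
Proof. by move=> _; exact: measurable_funP. Qed.

Let mv k N i : measurable_fun setT (fun w => v k N w i 0 / (N%:R * tau)).
Proof.
by apply: measurable_funM => //; exact: (measurable_state tau_gt0 (v_0 k) (v_S k) (@mW k)).
Qed.

Lemma modes_rate_good : good_rate_function (mode_sum_rate M rate).
Proof.
apply: good_mode_sum_rate => k kM; last first.
  exact: (mode_rate_coercive tau_gt0 (al_gt0 kM) (det1 kM) (elliptic kM) (Bn0 kM)).
move=> z; rewrite /rate /mode_rate /pair_det.
have c1 : {for z, continuous (fun z : R * R => z.1)} by exact: cvg_fst.
have c2 : {for z, continuous (fun z : R * R => z.2)} by exact: cvg_snd.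
apply: cvgMr_tmp; apply: cvgMl_tmp; apply: cvgMr_tmp; apply: cvgB; first apply: cvgD.
- by apply: cvgMl_tmp; exact: cvgM.
- by apply: cvgM => //; exact: cvgMl_tmp.
- by apply: cvgMl_tmp; exact: cvgM.
Qed.

Lemma modes_ldp_meas N G : open G -> measurable [set w | G (Z N w)].
Proof. by move=> oG; apply: measurable_mode_sum => // k; exact: mv. Qed.

Lemma modes_ldp_upper (rho : R) : 1 < rho -> exists2 K : R, 0 < K &
  \forall N \near \oo, forall (r : R) (E : set Omega), 0 <= r -> measurable E ->
    (forall w, E w -> (r%:E <= mode_sum_rate M rate (Z N w))%E) ->
    (P E <= (K * expR (- (N%:R * (r / rho))))%:E)%E.
Proof.
move=> rho1; have rho0 : 0 < rho by exact: lt_trans rho1.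
have : forall i : 'I_M, exists K : R, 0 < K /\ \forall N \near \oo,
    (\int[P]_w (expR (N%:R * rate i.+1 (p N w i.+1) (q N w i.+1) / rho))%:E <= K%:E)%E.
  move=> i; have iM := ordM i.
  exact: (mode_upper (W_BM iM) tau_gt0 (al_gt0 iM) (det1 iM) (elliptic iM) (Bn0 iM)
    (v_0 i.+1) (v_S i.+1) rho1).
move=> /choice[K0 hK].
pose K n := if insub n is Some i then K0 i else 1.
have KE (i : 'I_M) : K i = K0 i by rewrite /K valK.
have Kpos n : 0 < K n by rewrite /K; case: insubP => // i _ _; case: (hK i).
have near_all : \forall N \near \oo, forall i : 'I_M,
    (\int[P]_w (expR (N%:R * rate i.+1 (p N w i.+1) (q N w i.+1) / rho))%:E <= (K0 i)%:E)%E.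
  by apply: filter_forall => i; case: (hK i).
exists (\prod_(i < M) K i); first exact: prodr_gt0.
near=> N; move=> r E r0 mE EJ.
have bound : forall i : 'I_M,
    (\int[P]_w (expR (N%:R * rate i.+1 (p N w i.+1) (q N w i.+1) / rho))%:E <= (K0 i)%:E)%E.
  by near: N.
have mX n := measurable_state_rate tau_gt0 (v_0 n.+1) (v_S n.+1) (N%:R / rho) N.
pose X n : {RV P >-> R} := mfun_Sub (mem_set (mX n)).
have XE n w : X n w = N%:R * rate n.+1 (p N w n.+1) (q N w n.+1) / rho.
  by rewrite /X /= -/(rate n.+1 _ _) mulrAC.
have Xindep : mutually_independent P (fun n => sigma_rv (X n)).
  apply: mutually_independent_sub W_indep => n.
  exact: (sigma_state_rate tau_gt0 (v_0 n.+1) (v_S n.+1)).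
have mS : measurable_fun setT (fun w => \sum_(n < M) X n w).
  by apply: measurable_sum => n; exact: measurable_funP.
have Ele : (\int[P]_w (expR (\sum_(n < M) X n w))%:E <= (\prod_(n < M) K n)%:E)%E.
  apply: integral_expR_sum => // n nM; split => //.
  rewrite (KE (Ordinal nM)); under eq_integral do rewrite XE.
  exact: (bound (Ordinal nM)).
have ch := exp_markov P (N%:R * (r / rho)) mS.
apply: (@le_trans _ _ (P [set w | (N%:R * (r / rho) <= \sum_(n < M) X n w)%R])).
  apply: le_measure; rewrite ?inE//.
    rewrite -[X in measurable X]setTI.
    rewrite (_ : [set w | _] = (fun w => \sum_(n < M) X n w) @^-1` `[(N%:R * (r / rho)), +oo[%classic).
      by apply: mS => //; exact: measurable_itv.
    by apply/seteqP; split => w /=; rewrite in_itv /= andbT.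
  move=> w /EJ; rewrite mode_sum_rateE lee_fin big_add1 big_mkord => h.
  have SE : \sum_(n < M) X n w = N%:R * (\sum_(n < M) rate n.+1 (p N w n.+1) (q N w n.+1)) / rho.
    by rewrite mulr_sumr mulr_suml; apply: eq_bigr => i _; rewrite XE.
  by rewrite /mkset SE mulrA ler_pM2r ?invr_gt0// ler_wpM2l.
have e0 : 0 < expR (N%:R * (r / rho)) by exact: expR_gt0.
rewrite expRN [leRHS]EFinM [leRHS]muleC lee_pdivlMl//; exact: (le_trans ch Ele).
Unshelve. all: by end_near.
Qed.

Lemma modes_ldp_lower (G : set (H0 R)) (x : H0 R) (r del : R) : open G -> G x ->
  mode_sum_rate M rate x = r%:E -> 0 < del -> exists2 K : R, 0 < K &
  \forall N \near \oo, ((K * expR (- (N%:R * (r + del))))%:E <= P [set w | G (Z N w)])%E.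
Proof.
move=> oG Gx; rewrite /mode_sum_rate; case: asboolP => // /mode_sum_cdot xE [] rE del0.
set a := fun k => _ in xE; set b := fun k => complex.Im _ in xE.
rewrite xE in Gx; have [e e0 eG] := mode_sum_box oG Gx.
pose del' := del / M.+1%:R.
have del'0 : 0 < del' by rewrite divr_gt0.
pose box N (i : nat) := [set w | `|p N w i.+1 - a i.+1| <= e /\ `|q N w i.+1 - b i.+1| <= e].
have near_all : \forall N \near \oo, forall i : 'I_M,
    ((2^-1 * expR (- (N%:R * (rate i.+1 (a i.+1) (b i.+1) + del'))))%:E <= P (box N i))%E.
  apply: filter_forall => i; have iM := ordM i.
  exact: (mode_lower (W_BM iM) tau_gt0 (al_gt0 iM) (det1 iM) (elliptic iM) (Bn0 iM)
    (v_0 i.+1) (v_S i.+1) (a i.+1) (b i.+1) e0 del'0).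
exists (2^-1 ^+ M); first by rewrite exprn_gt0// invr_gt0.
near=> N.
have bound : forall i : 'I_M,
    ((2^-1 * expR (- (N%:R * (rate i.+1 (a i.+1) (b i.+1) + del'))))%:E <= P (box N i))%E.
  by near: N.
have sbox i : sigma_process (fun t w => W i.+1 t w) (box N i).
  exact: (sigma_state_box tau_gt0 (v_0 i.+1) (v_S i.+1)).
have mbox i : measurable (box N i).
  exact: (measurable_state_box tau_gt0 (v_0 i.+1) (v_S i.+1) _ _ _ _ (@mW i.+1)).
have capE := W_indep (iota_uniq 0 M) (fun i _ => sbox i).
apply: (@le_trans _ _ (P (\bigcap_(i in [set` iota 0 M]) box N i))); last first.
  apply: le_measure; rewrite ?inE.
  - by apply: fin_bigcap_measurable => // i _; exact: mbox.
  - exact: modes_ldp_meas.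
  move=> w hw; apply: eG => -[//|k] /andP[_ kM].
  by apply: (hw k); rewrite /= mem_iota add0n.
rewrite capE.
have -> : (\prod_(i <- iota 0 M) P (box N i) = \prod_(i < M) P (box N i))%E.
  by rewrite -[in LHS](subn0 M) -/(index_iota 0 M) big_mkord.
apply: (@le_trans _ _ (\prod_(i < M) (2^-1 * expR (- (N%:R * (rate i.+1 (a i.+1) (b i.+1) + del')))))%:E).
  rewrite big_split /= prodr_const card_ord lee_fin ler_pM2l ?exprn_gt0 ?invr_gt0//.
  rewrite -expR_sum ler_expR sumrN lerN2 -mulr_sumr ler_wpM2l//.
  rewrite big_split /= sumr_const card_ord -rE big_add1 big_mkord /= lerD2l.
  by rewrite /del' -[leLHS]mulr_natr mulrAC ler_pdivrMr// ler_pM2l// ler_nat leqnSn.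
apply: (lee_prod_fin _ _ bound) => i.
by rewrite mulr_ge0 ?expR_ge0// invr_ge0.
Unshelve. all: by end_near.
Qed.

Lemma modes_ldp : ldp P Z (mode_sum_rate M rate).
Proof.
apply: ldp_of_bounds.
- by case: modes_rate_good.
- exact: modes_ldp_meas.
- exact: modes_ldp_upper.
- exact: modes_ldp_lower.
Qed.

End ModesLdp.

(** * Vanishing step size *)

Lemma cvg_scale_at_right (R : realType) (c : R) : 0 < c ->
  c * t @[t --> 0^'+] --> 0^'+.
Proof.
move=> c0 S /= /nbhs_ballP[e e0 eS].
suff : \forall t \near 0^'+, S (c * t) by [].
near=> t; have t0 : 0 < t by near: t; exact: nbhs_right_gt.
apply: eS; last exact: mulr_gt0.
rewrite /ball /= sub0r normrN gtr0_norm ?mulr_gt0// mulrC -ltr_pdivlMr//.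
by near: t; apply: nbhs_right_lt; rewrite divr_gt0.
Unshelve. all: by end_near.
Qed.

Lemma near_modes (R : realType) (S : R -> Prop) (M : nat) :
  (\forall h \near 0^'+, S h) ->
  \forall tau \near 0^'+, forall k, (0 < k <= M)%N -> S (k%:R ^+ 2 * tau).
Proof.
move=> nS; have : \forall tau \near 0^'+, forall i : 'I_M, S (i.+1%:R ^+ 2 * tau).
  apply: filter_forall => i; have i0 : 0 < i.+1%:R ^+ 2 :> R by rewrite exprn_gt0.
  exact: (cvg_scale_at_right i0 nS).
apply: filterS => tau h [//|k] /andP[_ kM]; exact: (h (Ordinal kM)).
Qed.

Lemma cvg_at_right_bound (R : realType) (f : R -> R) (l C : R) :
  (\forall h \near 0^'+, `|f h - l| <= C * h) -> f h @[h --> 0^'+] --> l.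
Proof.
move=> fl; apply/cvgrPdist_le => e e0; near=> h.
have h0 : 0 < h by near: h; exact: nbhs_right_gt.
have C1 : 0 < `|C| + 1 by rewrite ltr_wpDl.
have hl : `|f h - l| <= C * h by near: h; exact: fl.
rewrite distrC (le_trans hl)//.
have : h <= e / (`|C| + 1) by near: h; apply: nbhs_right_le; rewrite divr_gt0.
rewrite ler_pdivlMr// mulrC; apply: le_trans; rewrite ler_wpM2r ?(ltW h0)//.
by rewrite (le_trans (ler_norm C))// lerDl.
Unshelve. all: by end_near.
Qed.

Section FullDiscretizationRate.
Context d (Omega : measurableType d) (R : realType) (P : probability Omega R).
Variables (alpha : R) (eta : nat -> R) (beta : nat -> R -> {RV P >-> R}) (u0 : H0 R).
Variables (A : R -> 'M[R]_2) (B : R -> 'cV[R]_2).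
Hypothesis alpha_gt0 : 0 < alpha.
Hypothesis beta_BM : forall k, (0 < k)%N -> brownian_motion (beta k).
Hypothesis beta_indep : mutually_independent P
  (fun k : nat => sigma_process (fun t w => beta k.+1 t w)).

Definition elliptic_step (h : R) := [/\ \det (A h) = 1,
  0 < 4 * \det (A h) - (\tr (A h)) ^+ 2 & B h 0 0 ^+ 2 + B h 1 0 ^+ 2 != 0].

Variables (M : nat).
Hypothesis eta_gt0 : forall k, (0 < k <= M)%N -> 0 < eta k.

Let al_gt0 k : (0 < k <= M)%N -> 0 < alpha_ alpha eta k.
Proof. by move=> /eta_gt0 h; rewrite /alpha_ mulr_gt0// sqrtr_gt0. Qed.

Section FixedStep.
Variable tau : R.
Hypothesis tau_gt0 : 0 < tau.
Hypothesis steps : forall k, (0 < k <= M)%N -> elliptic_step (k%:R ^+ 2 * tau).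

Lemma rate_IMtau_modes : rate_IMtau A B alpha eta M tau =
  mode_sum_rate M (fun k => mode_rate tau (alpha_ alpha eta k)
    (A (k%:R ^+ 2 * tau)) (B (k%:R ^+ 2 * tau))).
Proof.
apply/funext => x; rewrite /rate_IMtau /mode_sum_rate; case: ifP => // _.
congr EFin; apply: eq_big_nat => k; rewrite ltnS => kM; have [d1 el b0] := steps kM.
by apply: rate_summandE => //; [rewrite d1 mulr1 in el|exact: gram_neq0].
Qed.

Lemma BMN_modes : BMN A B alpha eta beta u0 M tau = fun N w => mode_sum M
  (fun k => pq A B alpha eta beta u0 M tau k N w 0 0 / (N%:R * tau))
  (fun k => pq A B alpha eta beta u0 M tau k N w 1 0 / (N%:R * tau)).
Proof.
apply/funext => N; apply/funext => w; rewrite /BMN /full_disc.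
rewrite -/(mode_sum M (fun k => pq A B alpha eta beta u0 M tau k N w 0 0)
  (fun k => pq A B alpha eta beta u0 M tau k N w 1 0)) mode_sumZ.
by congr mode_sum; apply/funext => k; rewrite mulrC.
Qed.

Lemma BMN_ldp : ldp P (BMN A B alpha eta beta u0 M tau) (rate_IMtau A B alpha eta M tau) /\
  good_rate_function (rate_IMtau A B alpha eta M tau).
Proof.
have d1 k : (0 < k <= M)%N -> \det (A (k%:R ^+ 2 * tau)) = 1 by move=> /steps[].
have el k : (0 < k <= M)%N ->
    0 < 4 * \det (A (k%:R ^+ 2 * tau)) - \tr (A (k%:R ^+ 2 * tau)) ^+ 2 by move=> /steps[].
have b0 k : (0 < k <= M)%N ->
    B (k%:R ^+ 2 * tau) 0 0 ^+ 2 + B (k%:R ^+ 2 * tau) 1 0 ^+ 2 != 0 by move=> /steps[].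
rewrite rate_IMtau_modes BMN_modes; split; last first.
  exact: (@modes_rate_good _ M tau (alpha_ alpha eta) (fun k => A (k%:R ^+ 2 * tau))
    (fun k => B (k%:R ^+ 2 * tau)) tau_gt0 al_gt0 d1 el b0).
apply: (@modes_ldp _ _ _ P M beta tau (alpha_ alpha eta) (fun k => A (k%:R ^+ 2 * tau))
    (fun k => B (k%:R ^+ 2 * tau)) (fun k => \col_(i < 2)
      (if i == 0 then complex.Re (cdot (PM M u0) (ec_ k)) else complex.Im (cdot (PM M u0) (ec_ k))))
    (pq A B alpha eta beta u0 M tau)) => //.
by move=> k /andP[k0 _]; exact: beta_BM.
Qed.

End FixedStep.

Hypothesis near_step : \forall h \near 0^'+, elliptic_step h.
Hypothesis cond_iii_A : exists C : R, \forall h \near 0^'+,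
  `|A h 0 0 - 1| + `|A h 1 1 - 1| + `|A h 0 1 - h| + `|A h 1 0 + h| <= C * h ^+ 2.
Hypothesis cond_iii_B : exists C : R, \forall h \near 0^'+,
  `|B h 0 0| + `|B h 1 0 - 1| <= C * h.

Lemma near_BMN_ldp : \forall tau \near 0^'+,
  ldp P (BMN A B alpha eta beta u0 M tau) (rate_IMtau A B alpha eta M tau) /\
  good_rate_function (rate_IMtau A B alpha eta M tau).
Proof.
near=> tau; apply: BMN_ldp; near: tau; [exact: nbhs_right_gt|exact: near_modes].
Unshelve. all: by end_near.
Qed.

(* As h -> 0, both - pair_det / h and - gram / h converge, to p^2 + q^2 and 1. *)
Lemma pair_det_ratio_cvg p q :
  pair_det (A h) p q / gram (A h) (B h) @[h --> 0^'+] --> p ^+ 2 + q ^+ 2.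
Proof.
have [C hC] := cond_iii_A; have [D hD] := cond_iii_B.
have c12 : A h 0 1 / h @[h --> 0^'+] --> (1 : R).
  apply: (@cvg_at_right_bound _ _ _ C); near=> h.
  have h0 : 0 < h by near: h; exact: nbhs_right_gt.
  have b : `|A h 0 0 - 1| + `|A h 1 1 - 1| + `|A h 0 1 - h| + `|A h 1 0 + h| <= C * h ^+ 2.
    by near: h.
  have -> : A h 0 1 / h - 1 = (A h 0 1 - h) / h by field; rewrite gt_eqF.
  rewrite normrM (gtr0_norm (x := h^-1)) ?invr_gt0// ler_pdivrMr//.
  have := normr_ge0 (A h 0 0 - 1); have := normr_ge0 (A h 1 1 - 1).
  have := normr_ge0 (A h 1 0 + h); lra.
have c21 : A h 1 0 / h @[h --> 0^'+] --> (- 1 : R).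
  apply: (@cvg_at_right_bound _ _ _ C); near=> h.
  have h0 : 0 < h by near: h; exact: nbhs_right_gt.
  have b : `|A h 0 0 - 1| + `|A h 1 1 - 1| + `|A h 0 1 - h| + `|A h 1 0 + h| <= C * h ^+ 2.
    by near: h.
  have -> : A h 1 0 / h - -1 = (A h 1 0 + h) / h by field; rewrite gt_eqF.
  rewrite normrM (gtr0_norm (x := h^-1)) ?invr_gt0// ler_pdivrMr//.
  have := normr_ge0 (A h 0 0 - 1); have := normr_ge0 (A h 1 1 - 1).
  have := normr_ge0 (A h 0 1 - h); lra.
have c22 : (A h 1 1 - A h 0 0) / h @[h --> 0^'+] --> (0 : R).
  apply: (@cvg_at_right_bound _ _ _ C); near=> h.
  have h0 : 0 < h by near: h; exact: nbhs_right_gt.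
  have b : `|A h 0 0 - 1| + `|A h 1 1 - 1| + `|A h 0 1 - h| + `|A h 1 0 + h| <= C * h ^+ 2.
    by near: h.
  rewrite subr0 normrM (gtr0_norm (x := h^-1)) ?invr_gt0// ler_pdivrMr//.
  have := ler_distD 1 (A h 1 1) (A h 0 0); rewrite (distrC 1).
  have := normr_ge0 (A h 0 1 - h); have := normr_ge0 (A h 1 0 + h); lra.
have c1 : B h 0 0 @[h --> 0^'+] --> (0 : R).
  apply: (@cvg_at_right_bound _ _ _ D); near=> h.
  have b : `|B h 0 0| + `|B h 1 0 - 1| <= D * h by near: h.
  by rewrite subr0 (le_trans _ b)// lerDl.
have c2 : B h 1 0 @[h --> 0^'+] --> (1 : R).
  apply: (@cvg_at_right_bound _ _ _ D); near=> h.
  have b : `|B h 0 0| + `|B h 1 0 - 1| <= D * h by near: h.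
  by rewrite (le_trans _ b)// lerDr.
pose form (a b c x y : R) := a * x ^+ 2 + b * x * y - c * y ^+ 2.
have cform (a b c x y : R -> R) (a' b' c' x' y' : R) :
    a h @[h --> 0^'+] --> a' -> b h @[h --> 0^'+] --> b' -> c h @[h --> 0^'+] --> c' ->
    x h @[h --> 0^'+] --> x' -> y h @[h --> 0^'+] --> y' ->
    form (a h) (b h) (c h) (x h) (y h) @[h --> 0^'+] --> form a' b' c' x' y'.
  move=> ha hb hc hx hy; rewrite /form !expr2.
  apply: cvgB; last by apply: cvgM => //; exact: cvgM.
  apply: cvgD; first by apply: cvgM => //; exact: cvgM.
  by apply: cvgM => //; exact: cvgM.
have -> : p ^+ 2 + q ^+ 2 = form (- 1) 0 1 p q / form (-1) 0 1 0 1.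
  by rewrite /form; field.
apply: (@cvg_trans _ (form (A h 1 0 / h) ((A h 1 1 - A h 0 0) / h) (A h 0 1 / h) p q /
    form (A h 1 0 / h) ((A h 1 1 - A h 0 0) / h) (A h 0 1 / h) (B h 0 0) (B h 1 0)
    @[h --> 0^'+])).
  apply: near_eq_cvg; near=> h.
  have h0 : h != 0 by rewrite gt_eqF//; near: h; exact: nbhs_right_gt.
  have e x y : form (A h 1 0 / h) ((A h 1 1 - A h 0 0) / h) (A h 0 1 / h) x y =
      pair_det (A h) x y / h by rewrite /form /pair_det; field.
  by rewrite !e /gram invf_div mulrA divfK//.
apply: cvgM; first by apply: cform => //; exact: cvg_cst.
apply: cvgV; last exact: cform.
have -> : form (-1) 0 1 0 1 = -1 by rewrite /form; ring.
by rewrite oppr_eq0 oner_eq0.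
Unshelve. all: by end_near.
Qed.

Variable Q : {linear U0 R -> U0 R}.
Hypothesis Q_eigen : forall k, (0 < k)%N -> Q (e_ k) = eta k *: e_ k.

Lemma modified_rate_cvg_HM x : HM M x -> exists (g : R -> R) (r : R),
  [/\ rate_IM alpha Q M x = r%:E,
      \forall tau \near 0^'+, modified_rate tau (rate_IMtau A B alpha eta M tau) x = (g tau)%:E &
      g tau @[tau --> 0^'+] --> r].
Proof.
move=> xM; pose p i := dot (RePart x) (e_ i); pose q i := dot (ImPart x) (e_ i).
exists (fun tau => \sum_(i < M) pair_det (A (i.+1%:R ^+ 2 * tau)) (p i.+1) (q i.+1) /
  gram (A (i.+1%:R ^+ 2 * tau)) (B (i.+1%:R ^+ 2 * tau)) / alpha_ alpha eta i.+1 ^+ 2).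
exists ((alpha ^+ 2)^-1 * \sum_(1 <= k < M.+1) (p k ^+ 2 + q k ^+ 2) / eta k); split.
- by rewrite (rate_IM_E eta_gt0 Q_eigen) asboolT.
- near=> tau; have tau0 : 0 < tau by near: tau; exact: nbhs_right_gt.
  have st : forall k, (0 < k <= M)%N -> elliptic_step (k%:R ^+ 2 * tau).
    by near: tau; exact: near_modes.
  rewrite /modified_rate (rate_IMtau_modes st).
  rewrite /mode_sum_rate asboolT// -EFinM; congr EFin.
  rewrite big_add1 big_mkord mulr_sumr; apply: eq_bigr => i _.
  by rewrite Re_cdot_ec Im_cdot_ec /mode_rate -mulrA mulKf ?gt_eqF.
have -> : (alpha ^+ 2)^-1 * \sum_(1 <= k < M.+1) (p k ^+ 2 + q k ^+ 2) / eta k =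
    \sum_(i < M) (p i.+1 ^+ 2 + q i.+1 ^+ 2) / alpha_ alpha eta i.+1 ^+ 2.
  rewrite big_add1 big_mkord mulr_sumr; apply: eq_bigr => i _.
  have e0 : 0 < eta i.+1 by rewrite eta_gt0// ltn_ord.
  rewrite /alpha_ exprMn sqr_sqrtr ?(ltW e0)//; field.
  by rewrite (lt0r_neq0 e0) (lt0r_neq0 alpha_gt0).
apply: cvg_big => [|i _]; first exact: add_continuous.
apply: cvgMr_tmp; have i0 : 0 < i.+1%:R ^+ 2 :> R by rewrite exprn_gt0.
exact: (cvg_comp (fun t => i.+1%:R ^+ 2 * t) _ (cvg_scale_at_right i0)
  (@pair_det_ratio_cvg (p i.+1) (q i.+1))).
Unshelve. all: by end_near.
Qed.

Lemma modified_rate_cvg x :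
  modified_rate tau (rate_IMtau A B alpha eta M tau) x @[tau --> 0^'+] -->
  rate_IM alpha Q M x.
Proof.
have [xM|xM] := pselect (HM M x).
  have [g [r [-> hg gr]]] := modified_rate_cvg_HM xM.
  apply: (@cvg_trans _ ((g tau)%:E @[tau --> 0^'+])); last by apply: cvg_EFin => //; near=> tau.
  by apply: near_eq_cvg; apply: filterS hg => tau ->.
rewrite (rate_IM_E eta_gt0 Q_eigen) asboolF//.
apply: cvg_near_cst; near=> tau; have tau0 : 0 < tau by near: tau; exact: nbhs_right_gt.
by rewrite /modified_rate /rate_IMtau asboolF// gt0_muley// lte_fin invr_gt0.
Unshelve. all: by end_near.
Qed.

End FullDiscretizationRate.

Section Projections.
Context {R : realType}.
Implicit Types (x z : H0 R).

Lemma normr_PM M z : `|PM M z| ^+ 2 =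
  \sum_(1 <= k < M.+1) (dot (RePart z) (e_ k) ^+ 2 + dot (ImPart z) (e_ k) ^+ 2).
Proof. by rewrite H0_normE PME /= !normr_sine_proj big_split. Qed.

Lemma PM_cvg x (eps : R) : 0 < eps ->
  \forall M \near \oo, `|x - PM M x| < eps.
Proof.
move=> eps0; have e2 : 0 < eps / 2 by rewrite divr_gt0.
have [N1 h1] := sine_proj_cvg (RePart x) e2; have [N2 h2] := sine_proj_cvg (ImPart x) e2.
exists (maxn N1 N2) => // M /=; rewrite geq_max => /andP[/h1 m1 /h2 m2].
have re : RePart (x - PM M x) = RePart x - sine_proj M (RePart x) by rewrite PME.
have im : ImPart (x - PM M x) = ImPart x - sine_proj M (ImPart x) by rewrite PME.
rewrite -ltr_sqr ?nnegrE ?(ltW eps0)// H0_normE re im.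
have sq (a : R) : 0 <= a -> a < eps / 2 -> a ^+ 2 < (eps / 2) ^+ 2.
  by move=> a0 ae; rewrite ltr_sqr// nnegrE// ltW.
have := sq _ (normr_ge0 _) m1; have := sq _ (normr_ge0 _) m2; have := sqr_ge0 eps; lra.
Qed.

Lemma normr_PM_cvg x : `|PM M x| ^+ 2 @[M --> \oo] --> `|x| ^+ 2.
Proof.
rewrite H0_normE; under eq_fun do rewrite H0_normE PME.
by apply: cvgD; exact: sine_proj_norm_cvg.
Qed.

Lemma PM_widen M N x : (M <= N)%N ->
  (forall k, (M < k)%N -> dot (RePart x) (e_ k) = 0 /\ dot (ImPart x) (e_ k) = 0) ->
  PM N x = PM M x.
Proof.
move=> MN hx; rewrite !PME /sine_proj !(@big_cat_nat _ _ _ M.+1 1 N.+1)//=.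
have z f : (forall k, (M < k)%N -> dot f (e_ k : U0 R) = 0) ->
    \sum_(M.+1 <= k < N.+1) dot f (e_ k) *: e_ k = 0 :> U0 R.
  move=> hf; rewrite big_nat big1// => k /andP[Mk _]; by rewrite hf// scale0r.
by rewrite !z ?addr0// => k /hx[].
Qed.

End Projections.

Lemma invariant_form_bounded (R : realType) (A : 'M[R]_2) (B : 'cV[R]_2) (v : nat -> 'cV[R]_2) :
  \det A = 1 -> 0 < 4 * \det A - \tr A ^+ 2 -> B 0 0 ^+ 2 + B 1 0 ^+ 2 != 0 ->
  (forall n, v n.+1 = A *m v n) ->
  exists C : R, forall n, v n 0 0 ^+ 2 + v n 1 0 ^+ 2 <= C.
Proof.
move=> d1 el b0 vS.
have [e e0 he] := mode_rate_coercive ltr01 ltr01 d1 el b0.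
exists (mode_rate 1 1 A B (v 0%N 0 0) (v 0%N 1 0) / e) => n.
rewrite ler_pdivlMr// mulrC (le_trans (he _ _))//.
rewrite /mode_rate; suff -> : pair_det A (v n 0 0) (v n 1 0) = pair_det A (v 0%N 0 0) (v 0%N 1 0) by [].
elim: n => // n <-; rewrite vS !mulmx2 /pair_det.
move: (v n 0 0) (v n 1 0) => p q.
transitivity (\det A * (A 1 0 * p ^+ 2 + (A 1 1 - A 0 0) * p * q - A 0 1 * q ^+ 2)).
  by rewrite det2; ring.
by rewrite d1 mul1r.
Qed.

Section DeterministicLdp.
Context d (Omega : measurableType d) (R : realType) (P : probability Omega R).
Local Open Scope ereal_scope.

Lemma ldp_deterministic (X : normedModType R) (y : nat -> X) :
  y n @[n --> \oo] --> (0%R : X) ->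
  ldp P (fun N (_ : Omega) => y N) (fun x => if x == 0%R then 0 else +oo).
Proof.
move=> y0; set J := fun x : X => _.
have J0 x : 0 <= J x by rewrite /J; case: ifP.
split; first split=> //.
- apply/lower_semicontinuousP => a.
  have [a0|a0] := ltP a 0%R.
    rewrite (_ : [set x | _] = setT); first exact: openT.
    by apply/seteqP; split => // x _ /=; apply: lt_le_trans (J0 x); rewrite lte_fin.
  rewrite (_ : [set x | _] = ~` [set 0%R]).
    apply: closed_openC; apply: accessible_closed_set1; exact: hausdorff_accessible (@norm_hausdorff _ X).
  apply/seteqP; split => x /=; rewrite /J; case: eqP => // _.
    by rewrite lte_fin ltNge a0.
  by move=> _; exact: ltry.
- move=> G oG; have [G0|G0] := pselect (G 0%R).
    apply: (@le_trans _ _ 0); first by rewrite leeNl oppe0; apply: le_ereal_inf_tmp => _ [x _ <-].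
    apply: le_limn_einf; have : \forall n \near \oo, G (y n) by apply: y0; exact: open_nbhs_nbhs.
    apply: filterS => n Gy; rewrite (_ : [set w | G (y n)] = setT); last by apply/seteqP; split.
    by rewrite probability_setT lne1 mule0.
  suff -> : ereal_inf (J @` G) = +oo by rewrite leNye.
  apply/eqP; rewrite -leye_eq; apply: le_ereal_inf_tmp => _ [x Gx <-].
  by rewrite /J; case: eqP => // x0; exfalso; apply: G0; rewrite -x0.
- move=> C cC; have [C0|C0] := pselect (C 0%R).
    apply: (@le_trans _ _ 0).
      apply: limn_esup_le; near=> n.
      have n0 : (0 < n%:R :> R)%R by rewrite ltr0n; near: n; exists 1%N.
      apply: mule_ge0_le0; first by rewrite lee_fin invr_ge0 ltW.
      have [Cy|Cy] := pselect (C (y n)).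
        rewrite (_ : [set w | C (y n)] = setT); last by apply/seteqP; split.
        by rewrite probability_setT lne1.
      rewrite (_ : [set w | C (y n)] = set0); last by apply/seteqP; split.
      by rewrite measure0 le0_lneNy// leNye.
    rewrite leeNr oppe0; apply: ereal_inf_lbound; exists 0%R => //.
    by rewrite /J eqxx.
  suff -> : limn_esup (fun N : nat => (N%:R^-1)%:E * lne (P [set w | C (y N)])) = -oo by rewrite leNye.
  apply/eqP; rewrite -leeNy_eq; apply: limn_esup_le; near=> n.
  have n0 : (0 < n%:R :> R)%R by rewrite ltr0n; near: n; exists 1%N.
  have Cy : ~ C (y n).
    suff : (~` C) (y n) by [].
    by near: n; apply: y0; apply: open_nbhs_nbhs; split => //; exact: closed_openC.
  rewrite (_ : [set w | C (y n)] = set0); last by apply/seteqP; split.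
  by rewrite measure0 le0_lneNy// gt0_muleNy// lte_fin invr_gt0.
Unshelve. all: by end_near.
Qed.

End DeterministicLdp.

Section WeakPreservation.
Context d (Omega : measurableType d) (R : realType) (P : probability Omega R).
Variables (alpha : R) (eta : nat -> R) (Q Q12 : {linear U0 R -> U0 R}).
Variables (beta : nat -> R -> {RV P >-> R}) (u0 : H0 R).
Variables (A : R -> 'M[R]_2) (B : R -> 'cV[R]_2).
Hypothesis alpha_gt0 : 0 < alpha.
Hypothesis eta_ge0 : forall k, (0 < k)%N -> 0 <= eta k.
Hypothesis eta_noninc : forall k l, (0 < k)%N -> (k <= l)%N -> eta l <= eta k.
Hypothesis Q_eigen : forall k, (0 < k)%N -> Q (e_ k) = eta k *: e_ k.
Hypothesis Q12_sqrt : is_sqrt_op (@dot R) Q12 Q.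
Hypothesis Q12_bounded : exists C : R, forall f, U1_norm (Q12 f) <= C * `|f|.
Hypothesis beta_BM : forall k, (0 < k)%N -> brownian_motion (beta k).
Hypothesis beta_indep : mutually_independent P
  (fun k : nat => sigma_process (fun t w => beta k.+1 t w)).
Hypothesis near_step : \forall h \near 0^'+, elliptic_step A B h.
Hypothesis cond_iii_A : exists C : R, \forall h \near 0^'+,
  `|A h 0 0 - 1| + `|A h 1 1 - 1| + `|A h 0 1 - h| + `|A h 1 0 + h| <= C * h ^+ 2.
Hypothesis cond_iii_B : exists C : R, \forall h \near 0^'+,
  `|B h 0 0| + `|B h 1 0 - 1| <= C * h.

Lemma near_at_right_lt (S : R -> Prop) : (\forall tau \near 0^'+, S tau) ->
  exists2 tau0 : R, 0 < tau0 & forall s, 0 < s < tau0 -> S s.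
Proof.
move=> /nbhs_ballP[e e0 eS]; exists e => // s /andP[s0 se]; apply: eS => //.
by rewrite /ball /= sub0r normrN gtr0_norm.
Qed.

Lemma rate_IM_PM M z : (forall k, (0 < k <= M)%N -> 0 < eta k) ->
  rate_IM alpha Q M (PM M (cext Q12 z)) = ((alpha ^+ 2)^-1 * `|PM M z| ^+ 2)%:E.
Proof.
move=> eta_gt0; rewrite (rate_IM_E eta_gt0 Q_eigen) asboolT; last exact: PM_HM.
congr (_ * _)%:E; rewrite normr_PM; apply: eq_big_nat => k /andP[k0]; rewrite ltnS => kM.
have e0 : 0 < eta k by rewrite eta_gt0// k0.
rewrite PME /= !dot_sine_proj// kM !(dot_Q12 eta_ge0 Q_eigen Q12_sqrt)// !exprMn.
by rewrite sqr_sqrtr ?(ltW e0)// -mulrDr mulrAC divff ?mul1r// gt_eqF.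
Qed.

Lemma exists_step M x0 (r r0 eps : R) : (0 < M)%N ->
  (forall k, (0 < k <= M)%N -> 0 < eta k) ->
  HM M x0 -> rate_IM alpha Q M x0 = r%:E -> `|r0 - r| < eps ->
  exists tau0 tau : R, [/\ 0 < tau < tau0,
    (forall s, 0 < s < tau0 -> ldp P (BMN A B alpha eta beta u0 M s) (rate_IMtau A B alpha eta M s)) &
    (`|r0%:E - modified_rate tau (rate_IMtau A B alpha eta M tau) x0| < eps%:E)%E].
Proof.
move=> M0 eta_gt0 xM rE rr.
have [tau0 tau00 hl] := near_at_right_lt
  (near_BMN_ldp u0 alpha_gt0 beta_BM beta_indep eta_gt0 near_step).
have [g [r' [r'E gE gr]]] := modified_rate_cvg_HM alpha_gt0 eta_gt0 near_step
  cond_iii_A cond_iii_B Q_eigen xM.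
have {r'E}r'r : r' = r by move: r'E; rewrite rE => -[].
rewrite {}r'r in gr.
have gr0 : `|r0 - g tau| @[tau --> 0^'+] --> `|r0 - r|.
  by apply: cvg_norm; apply: cvgB => //; exact: cvg_cst.
have near_lt : \forall tau \near 0^'+, `|r0 - g tau| < eps by apply: cvgr_lt gr0 _ rr.
have : \forall tau \near 0^'+, [/\ 0 < tau < tau0, `|r0 - g tau| < eps &
    modified_rate tau (rate_IMtau A B alpha eta M tau) x0 = (g tau)%:E].
  near=> tau; split; last by near: tau.
    by apply/andP; split; near: tau; [exact: nbhs_right_gt|exact: nbhs_right_lt].
  by near: tau.
move=> /filter_ex[tau [tt lt mE]]; exists tau0, tau; split => //.
  by move=> s /hl[].
by rewrite mE -EFinB /= lte_fin.
Unshelve. all: by end_near.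
Qed.

Lemma BMN_noiseless (tau : R) (w0 : Omega) : alpha_ alpha eta 1 = 0 -> 0 < tau ->
  elliptic_step A B tau ->
  BMN A B alpha eta beta u0 1 tau = (fun N _ => BMN A B alpha eta beta u0 1 tau N w0) /\
  BMN A B alpha eta beta u0 1 tau N w0 @[N --> \oo] --> (0 : H0 R).
Proof.
move=> al0 tau0 [d1 el b0].
pose v n := pq A B alpha eta beta u0 1 tau 1 n w0.
have vE n w : pq A B alpha eta beta u0 1 tau 1 n w = v n.
  by rewrite /v; elim: n => //= n ->; rewrite al0 !mul0r.
have vS n : v n.+1 = A tau *m v n.
  by rewrite /v /= al0 !mul0r scale0r addr0 expr1n mul1r.
have [C hC] := invariant_form_bounded d1 el b0 vS.
split.
  apply/funext => N; apply/funext => w; congr (_ *: _).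
  by rewrite /full_disc !big_nat1 !vE.
have C0 : 0 <= C by apply: le_trans (hC 0%N); rewrite addr_ge0// sqr_ge0.
have nE N : `|BMN A B alpha eta beta u0 1 tau N w0| = (N%:R * tau)^-1 *
    Num.sqrt (v N 0 0 ^+ 2 + v N 1 0 ^+ 2).
  rewrite /BMN normrZ ger0_norm ?invr_ge0 ?mulr_ge0 ?(ltW tau0)//; congr (_ * _).
  rewrite /full_disc -[LHS]normr_id -sqrtr_sqr.
  by rewrite (normr_sum_ec 1 (fun k => pq A B alpha eta beta u0 1 tau k N w0 0 0 +i*
    pq A B alpha eta beta u0 1 tau k N w0 1 0)%C) big_nat1 /= !vE.
apply/norm_cvg0P; apply/cvgrPdist_le => e e0; near=> N.
have N0 : 0 < N%:R :> R by rewrite ltr0n; near: N; exists 1%N.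
have h : Num.sqrt C / tau / N%:R <= e by near: N; exact: near_infty_div_le.
rewrite sub0r normrN normr_id nE; apply: le_trans h.
rewrite -[leRHS]mulrA -invfM (mulrC tau) [leLHS]mulrC.
by rewrite ler_pM2r ?invr_gt0 ?mulr_gt0// ler_wsqrtr.
Unshelve. all: by end_near.
Qed.

Lemma weak_preservation (x : H0 R) : range (cext Q12) x -> forall eps : R, 0 < eps ->
  exists (x0 : H0 R) (M : nat) (tau0 tau : R) (I : R -> H0 R -> \bar R),
    [/\ (0 < M)%N, 0 < tau < tau0,
        (forall s, 0 < s < tau0 -> ldp P (BMN A B alpha eta beta u0 M s) (I s)),
        `|x - x0| < eps &
        (`|rate_I alpha Q12 x - modified_rate tau (I tau) x0| < eps%:E)%E].
Proof.
move=> [z _ <-] {x} eps eps0; set x := cext Q12 z.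
have [eta_pos|] := pselect (forall k, (0 < k)%N -> 0 < eta k).
  pose r M := (alpha ^+ 2)^-1 * `|PM M z| ^+ 2.
  have cr : `|(alpha ^+ 2)^-1 * `|z| ^+ 2 - r M| @[M --> \oo] --> (0 : R).
    rewrite -[X in _ --> X](normr0 R) -(subrr ((alpha ^+ 2)^-1 * `|z| ^+ 2)).
    by apply: cvg_norm; apply: cvgB; [exact: cvg_cst|apply: cvgMl_tmp; exact: normr_PM_cvg].
  have near_r : \forall M \near \oo, `|(alpha ^+ 2)^-1 * `|z| ^+ 2 - r M| < eps by apply: cvgr_lt cr _ eps0.
  have [M [M0 xM rM]] : exists M, [/\ (0 < M)%N, `|x - PM M x| < eps &
      `|(alpha ^+ 2)^-1 * `|z| ^+ 2 - r M| < eps].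
    have : \forall M \near \oo, [/\ (0 < M)%N, `|x - PM M x| < eps &
      `|(alpha ^+ 2)^-1 * `|z| ^+ 2 - r M| < eps].
      near=> M; split; [by near: M; exists 1%N|by near: M; exact: PM_cvg|by near: M].
    by move=> /filter_ex[M]; exists M.
  have eM k : (0 < k <= M)%N -> 0 < eta k by move=> /andP[/eta_pos].
  have [tau0 [tau [tt hl hm]]] := exists_step M0 eM (PM_HM M x) (rate_IM_PM z eM) rM.
  exists (PM M x), M, tau0, tau, (rate_IMtau A B alpha eta M); split => //.
  by rewrite (rate_I_inj eta_ge0 Q_eigen Q12_sqrt).
move=> /existsNP[k0 /not_implyP[k00 /negP]]; rewrite -leNgt => ek0.
have ex : exists k, (0 < k)%N && (eta k <= 0) by exists k0; rewrite k00.
case: (ex_minnP ex) => -[//|m] /andP[_ em] mmin.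
have eta_gt0 k : (0 < k <= m)%N -> 0 < eta k.
  move=> /andP[kp km]; rewrite ltNge; apply/negP => ek.
  by have := mmin k; rewrite kp ek => /(_ isT); rewrite leqNgt ltnS km.
have eta_eq0 k : (m < k)%N -> eta k = 0.
  move=> mk; have kp : (0 < k)%N by exact: leq_trans mk.
  by apply/eqP; rewrite eq_le eta_ge0// andbT (le_trans (eta_noninc _ mk)).
have rateE := rate_I_finite_rank eta_ge0 Q_eigen Q12_sqrt Q12_bounded alpha z eta_gt0 eta_eq0.
have xE (eps' : R) : 0 < eps' -> `|x - PM m x| < eps'.
  move=> e'0; have : \forall N \near \oo, (m <= N)%N /\ `|x - PM N x| < eps'.
    by near=> N; split; [near: N; exists m|near: N; exact: PM_cvg].
  move=> /filter_ex[N [mN]]; rewrite (PM_widen mN)// => k mk.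
  have kp : (0 < k)%N by exact: leq_trans mk.
  by rewrite !(dot_Q12 eta_ge0 Q_eigen Q12_sqrt)// (eta_eq0 _ mk) sqrtr0 !mul0r.
have [m0|m0] := posnP m; last first.
  have rr : `|(alpha ^+ 2)^-1 * `|PM m z| ^+ 2 - (alpha ^+ 2)^-1 * `|PM m z| ^+ 2| < eps.
    by rewrite subrr normr0.
  have [tau0 [tau [tt hl hm]]] := exists_step m0 eta_gt0 (PM_HM m x) (rate_IM_PM z eta_gt0) rr.
  exists (PM m x), m, tau0, tau, (rate_IMtau A B alpha eta m); split => //; first exact: xE.
  by rewrite rateE.
have PM0 y : PM 0 y = 0 :> H0 R by rewrite /PM big_geq.
have [tau0 tau00 hs] := near_at_right_lt near_step.
exists 0, 1%N, tau0, (tau0 / 2), (fun _ (y : H0 R) => if y == 0%R then 0%E else +oo%E).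
have t2 : 0 < tau0 / 2 < tau0 by rewrite divr_gt0//= ltr_pdivrMr// ltr_pMr// ltr1n.
split => //.
- move=> s s0; have [w0|none] := pselect (exists w : Omega, True); last first.
    have := probability_setT P; rewrite (_ : setT = set0) ?measure0.
      by move=> /eqP; rewrite eq_sym onee_eq0.
    by apply/seteqP; split => // w _; apply: none; exists w.
  case: w0 => w0 _; case/andP: (s0) => sp _.
  have al0 : alpha_ alpha eta 1 = 0 by rewrite /alpha_ eta_eq0 ?m0// sqrtr0 mulr0.
  have [-> cv] := BMN_noiseless w0 al0 sp (hs _ s0).
  exact: ldp_deterministic.
- by have := xE _ eps0; rewrite m0 PM0.
- by rewrite rateE m0 PM0 normr0 expr0n /= mulr0 /modified_rate eqxx mule0 sube0 abse0 lte_fin.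
Unshelve. all: by end_near.
Qed.

End WeakPreservation.

Theorem theorem5p6 (R : realType)
    (d : measure_display) (Omega : measurableType d) (P : probability Omega R)
    (* the stochastic Schroedinger equation: alpha, Q, Q^{1/2}, beta_k, u_0 *)
    (alpha : R) (eta : nat -> R) (Q Q12 : {linear U0 R -> U0 R})
    (beta : nat -> R -> {RV P >-> R}) (u0 : H0 R)
    (* the one-step method *)
    (A : R -> 'M[R]_2) (B : R -> 'cV[R]_2)
    (alpha_gt0 : 0 < alpha)
    (eta_ge0 : forall k, (0 < k)%N -> 0 <= eta k)
    (eta_noninc : forall k l, (0 < k)%N -> (k <= l)%N -> eta l <= eta k)
    (Q_nonneg_sym : nonneg_symmetric (@dot R) Q)
    (Q_eigen : forall k, (0 < k)%N -> Q (e_ k) = eta k *: e_ k)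
    (Q12_sqrt : is_sqrt_op (@dot R) Q12 Q)
    (Q12_HS : hilbert_schmidt_U0_U1 Q12)
    (beta_BM : forall k, (0 < k)%N -> brownian_motion (beta k))
    (beta_indep : mutually_independent P
       (fun k : nat => sigma_process (fun t w => beta k.+1 t w)))
    (u0_H10 : in_H1_0 u0)
    (B_neq0 : \forall h \near 0^'+, B h 0 0 ^+ 2 + B h 1 0 ^+ 2 != 0)
    (cond_i : exists2 h1 : R, 0 < h1 & forall h, 0 < h -> h < h1 ->
       0 < 4 * \det (A h) - (\tr (A h)) ^+ 2)
    (cond_ii : exists2 h2 : R, 0 < h2 & forall h, 0 < h -> h < h2 ->
       \det (A h) = 1)
    (cond_iii_A : exists C : R, \forall h \near 0^'+,
       `|A h 0 0 - 1| + `|A h 1 1 - 1| + `|A h 0 1 - h| + `|A h 1 0 + h|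
       <= C * h ^+ 2)
    (cond_iii_B : exists C : R, \forall h \near 0^'+,
       `|B h 0 0| + `|B h 1 0 - 1| <= C * h) :
  [/\
    (forall M : nat, (0 < M)%N -> 0 < eta M ->
       \forall tau \near 0^'+,
         ldp P (BMN A B alpha eta beta u0 M tau) (rate_IMtau A B alpha eta M tau)
         /\ good_rate_function (rate_IMtau A B alpha eta M tau)),
    (forall M : nat, (0 < M)%N -> 0 < eta M ->
       forall x : H0 R,
         modified_rate tau (rate_IMtau A B alpha eta M tau) x
           @[tau --> 0^'+] --> rate_IM alpha Q M x) &
    (forall x : H0 R, range (cext Q12) x -> forall eps : R, 0 < eps ->
       exists (x0 : H0 R) (M : nat) (tau0 tau : R) (I : R -> H0 R -> \bar R),
         [/\ (0 < M)%N,
             0 < tau < tau0,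
             (forall s, 0 < s < tau0 -> ldp P (BMN A B alpha eta beta u0 M s) (I s)),
             `|x - x0| < eps &
             (`|rate_I alpha Q12 x - modified_rate tau (I tau) x0| < eps%:E)%E])].
Proof.
have near_step : \forall h \near 0^'+, elliptic_step A B h.
  have [h1 h10 hi] := cond_i; have [h2 h20 hii] := cond_ii; near=> h.
  have h0 : 0 < h by near: h; exact: nbhs_right_gt.
  split; last by near: h.
    by apply: hii => //; near: h; exact: nbhs_right_lt.
  by apply: hi => //; near: h; exact: nbhs_right_lt.
have eta_gt0 M : 0 < eta M -> forall k, (0 < k <= M)%N -> 0 < eta k.
  by move=> eM k /andP[k0 kM]; exact: lt_le_trans (eta_noninc _ _ k0 kM).
split.
- by move=> M _ /eta_gt0 eM; exact: near_BMN_ldp.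
- move=> M _ /eta_gt0 eM x.
  by apply: modified_rate_cvg; [exact: alpha_gt0|exact: eM|..].
have [_ Q12_bounded _] := Q12_HS.
exact: (weak_preservation u0 alpha_gt0 eta_ge0 eta_noninc Q_eigen Q12_sqrt Q12_bounded
  beta_BM beta_indep near_step cond_iii_A cond_iii_B).
Unshelve. all: by end_near.
Qed.
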